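(* Let $P$ be a compact connected polyhedron of dimension $2$ such that $\operatorname{plgcat}(P) = 2$. Then $P$ $3$-deforms to the suspension of a graph.
   Context: A polyhedron is the underlying topological space of some simplicial complex; a subpolyhedron $Q \subseteq P$ is the underlying space of a subcomplex of some triangulation of $P$. As usual in PL topology, all triangulations of a polyhedron are taken compatible with its PL structure. For a finite simplicial complex $K$, a simplex $\sigma$ is a free face if there is a unique simplex $\tau \in K$ properly containing $\sigma$; then there is an elementary collapse from $K$ to $K \setminus \{\sigma,\tau\}$. A complex $K$ collapses to $L$ if there is a finite sequence of elementary collapses from $K$ to $L$; $K$ is collapsible if it collapses to a single vertex. A polyhedron is PL collapsible if some triangulation of it is collapsible. $\operatorname{plgcat}(P)$ is the minimum number of PL collapsible subpolyhedra that cover $P$. There is an $n$-deformation from a finite complex $K$ to a finite complex $L$ ($K$ $n$-deforms to $L$) if there is a finite sequence of finite complexes $K_1 = K, K_2, \dots, K_r = L$, all of dimension at most $n$, such that for every $i$ one of $K_i, K_{i+1}$ is obtained from the other by an elementary collapse. A polyhedron $P$ $n$-deforms to a polyhedron $Q$ if some triangulation of $P$ $n$-deforms to some triangulation of $Q$. A graph is a simplicial complex of dimension $1$ (finite, not necessarily connected). The suspension of $G$ is the simplicial complex $v_1G \cup v_2G$, the union of two cones over $G$ with distinct new apexes $v_1,v_2$. *)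

(* Defs.v *)
From HB Require Import structures.
From mathcomp Require Import all_boot all_order all_algebra finmap.
From mathcomp Require Import all_classical all_reals all_analysis.
From Stdlib Require Import Relation_Operators.

Set Implicit Arguments.
Unset Strict Implicit.
Unset Printing Implicit Defensive.

Import Order.TTheory GRing.Theory Num.Theory.
Import numFieldNormedType.Exports.
Local Open Scope fset_scope.
Local Open Scope ring_scope.

(** * Finite (abstract) simplicial complexes

    A finite complex is the finite set of its nonempty simplices; the empty
    simplex is not recorded.  Vertices are labelled by natural numbers, which
    is no restriction on finite complexes and leaves room for the new vertices
    that expansions introduce. *)

Definition complex := {fset {fset nat}}.

Definition is_complex (K : complex) : Prop :=
  fset0 \notin K /\
  forall s t : {fset nat}, s \in K -> t `<=` s -> t != fset0 -> t \in K.

Definition dim_le (n : nat) (K : complex) : Prop :=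
  forall s, s \in K -> (#|` s| <= n.+1)%N.

Definition has_dim (n : nat) (K : complex) : Prop :=
  dim_le n K /\ exists2 s, s \in K & #|` s| = n.+1.

Definition elementary_collapse (K L : complex) : Prop :=
  exists s t : {fset nat},
    [/\ s \in K, t \in K, s `<` t,
        (forall u, u \in K -> s `<` u -> u = t)
      & L = K `\` [fset s; t]].

Definition collapses : complex -> complex -> Prop :=
  clos_refl_trans complex elementary_collapse.

Definition collapsible (K : complex) : Prop :=
  is_complex K /\ exists v : nat, collapses K [fset [fset v]].

Definition deforms (n : nat) (K L : complex) : Prop :=
  exists (r : nat) (C : nat -> complex),
    [/\ C 0%N = K, C r = L,
        (forall i, (i <= r)%N -> is_complex (C i) /\ dim_le n (C i))
      & forall i, (i < r)%N ->
          elementary_collapse (C i) (C i.+1) \/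
          elementary_collapse (C i.+1) (C i)].

Definition graph (G : complex) : Prop := is_complex G /\ has_dim 1 G.

Definition cone (v : nat) (G : complex) : complex :=
  [fset v] |` (G `|` [fset v |` s | s in G]).

(* Only meant for v1 != v2 that are not vertices of G. *)
Definition suspension (v1 v2 : nat) (G : complex) : complex :=
  cone v1 G `|` cone v2 G.

Local Open Scope classical_set_scope.

(** * Geometric simplicial complexes in a real vector space

    A geometric simplex is given by its finite set of vertices. *)

Section Geometric.
Context {R : realType} {E : lmodType R}.
Implicit Types (s t : {fset E}) (K : set {fset E}) (x : E).

Definition barycentric s (a : E -> R) : Prop :=
  (forall v, v \in s -> 0 <= a v) /\ \sum_(v <- s) a v = 1.

Definition hull s : set E :=
  [set x | exists2 a, barycentric s a & x = \sum_(v <- s) a v *: v].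

Definition affinely_independent s : Prop :=
  forall a : E -> R, \sum_(v <- s) a v = 0 -> \sum_(v <- s) a v *: v = 0 ->
  forall v, v \in s -> a v = 0.

(* [hull fset0] is empty, so the last clause also covers disjoint simplices. *)
Definition geometric_complex K : Prop :=
  [/\ (forall s, K s -> s != fset0 /\ affinely_independent s),
      (forall s t, K s -> (t `<=` s)%fset -> t != fset0 -> K t)
    & forall s t, K s -> K t -> hull s `&` hull t = hull (s `&` t)%fset].

Definition underlying K : set E := \bigcup_(s in K) hull s.

End Geometric.

(* A polyhedron is a subset of some R^n, with the PL structure induced by R^n.
   Local finiteness makes the topology inherited from R^n agree with the weak
   topology of the complex. *)
Section Polyhedron.
Context {R : realType} {n : nat}.
Implicit Types (K : set {fset 'rV[R]_n}) (P : set 'rV[R]_n).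

Definition locally_finite K : Prop :=
  forall x : 'rV[R]_n, underlying K x ->
  exists2 U, nbhs x U & finite_set [set s | K s /\ hull s `&` U !=set0].

Definition polyhedron P : Prop :=
  exists K, [/\ geometric_complex K, locally_finite K & underlying K = P].

Definition polyhedron_dim P (d : nat) : Prop :=
  exists K,
    [/\ geometric_complex K, locally_finite K, underlying K = P,
        (forall s, K s -> (#|` s| <= d.+1)%N)
      & exists2 s, K s & #|` s| = d.+1].

End Polyhedron.

(** * Piecewise linear maps and triangulations *)

(* The realization of an abstract complex, in barycentric coordinates. *)
Definition realization (R : realType) (K : complex) : set (nat -> R^o) :=
  [set x | (forall v, 0 <= x v) /\
     exists2 s, s \in K &
       (forall v, v \notin s -> x v = 0) /\ \sum_(v <- s) x v = 1].
Arguments realization : clear implicits.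

Section PL.
Context {R : realType}.

Definition affine_on {E F : lmodType R} (s : {fset E}) (f : E -> F) : Prop :=
  forall a, barycentric s a ->
  f (\sum_(v <- s) a v *: v) = \sum_(v <- s) a v *: f v.

(* [A] is a compact polyhedron and [f] is linear on the simplices of some finite
   simplicial subdivision of it. *)
Definition pl_on {E F : lmodType R} (A : set E) (f : E -> F) : Prop :=
  exists K : set {fset E},
    [/\ finite_set K, geometric_complex K, underlying K = A
      & forall s, K s -> affine_on s f].

(* A PL bijection from a compact polyhedron is a homeomorphism with PL inverse:
   it carries a complex on which it is linear to a geometric complex. *)
Definition pl_homeo {E F : lmodType R} (A : set E) (B : set F) (f : E -> F) :
  Prop := pl_on A f /\ set_bij A B f.

Context {E : lmodType R}.
Implicit Types (P Q : set E).

Definition triangulation P (K : complex) (h : (nat -> R^o) -> E) : Prop :=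
  is_complex K /\ pl_homeo (realization R K) P h.

Definition subpolyhedron Q P : Prop :=
  exists K h L, [/\ triangulation P K h, is_complex L, (L `<=` K)%fset
                  & Q = h @` realization R L].

Definition pl_collapsible P : Prop :=
  exists K h, triangulation P K h /\ collapsible K.

Definition pl_collapsible_cover P (k : nat) : Prop :=
  exists Q : 'I_k -> set E,
    (forall i, subpolyhedron (Q i) P /\ pl_collapsible (Q i)) /\
    P = \bigcup_i Q i.

(* The value is 0 when [P] has no finite cover by PL collapsible
   subpolyhedra, and also when [P] is empty. *)
Definition plgcat P : nat :=
  xget 0%N [set k | pl_collapsible_cover P k /\
                    forall j, pl_collapsible_cover P j -> (k <= j)%N].

End PL.

Definition pl_deforms {R : realType} {E F : lmodType R} (n : nat)
    (P : set E) (Q : set F) : Prop :=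
  exists K h L g,
    [/\ triangulation P K h, triangulation Q L g & deforms n K L].

(* Main.v *)
(* Let P be the union of PL collapsible Q1 and Q2. Cut R^n along finitely many
   hyperplanes so that Q1, Q2, the simplices on which their parametrizations are
   linear, and the cells of their collapsible triangulations M1, M2 become unions
   of cells. The flags of cells of P triangulate P, with subcomplexes K1 and K2
   over Q1 and Q2 that are linear subdivisions of M1 and M2.

   A linear subdivision K of a collapsible complex M of dimension at most 2 is
   collapsible. Indeed a complex of dimension at most 2 is collapsible as soon as
   it is connected, has Euler characteristic 1, and every nonempty set of triangles
   has an edge in exactly one of them. These properties are checked along the
   collapse of M: for a removed pair of a simplex and its free facet, one moves
   the points of K lying over the pair away from that facet.

   If L is the intersection of K1 and K2, then the union of K1 and K2 expands to that of the
   cones v1 K1 and v2 K2, which collapses to the suspension of L. As a subcomplex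
   of K2, L collapses to a graph, hence so does its suspension to that of the
   graph; a whisker makes sure that the graph has an edge. *)
Require Import Defs.
From HB Require Import structures.
From mathcomp Require Import all_boot all_order all_algebra finmap.
From mathcomp Require Import all_classical all_reals all_analysis.
From mathcomp Require Import ring lra zify.
From Stdlib Require Import Relation_Operators.

Set Implicit Arguments.
Unset Strict Implicit.
Unset Printing Implicit Defensive.

Import Order.TTheory GRing.Theory Num.Theory.
Import numFieldNormedType.Exports.
Local Open Scope classical_set_scope.
Local Open Scope fset_scope.
Local Open Scope ring_scope.

(** * Collapses and deformations *)

Section Combinatorics.
Implicit Types (K L A B X Y G S : complex) (s t u : {fset nat}).

(** A collapse does not lift step by step to a subdivision: over one removed pair lies a whole
    triangulated cell, whose own collapse would have to be organized. The conditions of the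
    criterion can instead be compared across a removed pair without exhibiting any collapse
    upstairs. Two of them, connectedness and the Euler characteristic, serve to recognize as a tree
    the graph left when the triangles are gone.

    The parametrizations of Q1 and Q2 are linear on simplices that fit neither each other nor M1 and
    M2. Signs of finitely many affine forms settle all of this at once: the sets in question become
    closed under passing to smaller sign labels, and every compatibility is a statement about
    labels.

    Dimensions do not come for free either: that of P is witnessed by yet another triangulation, and
    those of M1 and M2 are not given. Both bounds follow a moment curve inside a simplex with more
    than three vertices, since no plane contains four points of the curve.

    Connectedness of P makes Q1 and Q2 meet, so that the graph has a vertex to carry the whisker. *)

Lemma fproperU1 (v : nat) s : v \notin s -> s `<` v |` s.
Proof.
move=> vs; rewrite fproperE fsubsetUr /=.
by apply/fsubsetPn; exists v; rewrite ?fset1U1.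
Qed.

Lemma collapse_facetP K L : is_complex K -> elementary_collapse K L ->
  exists v s, [/\ v \notin s, s \in K, v |` s \in K,
    forall u, u \in K -> s `<` u -> u = v |` s & L = K `\` [fset s; v |` s]].
Proof.
move=> [K0 Kdown] [s [t [sK tK st fr ->]]].
move: (st); rewrite fproperE => /andP[sst /fsubsetPn[v vt vs]].
have vst : v |` s = t.
  apply: fr; last exact: fproperU1.
  apply: (Kdown t) => //.
    by rewrite fsubUset fsub1set vt.
  by apply/fset0Pn; exists v; rewrite fset1U1.
by exists v, s; rewrite vst; split.
Qed.

Lemma collapse_subset K L : elementary_collapse K L -> L `<=` K.
Proof. by move=> [s [t [_ _ _ _ ->]]]; apply: fsubsetDl. Qed.

Lemma collapse_complex K L :
  is_complex K -> elementary_collapse K L -> is_complex L.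
Proof.
move=> cK [s [t [sK tK st fr ->]]]; case: cK => [K0 Kdown].
split; first by rewrite !inE (negPf K0) andbF.
move=> a b; rewrite !inE !negb_or => /andP[/andP[nas nat_] aK] ba b0.
rewrite (Kdown a) // andbT; apply/andP; split; last first.
  apply/negP => /eqP bt; subst b.
  by move: nat_; rewrite (fr a) ?eqxx // (fproper_sub_trans st).
apply/negP => /eqP bs; subst b.
by move: nat_; rewrite (fr a) ?eqxx // fproperEneq eq_sym nas.
Qed.

Lemma collapses_complex K L : collapses K L -> is_complex K -> is_complex L.
Proof.
by elim=> [A B AB cA|//|A B C _ IH1 _ IH2 /IH1/IH2//]; apply: collapse_complex AB.
Qed.

Lemma collapses_subset K L : collapses K L -> L `<=` K.
Proof.
elim=> [A B|A|A B C _ BA _ CB]; [exact: collapse_subset|exact: fsubset_refl|].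
exact: fsubset_trans BA.
Qed.

Lemma dim_le_subset n K L : L `<=` K -> dim_le n K -> dim_le n L.
Proof. by move=> /fsubsetP LK dK s /LK/dK. Qed.

Lemma collapses_step K L X : elementary_collapse K L -> collapses L X ->
  collapses K X.
Proof. by move=> KL; apply: rt_trans; apply: rt_step. Qed.

Lemma deforms_trans n A B C : deforms n A B -> deforms n B C -> deforms n A C.
Proof.
move=> [r [F [F0 Fr Fc Fe]]] [r' [F' [F'0 F'r F'c F'e]]].
exists (r + r')%N, (fun i => if (i <= r)%N then F i else F' (i - r)%N); split=> //.
- case: leqP => [|_]; last by rewrite addKn.
  rewrite -[X in (_ <= X)%N]addn0 leq_add2l leqn0 => /eqP r'0.
  by rewrite r'0 addn0 Fr -F'r r'0 F'0.
- move=> i ir; case: leqP => [/Fc//|ri]; apply: F'c.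
  by rewrite leq_subLR.
- move=> i ir; case: (ltngtP i r) => ri.
  + exact: Fe.
  + by rewrite subSn ?(ltnW ri) //; apply: F'e; lia.
  + rewrite subSn ?ri // subnn Fr -F'0; apply: F'e.
    by move: ir; rewrite ri -[X in (X < _)%N]addn0 ltn_add2l.
Qed.

Lemma deforms_sym n A B : deforms n A B -> deforms n B A.
Proof.
move=> [r [F [F0 Fr Fc Fe]]].
exists r, (fun i => F (r - i)%N); split; rewrite ?subn0 ?subnn //.
  by move=> i _; apply: Fc; apply: leq_subr.
move=> i ir; have -> : (r - i = (r - i.+1).+1)%N by rewrite subnSK.
by case: (Fe (r - i.+1)%N); [lia|right|left].
Qed.

Lemma collapses_deforms n A B : collapses A B -> is_complex A -> dim_le n A ->
  deforms n A B.
Proof.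
elim=> [X Y XY cX dX|X cX dX|X Y Z XY IH1 YZ IH2 cX dX].
- exists 1%N, (fun i => if i is 0%N then X else Y); split=> //.
    case=> [//|_ _]; split; first exact: collapse_complex XY.
    exact: dim_le_subset (collapse_subset XY) dX.
  by case=> [|//] _; left.
- by exists 0%N, (fun=> X); split.
- apply: (deforms_trans (IH1 cX dX)); apply: IH2.
    exact: collapses_complex XY cX.
  exact: dim_le_subset (collapses_subset XY) dX.
Qed.

(** * Cones and suspensions *)

Lemma in_cone v A s : (s \in cone v A) =
  [|| s == [fset v], s \in A | [exists t : A, s == v |` val t]].
Proof.
rewrite /cone !inE; congr [|| _, _ | _].
apply/imfsetP/existsP => /=.
  by move=> [t tA ->]; exists [` tA]; rewrite eqxx.
by move=> [[t tA] /= /eqP ->]; exists t.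
Qed.

Lemma coneP v A s : reflect
  [\/ s = [fset v], s \in A | exists2 t, t \in A & s = v |` t] (s \in cone v A).
Proof.
rewrite in_cone; apply: (iffP or3P) => -[].
- by move=> /eqP ->; constructor 1.
- by move=> sA; constructor 2.
- by move=> /existsP[[t tA] /= /eqP ->]; constructor 3; exists t.
- by move=> ->; constructor 1.
- by move=> sA; constructor 2.
- by move=> [t tA ->]; constructor 3; apply/existsP; exists [` tA] => /=.
Qed.

Lemma complexU K L : is_complex K -> is_complex L -> is_complex (K `|` L).
Proof.
move=> [K0 Kd] [L0 Ld]; split; first by rewrite inE negb_or K0.
move=> s t; rewrite !inE => /orP[sK|sL] ts t0.
  by rewrite (Kd s).
by rewrite (Ld s) // orbT.
Qed.

Lemma complexI K L : is_complex K -> is_complex L -> is_complex (K `&` L).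
Proof.
move=> [K0 Kd] [L0 Ld]; split; first by rewrite inE negb_and K0.
by move=> s t; rewrite !inE => /andP[sK sL] ts t0; rewrite (Kd s) // (Ld s).
Qed.

Lemma fsubset_U1 (v : nat) s t : s `<=` v |` t -> v \notin s -> s `<=` t.
Proof.
move=> /fsubsetP st vs; apply/fsubsetP => x xs.
by have := st x xs; rewrite !inE => /orP[/eqP xv|//]; rewrite -xv xs in vs.
Qed.

Lemma cone_complex v A : is_complex A -> is_complex (cone v A).
Proof.
move=> [A0 Ad]; split.
  apply/coneP => -[/esym/eqP|fA|[t _ /esym/eqP]].
  - by apply/negP/fset0Pn; exists v; rewrite inE.
  - by rewrite fA in A0.
  - by apply/negP/fset0Pn; exists v; rewrite fset1U1.
move=> s t /coneP sA ts t0; apply/coneP; have [vt|vt] := boolP (v \in t); last first.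
  case: sA => [sv|sA|[u uA su]].
  - have := @fsubset_U1 v t fset0; rewrite fsetU0 -sv fsubset0 => /(_ ts vt).
    by rewrite (negPf t0).
  - by constructor 2; apply: Ad ts t0.
  - by rewrite su in ts; constructor 2; apply: (Ad u) => //; apply: fsubset_U1 ts vt.
have [tv0|tv0] := eqVneq (t `\ v) fset0.
  by constructor 1; rewrite -(fsetD1K vt) tv0 fsetU0.
have tvs : t `\ v `<=` s `\ v by apply: fsetSD.
case: sA => [sv|sA|[u uA su]].
- by move: tvs; rewrite sv fsetDv fsubset0 (negPf tv0).
- constructor 2; exact: Ad ts t0.
- constructor 3; exists (t `\ v); last by rewrite fsetD1K.
  apply: (Ad u) => //; rewrite su in ts.
  by apply: (@fsubset_U1 v); rewrite ?inE ?eqxx // (fsubset_trans _ ts) // fsubsetDl.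
Qed.

Lemma cone_dim n v A : dim_le n A -> dim_le n.+1 (cone v A).
Proof.
move=> dA s /coneP[->|/dA/leqW//|[t /dA tn ->]]; first by rewrite cardfs1.
by rewrite cardfsU1; case: (_ \notin _); rewrite ?add1n ?add0n ?ltnS // leqW.
Qed.

Lemma dim_leU n A B : dim_le n A -> dim_le n B -> dim_le n (A `|` B).
Proof. by move=> dA dB s; rewrite inE => /orP[/dA|/dB]. Qed.

Definition fresh (v : nat) K := forall s, s \in K -> v \notin s.

Lemma freshP v K : is_complex K -> fresh v K <-> [fset v] \notin K.
Proof.
move=> [_ Kd]; split=> [fv|vK s sK].
  by apply/negP => /fv; rewrite inE eqxx.
apply: contra vK => vs; apply: (Kd s) => //; first by rewrite fsub1set.
by apply/fset0Pn; exists v; rewrite inE.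
Qed.

Lemma in_coneE v A : fresh v A -> fset0 \notin A -> forall s, (s \in cone v A) =
  if v \in s then (s `\ v == fset0) || (s `\ v \in A) else s \in A.
Proof.
move=> fv A0 s; apply/coneP/idP.
  case=> [->|sA|[t tA ->]].
  - by rewrite inE eqxx fsetDv eqxx.
  - by rewrite (negPf (fv s sA)).
  - by rewrite fset1U1 fsetU1K ?tA ?orbT // fv.
case: ifP => [vs /orP[/eqP sv0|sA]|_ sA].
- by constructor 1; rewrite -(fsetD1K vs) sv0 fsetU0.
- by constructor 3; exists (s `\ v); rewrite ?fsetD1K.
- by constructor 2.
Qed.

Lemma fresh_cone w v A : w != v -> fresh w A -> fresh w (cone v A).
Proof.
move=> wv fw s /coneP[->|/fw//|[t /fw wt ->]]; first by rewrite inE.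
by rewrite !inE (negPf wv).
Qed.

Lemma freshU w A B : fresh w A -> fresh w B -> fresh w (A `|` B).
Proof. by move=> fA fB s; rewrite inE => /orP[/fA|/fB]. Qed.

Lemma fresh_subset w A B : B `<=` A -> fresh w A -> fresh w B.
Proof. by move=> /fsubsetP BA fA s /BA/fA. Qed.

Lemma fsetU1_properK (v : nat) s t :
  v \notin s -> v \notin t -> (v |` s `<` v |` t) = (s `<` t).
Proof.
move=> vs vt; have H a b : v \notin a -> (v |` a `<=` v |` b) = (a `<=` b).
  move=> va; apply/idP/idP => [ab|]; last exact: fsetUS.
  by apply: (fsubset_U1 _ va); apply: fsubset_trans ab; apply: fsubsetUr.
by rewrite !fproperE !H.
Qed.

(** The base stays in [X] and only simplices through [v] are removed; those above the join of [v]
    and [s] correspond to the simplices of [A] above [s]. *)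
Lemma cone_collapse_step v X A B : is_complex A -> A `<=` X -> fresh v X ->
  elementary_collapse A B ->
  elementary_collapse (X `|` cone v A) (X `|` cone v B).
Proof.
move=> cA AX fX AB; have fA := fresh_subset AX fX.
have [u [s [us sA usA fr eB]]] := collapse_facetP cA AB.
have [A0 _] := cA; have vs := fA _ sA; have vus := fA _ usA.
have vXn t : v \in t -> t \notin X by move=> vt; apply/negP => /fX; rewrite vt.
have B0 : fset0 \notin B by rewrite eB !inE (negPf A0) andbF.
have fB : fresh v B by apply: fresh_subset fA; rewrite eB fsubsetDl.
exists (v |` s), (v |` (u |` s)); split.
- by rewrite inE; apply/orP; right; apply/coneP; constructor 3; exists s.
- by rewrite inE; apply/orP; right; apply/coneP; constructor 3; exists (u |` s).
- by rewrite fsetU1_properK // fproperU1.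
- move=> w wXA vsw; have vw : v \in w.
    by have /fsubsetP := fproper_sub vsw; apply; rewrite fset1U1.
  move: wXA; rewrite inE (negPf (vXn _ vw)) /= in_coneE // vw.
  move: vsw; rewrite -(fsetD1K vw) fsetU1_properK // ?fsetD11 //.
  rewrite fsetU1K ?fsetD11 // => sw /orP[/eqP w0|wA].
    by move: sw; rewrite w0 fproperE => /andP[_ /negP[]]; apply: fsub0set.
  by rewrite (fr _ wA sw).
- have DK (w t : {fset nat}) : v \in w -> v \notin t -> (w == v |` t) = (w `\ v == t).
    move=> vw vt; apply/eqP/eqP => [->|<-]; first by rewrite fsetU1K.
    by rewrite fsetD1K.
  apply/fsetP => w; move: (in_coneE fA A0 w) (in_coneE fB B0 w).
  move: (cone v A) (cone v B) => CA CB eCA eCB.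
  have [vw|vw] := boolP (v \in w).
    rewrite !inE eCA eCB vw !(negPf (vXn w vw)) /=.
    rewrite !DK // negb_or eB !inE negb_or.
    have [w0|//] := eqVneq (w `\ v) fset0.
    rewrite w0 /= andbT; apply/esym/andP; split.
      by apply: contraNneq A0 => ->.
    by apply: contraNneq A0 => ->.
  rewrite !inE eCA eCB (negPf vw).
  have -> : (w == v |` s) = false.
    by apply: contraNF vw => /eqP ->; rewrite fset1U1.
  have -> : (w == v |` (u |` s)) = false.
    by apply: contraNF vw => /eqP ->; rewrite fset1U1.
  rewrite /= eB !inE; apply/orP/orP => -[wX|]; [by left| |by left|].
    by case/andP; right.
  by move=> /(fsubsetP AX); left.
Qed.

Lemma cone_collapses v X A B : is_complex A -> A `<=` X -> fresh v X ->
  collapses A B -> collapses (X `|` cone v A) (X `|` cone v B).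
Proof.
move=> cA AX fX AB; elim: AB cA AX => [C D CD cC CX|C cC CX|C D E CD IH1 DE IH2 cC CX].
- by apply: rt_step; apply: cone_collapse_step.
- exact: rt_refl.
- apply: rt_trans (IH1 cC CX) _; apply: IH2.
    exact: collapses_complex CD cC.
  exact: fsubset_trans (collapses_subset CD) CX.
Qed.

(** Ends the collapse of a cone over a collapsible base: after [cone_collapses] only the edge from
    [v] to [p] is left, with [v] as its free vertex. *)
Lemma cone_point_collapses v X (p : nat) : fresh v X -> [fset p] \in X ->
  collapses (X `|` cone v [fset [fset p]]) X.
Proof.
move=> fX pX; have vp : v != p by apply/eqP => vp; move/fX: pX; rewrite vp inE eqxx.
have vXn t : v \in t -> t \notin X by move=> vt; apply/negP => /fX; rewrite vt.
have mem w : w \in cone v [fset [fset p]] =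
    [|| w == [fset v], w == [fset p] | w == v |` [fset p]].
  rewrite in_cone !inE; congr [|| _, _ | _]; apply/existsP/eqP.
    by move=> [[t /=]]; rewrite inE => /eqP -> /eqP.
  by move=> ->; exists [` fset11 [fset p]] => /=.
apply: rt_step; exists [fset v], (v |` [fset p]); split.
- by rewrite inE mem eqxx orbT.
- by rewrite inE mem eqxx !orbT.
- by rewrite fproperE fsubsetUl /=; apply/fsubsetPn; exists p;
    rewrite !inE ?eqxx ?orbT // eq_sym.
- move=> w; rewrite inE mem => wX vw; have vinw : v \in w.
    by have /fsubsetP := fproper_sub vw; apply; rewrite inE.
  move: wX; rewrite (negPf (vXn w vinw)) /= => /or3P[/eqP wv|/eqP wp|/eqP//].
    by move: vw; rewrite wv fproperEneq eqxx.
  by move: vinw; rewrite wp inE (negPf vp).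
- apply/fsetP => w; move: (mem w); move: (cone _ _) => C eC.
  rewrite !inE eC negb_or.
  have [wX|wX] := boolP (w \in X) => /=.
    rewrite andbT; apply/esym/andP; split; apply: contraTneq wX => ->; apply: vXn.
      by rewrite inE.
    by rewrite fset1U1.
  apply/esym/negbTE; rewrite !negb_and !negb_or !negbK.
  have [|] := eqVneq w [fset v] => //= _.
  have [|] := eqVneq w (v |` [fset p]) => //= _.
  by rewrite andbT; apply: contraNneq wX => ->.
Qed.

(** The removed simplices lie outside the complex [Y], which therefore contains nothing above them:
    every free face stays free. *)
Lemma collapses_union Y A B : is_complex A -> is_complex Y ->
  (forall s, s \in Y -> s \in A -> s \in B) ->
  collapses A B -> collapses (A `|` Y) (B `|` Y).
Proof.
move=> cA cY YAB AB.
elim: AB cA YAB => [C D CD cC CX|C cC CX|C D E CD IH1 DE IH2 cC CX].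
- have [s [t [sC tC st fr eD]]] := CD; have [Y0 Yd] := cY; have [C0 Cd] := cC.
  have sY : s \notin Y by apply/negP => /CX/(_ sC); rewrite eD !inE eqxx.
  have s0 : s != fset0 by apply: contraNneq C0 => <-.
  have tY : t \notin Y.
    by apply: contra sY => tY; apply: (Yd t) => //; apply: fproper_sub.
  apply: rt_step; exists s, t; split=> //; rewrite ?in_fsetU ?sC ?tC //.
    move=> u; rewrite inE => /orP[/fr//|uY su].
    by rewrite (Yd u) // ?fproper_sub in sY.
  rewrite eD fsetDUl; congr (_ `|` _); apply/fsetP => w; rewrite !inE negb_or.
  have [wY|_] := boolP (w \in Y); last by rewrite andbF.
  rewrite andbT; apply/esym/andP; split.
    by apply: contraNneq sY => <-.
  by apply: contraNneq tY => <-.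
- exact: rt_refl.
- have DC := fsubsetP (collapses_subset CD); have ED := fsubsetP (collapses_subset DE).
  apply: rt_trans (IH1 cC _) (IH2 _ _).
  + by move=> s sY sC; apply: ED; apply: CX.
  + exact: collapses_complex CD cC.
  + by move=> s sY /DC; apply: CX.
Qed.

(** The two cones go first, down to the cones over [B], while the base [A] is kept. Only then are
    the simplices of [A] outside [B] no longer covered by either cone, and the base can collapse as
    well. *)
Lemma suspension_collapses v1 v2 A B : v1 != v2 -> fresh v1 A -> fresh v2 A ->
  is_complex A -> collapses A B ->
  collapses (suspension v1 v2 A) (suspension v1 v2 B).
Proof.
move=> v12 f1 f2 cA AB; have cB := collapses_complex AB cA.
have BA := collapses_subset AB; have [A0 _] := cA; have [B0 _] := cB.
have AC v X : X `<=` cone v X.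
  by apply/fsubsetP => s sX; apply/coneP; constructor 2.
apply: rt_trans (_ : collapses (cone v2 A `|` cone v1 B) _).
  rewrite /suspension fsetUC; apply: cone_collapses => //.
  exact: fresh_cone.
have -> : cone v2 A `|` cone v1 B = (A `|` cone v1 B) `|` cone v2 A.
  rewrite [RHS]fsetUC fsetUA; congr (_ `|` _); apply/esym/fsetUidPl; exact: AC.
apply: rt_trans (_ : collapses ((A `|` cone v1 B) `|` cone v2 B) _).
  apply: cone_collapses => //; first exact: fsubsetUl.
  apply: freshU => //; apply: fresh_cone; first by rewrite eq_sym.
  exact: fresh_subset BA f2.
have -> : suspension v1 v2 B = B `|` (cone v1 B `|` cone v2 B).
  apply/esym/fsetUidPr; apply: fsubset_trans (AC v1 B) _; exact: fsubsetUl.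
rewrite -fsetUA; apply: collapses_union => //.
  by apply: complexU; apply: cone_complex.
have f1B := fresh_subset BA f1; have f2B := fresh_subset BA f2.
move=> s; rewrite inE => /orP[].
  by rewrite in_coneE //; case: ifP => // v1s _ /f1/negP[].
by rewrite in_coneE //; case: ifP => // v2s _ /f2/negP[].
Qed.

(** The simplices of [A] outside [B] are removed from the largest down, each together with its join
    with [v], which is its only proper coface once the larger ones are gone. *)
Lemma cone_shrink v Y A B : is_complex A -> is_complex B -> is_complex Y ->
  B `<=` A -> fresh v A -> fresh v Y ->
  (forall s, s \in Y -> s \in A -> s \in B) ->
  collapses (cone v A `|` Y) (cone v B `|` Y).
Proof.
move=> cA cB cY BA fA fY YAB.
have [n] := ubnP #|` A `\` B|; elim: n => // n IH in A cA BA fA YAB *.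
move=> cardAB; have [/eqP|/fset0Pn[s0 s0AB]] := eqVneq (A `\` B) fset0.
  rewrite fsetD_eq0 => AB; have -> : A = B by apply/eqP; rewrite eqEfsubset AB.
  exact: rt_refl.
have [s sAB smax] : exists2 s, s \in A `\` B &
    forall t, t \in A `\` B -> (#|` t| <= #|` s|)%N.
  have [[s sP] _ sM] := arg_maxnP (fun s : A `\` B => #|` val s|) (erefl (xpredT [` s0AB])).
  by exists s => // t tP; apply: (sM [` tP]).
have [sB sA] : s \notin B /\ s \in A by move: sAB; rewrite !inE => /andP.
have [A0 Ad] := cA; have [B0 Bd] := cB; have [Y0 Yd] := cY.
have s0' : s != fset0 by apply: contraNneq A0 => <-.
have sY : s \notin Y by apply: contra sB => /YAB; apply.
have vs := fA _ sA.
have sMax u : u \in A -> s `<` u -> False.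
  move=> uA su; have uB : u \notin B.
    by apply: contra sB => uB; apply: (Bd u) => //; apply: fproper_sub.
  have := smax u; rewrite !inE uA uB => /(_ isT).
  by rewrite leqNgt fproper_ltn_card.
have cA' : is_complex (A `\ s).
  split; first by rewrite !inE (negPf A0) andbF.
  move=> x y; rewrite !inE => /andP[xs xA] yx y0; rewrite (Ad x) // andbT.
  apply/eqP => ys; subst y; apply: (sMax x) => //.
  by rewrite fproperEneq eq_sym xs.
apply: collapses_step (IH (A `\ s) cA' _ _ _ _); last first.
- rewrite -ltnS; apply: leq_trans cardAB; rewrite ltnS; apply: fproper_ltn_card.
  rewrite fproperE fsetSD ?fsubsetDl //=; apply/fsubsetPn; exists s => //.
  by rewrite !inE eqxx andbF.
- by move=> t tY; rewrite inE => /andP[_]; apply: YAB.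
- exact: fresh_subset (fsubsetDl _ _) fA.
- apply/fsubsetP => t tB; rewrite !inE (fsubsetP BA) // andbT.
  by apply: contraNneq sB => <-.
have f' : fresh v (A `\ s) by apply: fresh_subset (fsubsetDl _ _) fA.
have A'0 : fset0 \notin A `\ s by case: cA'.
exists s, (v |` s); split.
- by rewrite inE in_coneE // (negPf vs) sA.
- by rewrite inE in_coneE // fset1U1 fsetU1K // sA orbT.
- exact: fproperU1.
- move=> w; rewrite inE => /orP[|wY sw]; last first.
    by case/negP: sY; apply: (Yd w) => //; apply: fproper_sub.
  rewrite in_coneE //; case: ifP => [vw|_ wA /(sMax w wA)//].
  move=> wA sw; have sw' : s `<=` w `\ v.
    by apply: (@fsubset_U1 v) => //; rewrite fsetD1K // fproper_sub.
  case/orP: wA => [/eqP w0|wA].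
    by move: sw'; rewrite w0 fsubset0 (negPf s0').
  have [->|ns] := eqVneq s (w `\ v); first by rewrite fsetD1K.
  by case: (sMax _ wA); rewrite fproperEneq ns.
- apply/fsetP => w; move: (in_coneE fA A0 w) (in_coneE f' A'0 w).
  move: (cone v _) (cone v _) => CA CB eCA eCB; rewrite !inE eCA eCB !inE negb_or.
  have [vw|vw] := boolP (v \in w).
    have -> : (w == s) = false by apply: contraNF vs => /eqP <-.
    have -> : (w == v |` s) = (w `\ v == s).
      apply/eqP/eqP => [->|<-]; first by rewrite fsetU1K.
      by rewrite fsetD1K.
    have -> : (w \in Y) = false by apply/negbTE/negP => /fY; rewrite vw.
    rewrite !orbF /=; have [->|//] := eqVneq (w `\ v) fset0.
    by rewrite eq_sym s0'.
  have -> : (w == v |` s) = false.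
    by apply: contraNF vw => /eqP ->; rewrite fset1U1.
  rewrite andbT; have [->|//] := eqVneq w s.
  by rewrite (negPf sY).
Qed.

Lemma nat_fset_avoid (F : {fset nat}) : exists v : nat, v \notin F.
Proof.
exists (\max_(i <- F) i).+1; apply/negP => /(@leq_bigmax_seq _ _ xpredT id).
by move=> /(_ isT); rewrite ltnn.
Qed.

Lemma exists_fresh K (F : {fset nat}) : exists2 v, fresh v K & v \notin F.
Proof.
have [v] := nat_fset_avoid (F `|` \bigcup_(s <- K) s).
rewrite inE negb_or => /andP[vF vK]; exists v => // s sK.
by apply: contra vK => vs; apply/bigfcupP; exists s; rewrite ?sK.
Qed.

(* In dimension 2 this amounts to collapsing to a graph, but it visibly passes to
   subcomplexes. *)
Definition has_free_edges K := forall S, S `<=` K -> S != fset0 ->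
  (forall t, t \in S -> #|` t| = 3%N) ->
  exists e t, [/\ t \in S, e `<=` t, #|` e| = 2%N
                & forall u, u \in S -> e `<=` u -> u = t].

Lemma has_free_edges_subset K L : L `<=` K -> has_free_edges K -> has_free_edges L.
Proof. by move=> LK fK S SL; apply: fK; apply: fsubset_trans LK. Qed.

Lemma collapse_card K L : elementary_collapse K L -> (#|` L| < #|` K|)%N.
Proof.
move=> [s [t [sK _ _ _ ->]]]; apply: fproper_ltn_card.
rewrite fproperE fsubsetDl /=; apply/fsubsetPn; exists s => //.
by rewrite !inE eqxx.
Qed.

(** The condition is applied to the set of all triangles: in dimension 2 only triangles properly
    contain an edge, so an edge of exactly one triangle is a free face. *)
Lemma free_edge_collapse K : is_complex K -> dim_le 2 K -> has_free_edges K ->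
  dim_le 1 K \/ exists e t, [/\ t \in K, e `<=` t, #|` t| = 3%N, #|` e| = 2%N &
                             elementary_collapse K (K `\` [fset e; t])].
Proof.
move=> [K0 Kd] dK fK.
have [T0|T0] := eqVneq [fset t in K | #|` t| == 3%N] fset0.
  left=> s sK; have := dK s sK; rewrite leq_eqVlt => /orP[s3|//].
  by have := in_fset0 s; rewrite -T0 !inE sK s3.
have [|t|e [t [tT et e2 fr]]] := fK _ _ T0.
- by apply/fsubsetP => t; rewrite !inE => /andP[].
- by rewrite !inE => /andP[_ /eqP].
move: tT; rewrite !inE => /andP[/= tK /eqP t3].
right; exists e, t; split=> //; exists e, t; split=> //.
- by apply: (Kd t); rewrite // -cardfs_gt0 e2.
- by rewrite fproperEneq et andbT; apply/eqP => ee; rewrite -ee e2 in t3.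
- move=> u uK eu; apply: fr (fproper_sub eu); rewrite !inE uK /= eqn_leq dK //.
  by rewrite -e2; apply: fproper_ltn_card.
Qed.

Lemma collapses_to_graph K : is_complex K -> dim_le 2 K -> has_free_edges K ->
  exists G, [/\ is_complex G, dim_le 1 G & collapses K G].
Proof.
have [n] := ubnP #|` K|; elim: n => // n IH in K *.
move=> Kn cK dK fK; have [d1|[e [t [_ _ _ _ KL]]]] := free_edge_collapse cK dK fK.
  by exists K; split=> //; apply: rt_refl.
have LK := collapse_subset KL.
have [||||G [cG dG LG]] := IH (K `\` [fset e; t]).
- by rewrite -ltnS; apply: leq_trans Kn; rewrite ltnS; apply: collapse_card.
- exact: collapse_complex KL.
- exact: dim_le_subset dK.
- exact: has_free_edges_subset fK.
by exists G; split=> //; apply: collapses_step LG.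
Qed.

Lemma collapses_neq0 K L : is_complex K -> collapses K L -> K != fset0 -> L != fset0.
Proof.
move=> cK KL; elim: KL cK => [A B AB cA _|//|A B C AB IH1 _ IH2 cA A0].
  have [v [s [vs sA vsA _ ->]]] := collapse_facetP cA AB; have [A0 Ad] := cA.
  have s0 : s != fset0 by apply: contraNneq A0 => <-.
  (* The vertex [v] opposite the free face survives, because the free face is nonempty and does not
     contain it. *)
  apply/fset0Pn; exists [fset v]; rewrite !inE negb_or; apply/andP; split; last first.
    apply: (Ad _ _ vsA); first by rewrite fsubsetUl.
    by apply/fset0Pn; exists v; rewrite inE.
  apply/andP; split; first by apply: contraNneq vs => <-; rewrite inE.
  apply: contraNneq s0 => /fsetP vvs; apply/eqP/fsetP => x; rewrite inE.
  apply/negP => xs; have := vvs x; rewrite !inE xs orbT => /eqP xv.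
  by move: vs; rewrite -xv xs.
by apply: IH2; [apply: collapses_complex AB cA|apply: IH1].
Qed.

Lemma complex_vertex K : is_complex K -> K != fset0 -> exists p, [fset p] \in K.
Proof.
move=> [K0 Kd] /fset0Pn[s sK].
have /fset0Pn[p ps] : s != fset0 by apply: contraNneq K0 => <-.
exists p; apply: (Kd s) => //; first by rewrite fsub1set.
by apply/fset0Pn; exists p; rewrite inE.
Qed.

Lemma deforms_suspension K1 K2 : dim_le 2 K1 -> dim_le 2 K2 ->
  collapsible K1 -> collapsible K2 -> has_free_edges K2 -> K1 `&` K2 != fset0 ->
  exists G v1 v2, [/\ graph G, v1 != v2, [fset v1] \notin G, [fset v2] \notin G &
    is_complex (suspension v1 v2 G) /\ deforms 3 (K1 `|` K2) (suspension v1 v2 G)].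
Proof.
move=> d1 d2 [c1 [p1 col1]] [c2 [p2 col2]] f2 L0.
pose K := K1 `|` K2; pose L := K1 `&` K2.
have cL : is_complex L := complexI c1 c2.
have LK2 : L `<=` K2 := fsubsetIr _ _.
have [||G [cG dG LG]] := collapses_to_graph cL.
- exact: dim_le_subset d2.
- exact: has_free_edges_subset f2.
have GL := collapses_subset LG.
have [p pG] := complex_vertex cG (collapses_neq0 cL LG L0).
have [w fw _] := exists_fresh K fset0.
have [v1 fv1 v1w] := exists_fresh K [fset w].
have [v2 fv2] := exists_fresh K [fset w; v1].
rewrite !inE negb_or => /andP[v2w v21]; rewrite inE in v1w.
have v12 : v1 != v2 by rewrite eq_sym.
have KG : G `<=` K.
  by apply: fsubset_trans GL _; apply: fsubset_trans LK2 _; apply: fsubsetUr.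
(* [graph] demands dimension exactly 1, whereas [G] may consist of isolated vertices. *)
pose G' := G `|` cone w [fset [fset p]].
have cpt : is_complex [fset [fset p]].
  split; first by rewrite inE; apply/negP => /eqP/fsetP/(_ p); rewrite !inE eqxx.
  move=> s t; rewrite inE => /eqP -> tp t0; rewrite inE eqEfsubset tp fsub1set.
  by have /fset0Pn[x xt] := t0; have := fsubsetP tp x xt; rewrite inE => /eqP <-.
have cG' : is_complex G' by apply: complexU => //; apply: cone_complex.
have fG' v : fresh v K -> v != w -> fresh v G'.
  move=> fv vw; apply: freshU; first exact: fresh_subset fv.
  apply: fresh_cone => // s; rewrite inE => /eqP ->; rewrite inE.
  by apply/eqP => vp; move: pG; rewrite -vp => /(fresh_subset KG fv); rewrite inE eqxx.
have f1' := fG' _ fv1 v1w; have f2' := fG' _ fv2 v2w.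
have d3 A B v v' : dim_le 2 A -> dim_le 2 B -> dim_le 3 (cone v A `|` cone v' B).
  by move=> dA dB; apply: dim_leU; apply: cone_dim.
have dL : dim_le 2 L by apply: dim_le_subset d2.
have dG' : dim_le 1 G'.
  apply: dim_leU => //; apply: cone_dim => s; rewrite inE => /eqP ->.
  by rewrite cardfs1.
have dG'2 : dim_le 2 G' by move=> s /dG'/leqW.
have cS A B v v' : is_complex A -> is_complex B -> is_complex (cone v A `|` cone v' B).
  by move=> cA cB; apply: complexU; apply: cone_complex.
have fsub v A : A `<=` K -> fresh v K -> fresh v A by move=> AK; apply: fresh_subset.
have K1K : K1 `<=` K := fsubsetUl _ _; have K2K : K2 `<=` K := fsubsetUr _ _.
have LK := fsubset_trans LK2 K2K.
exists G', v1, v2; split => //.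
- split=> //; split=> //; exists (w |` [fset p]).
    by rewrite inE; apply/orP; right; apply/coneP; constructor 3; exists [fset p];
      rewrite ?inE.
  rewrite cardfs2; case: eqVneq => // wp; move: pG; rewrite -wp.
  by move=> /(fresh_subset KG fw); rewrite inE eqxx.
- by apply/freshP.
- by apply/freshP.
split; first exact: cS.
apply: deforms_trans (_ : deforms 3 (cone v1 K1 `|` cone v2 K2) _).
  apply: deforms_sym; apply: collapses_deforms; [|exact: cS|exact: d3].
  have AC v X : X `<=` cone v X.
    by apply/fsubsetP => s sX; apply/coneP; constructor 2.
  (* With [K] put in front, the two cones collapse onto it one after the other. *)
  have -> : cone v1 K1 `|` cone v2 K2 = (K `|` cone v2 K2) `|` cone v1 K1.
    rewrite -fsetUA [cone v2 K2 `|` _]fsetUC; apply/esym/fsetUidPr.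
    by apply: fsetUSS; apply: AC.
  have pK1 : [fset p1] \in K1.
    by apply: (fsubsetP (collapses_subset col1)); rewrite inE.
  have pK2 : [fset p2] \in K2.
    by apply: (fsubsetP (collapses_subset col2)); rewrite inE.
  have fX : fresh v1 (K `|` cone v2 K2).
    apply: freshU => //; by apply: fresh_cone => //; apply: fsub.
  apply: rt_trans (cone_collapses _ _ _ col1) _ => //.
    by apply: fsubset_trans K1K _; apply: fsubsetUl.
  apply: rt_trans (cone_point_collapses fX _) _ => //.
    by rewrite inE (fsubsetP K1K).
  apply: rt_trans (cone_collapses _ _ _ col2) _ => //.
  by apply: cone_point_collapses => //; rewrite (fsubsetP K2K).
apply: deforms_trans (_ : deforms 3 (suspension v1 v2 L) _).
  apply: collapses_deforms; [|exact: cS|exact: d3].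
  (* A simplex of [cone v2 K2] that lies in [K1] avoids [v2], so it lies in [L]: shrinking the base
     of the first cone to [L] leaves the second cone intact. The second cone is then shrunk in the
     same way. *)
  apply: rt_trans (_ : collapses (cone v1 L `|` cone v2 K2) _).
    apply: cone_shrink => //; try exact: fsub; try exact: fsubsetIl.
    - exact: cone_complex.
    - by apply: fresh_cone => //; apply: fsub.
    - move=> s; rewrite in_coneE; [|exact: fsub|by case: c2].
      case: ifP => [v2s _ /(fsub _ _ K1K fv2)|_ s2 s1]; first by rewrite v2s.
      by rewrite inE s1.
  rewrite /suspension ![cone v1 L `|` _]fsetUC; apply: cone_shrink => //; try exact: fsub.
  - exact: cone_complex.
  - by apply: fresh_cone => //; apply: fsub.
  - move=> s; rewrite in_coneE; [|exact: fsub|by case: cL].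
    by case: ifP => [v1s _ /(fsub _ _ K2K fv1)|//]; rewrite v1s.
apply: deforms_trans (_ : deforms 3 (suspension v1 v2 G) _).
  apply: collapses_deforms; [|exact: cS|exact: d3].
  by apply: suspension_collapses => //; apply: fsub.
apply: deforms_sym; apply: collapses_deforms; [|exact: cS|exact: d3].
apply: suspension_collapses => //; apply: cone_point_collapses => //; exact: fsub fw.
Qed.

End Combinatorics.

(** * A collapsibility criterion in dimension 2 *)

Section Criterion.
Implicit Types (K L A B X Y G S : complex) (s t u : {fset nat}).

(** The exponent is the cardinality, not the dimension, so this is minus the Euler
    characteristic. *)
Definition euler_sum K : int := \sum_(s <- K) (-1) ^+ #|` s|.

(** Connectedness by two-colourings rather than by paths: along a collapse a colouring has to be
    changed at one vertex at most. *)
Definition vertex_connected K := forall f : nat -> bool,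
  (forall s x y, s \in K -> x \in s -> y \in s -> f x = f y) ->
  forall s t x y, s \in K -> t \in K -> x \in s -> y \in t -> f x = f y.

Lemma collapse_euler_sum K L : is_complex K -> elementary_collapse K L ->
  euler_sum L = euler_sum K.
Proof.
move=> cK KL; have [v [s [vs sK vsK _ ->]]] := collapse_facetP cK KL.
have svs : v |` s != s.
  by apply: contraNneq vs => <-; rewrite fset1U1.
rewrite /euler_sum [RHS](big_fsetD1 s) //= [X in _ + X](big_fsetD1 (v |` s)) /=; last first.
  by rewrite !inE svs.
rewrite cardfsU1 vs exprS addrA mulN1r subrr add0r; apply: eq_fbigl => w.
by rewrite !inE negb_or andbA; congr (_ && _); rewrite andbC.
Qed.

Lemma collapse_vertex_connected K L : is_complex K -> elementary_collapse K L ->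
  vertex_connected K -> vertex_connected L.
Proof.
move=> cK KL vK f fL; have LK := fsubsetP (collapse_subset KL).
have [v [s [vs sK vsK fr eL]]] := collapse_facetP cK KL; have [K0 Kd] := cK.
have /fset0Pn[x0 x0s] : s != fset0 by apply: contraNneq K0 => <-.
pose g y := if (s == [fset x0]) && (y == x0) then f v else f y.
have gL u x : u \in L -> x \in u -> g x = f x.
  move=> uL xu; rewrite /g; case: andP => // -[/eqP es /eqP ex]; subst x.
  have : u != s by apply: contraTneq uL => ->; rewrite eL !inE eqxx.
  rewrite eq_sym => nsu; have := fr _ (LK _ uL); rewrite fproperEneq nsu es fsub1set xu.
  by move=> /(_ isT) uE; move: uL; rewrite uE -es eL !inE eqxx orbT.
have gK u x y : u \in K -> x \in u -> y \in u -> g x = g y.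
  move=> uK xu yu; have [uL|] := boolP (u \in L).
    by rewrite !(gL u) //; apply: fL uL _ _.
  rewrite eL !inE uK andbT negbK => usv.
  have H z : z \in v |` s -> g z = f v.
    rewrite !inE => /orP[/eqP ->|zs]; rewrite /g.
      by case: ifP.
    case: andP => // nz.
    (* This edge survives: it contains [v], so it is not [s], and it is the larger removed simplex
       only if [z] is the whole of [s], which [nz] excludes. *)
    have zL : [fset z; v] \in L.
      rewrite eL !inE negb_or; apply/andP; split; [apply/andP; split|].
      - by apply: contraNneq vs => <-; rewrite !inE eqxx orbT.
      - apply: contra_notN nz => /eqP/fsetP zvs.
        have sz y' : y' \in s -> y' = z.
          move=> ys; have := zvs y'; rewrite !inE ys orbT.
          case/orP=> /eqP // y'v; by rewrite y'v (negPf vs) in ys.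
        rewrite (sz x0) // eqxx; split=> //; apply/eqP/fsetP => y'; rewrite inE.
        by apply/idP/eqP => [/sz|->].
      - apply: (Kd _ _ vsK).
          by apply/fsubsetP => y'; rewrite !inE => /orP[/eqP ->|->//]; rewrite zs orbT.
        by apply/fset0Pn; exists z; rewrite !inE eqxx.
    by apply: (fL _ _ _ zL); rewrite !inE eqxx ?orbT.
  have uvs z : z \in u -> z \in v |` s.
    by case/orP: usv => /eqP -> //; rewrite !inE => ->; rewrite orbT.
  by rewrite !H ?uvs.
move=> a b x y aL bL xa yb; rewrite -(gL a) // -(gL b) //.
by apply: (vK g gK a b) => //; apply: LK.
Qed.

Lemma sum1_fset (I : choiceType) (A : {fset I}) (P : pred I) :
  (\sum_(i <- A | P i) 1 = #|` [fset i in A | P i]|)%N.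
Proof. by rewrite -sum1_size big_fset_condE. Qed.

(** There is one more vertex than edges. If no vertex were a leaf, all degrees would be at least 2,
    and counting incidences would give at least as many edges as vertices. Removing a leaf with its
    edge preserves the hypotheses. *)
Lemma tree_collapses G : is_complex G -> dim_le 1 G -> vertex_connected G ->
  euler_sum G = -1 -> exists v, collapses G [fset [fset v]].
Proof.
have [n] := ubnP #|` G|; elim: n => // n IH in G *.
move=> Gn cG dG vG eG; have [G0 Gd] := cG.
pose V := [fset s in G | #|` s| == 1%N]; pose E := [fset s in G | #|` s| == 2%N].
have cVE : #|` V| = #|` E|.+1.
  have nE (P : pred {fset nat}) :
      \sum_(s <- G) (P s)%:R = #|` [fset s in G | P s]|%:R :> int.
    rewrite -sum1_fset natr_sum [RHS]big_mkcond /=.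
    by apply: eq_bigr => s _; case: (P s).
  have : euler_sum G = #|` E|%:R - #|` V|%:R.
    rewrite -!nE -sumrB; apply: eq_big_seq => s sG.
    have := dG s sG; have : #|` s| != 0%N.
      by rewrite cardfs_eq0; apply: contraNneq G0 => <-.
    by case: #|` s| => [|[|[|]]].
  by rewrite eG => VE; lia.
have card12 s : s \in G -> (#|` s| == 1%N) || (#|` s| == 2%N).
  move=> sG; have := dG s sG; have : #|` s| != 0%N.
    by rewrite cardfs_eq0; apply: contraNneq G0 => <-.
  by case: #|` s| => [|[|[|]]].
have [/eqP E0|E0] := eqVneq E fset0.
  move: cVE; rewrite -cardfs_eq0 in E0; rewrite (eqP E0) => /eqP/cardfs1P[s Vs].
  have : s \in V by rewrite Vs inE.
  rewrite !inE => /andP[sG /cardfs1P[v sv]]; exists v.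
  suff -> : G = [fset [fset v]] by apply: rt_refl.
  apply/fsetP => u; rewrite inE -sv; apply/idP/eqP => [uG|->//].
  case/orP: (card12 u uG) => u12.
    have : u \in V by rewrite !inE uG.
    by rewrite Vs inE => /eqP.
  have : u \in E by rewrite !inE uG.
  by rewrite (eqP (_ : E == fset0)) // -cardfs_eq0.
have [x [e [xG eE xe xfr]]] : exists x e, [/\ [fset x] \in G, e \in E, x \in e &
    forall e', e' \in E -> x \in e' -> e' = e].
  apply: contrapT => noleaf.
  pose D x := [fset e in E | [fset x] `<=` e].
  have deg x : [fset x] \in G -> (2 <= #|` D x|)%N.
    move=> xG; case D2 : #|` D x| => [|[|//]].
      suff : (#|` V| <= 1)%N.
        by rewrite cVE ltnS leqn0 cardfs_eq0 (negPf E0).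
      (* For an isolated vertex [x], the colouring that singles out [x] is constant on simplices, so
         connectedness leaves no other vertex. *)
      have fx s y z : s \in G -> y \in s -> z \in s -> (y == x) = (z == x).
        move=> sG ys zs; case/orP: (card12 s sG) => [/cardfs1P[w sw]|s2].
          by move: ys zs; rewrite sw !inE => /eqP -> /eqP ->.
        have sx y' : y' \in s -> (y' == x) = false.
          move=> y's; apply/negP => /eqP y'x; have := in_fset0 s.
          by rewrite -(cardfs0_eq D2) !inE sG s2 fsub1set -y'x y's.
        by rewrite !sx.
      have V1 : V `<=` [fset [fset x]].
        apply/fsubsetP => s; rewrite !inE => /andP[sG /cardfs1P[y sy]].
        have := vG _ fx s [fset x] y x sG xG; rewrite sy !inE !eqxx.
        by move=> /(_ isT isT)/eqP ->.
      by rewrite -(cardfs1 [fset x]); apply: fsubset_leq_card.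
    case: noleaf; move/eqP/cardfs1P: D2 => [e De].
    have : e \in D x by rewrite De inE.
    rewrite !inE fsub1set => /andP[eE xe]; exists x, e; split => //; first by rewrite !inE.
    move=> e' e'E xe'; have : e' \in D x by rewrite !inE fsub1set xe' andbT; move: e'E;
      rewrite !inE.
    by rewrite De inE => /eqP.
  have : (#|` V| * 2 <= #|` E| * 2)%N.
    have -> : (#|` V| * 2 = \sum_(s <- V) 2)%N by rewrite big_const_seq count_predT
      iter_addn_0 mulnC.
    have -> : (#|` E| * 2 = \sum_(s <- E) 2)%N by rewrite big_const_seq count_predT
      iter_addn_0 mulnC.
    apply: leq_trans (_ : \sum_(s <- V) \sum_(e <- E | s `<=` e) 1 <= _)%N.
      rewrite !big_seq; apply: leq_sum => s.
      rewrite !inE => /andP[sG /cardfs1P[x sx]]; rewrite sum1_fset sx.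
      by apply: deg; rewrite -sx.
    rewrite (exchange_big_dep xpredT) //= !big_seq; apply: leq_sum => e.
    rewrite !inE => /andP[eG' /eqP e2]; rewrite sum1_fset -[X in (_ <= X)%N]e2.
    have sub : [fset s in V | s `<=` e] `<=` [fset [fset x] | x in e].
      apply/fsubsetP => s; rewrite !inE /=.
      move=> /andP[/andP[sG /cardfs1P[x ->]]]; rewrite fsub1set => xe.
      by apply/imfsetP; exists x.
    by apply: leq_trans (fsubset_leq_card sub) _; apply: leq_imfset_card.
  by rewrite cVE leq_pmul2r // ltnn.
have [eG' /eqP e2] : e \in G /\ #|` e| == 2%N by move: eE; rewrite !inE => /andP.
have Gcol : elementary_collapse G (G `\` [fset [fset x]; e]).
  exists [fset x], e; split=> //.
    by rewrite fproperEneq fsub1set xe andbT; apply/eqP => xE; rewrite -xE cardfs1 in e2.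
  move=> u uG xu; apply: xfr; last by rewrite -fsub1set fproper_sub.
  rewrite !inE uG /=; have := card12 u uG; have := fproper_ltn_card xu.
  by rewrite cardfs1; case: #|` u| => [|[|[|]]].
have [|||||v cv] := IH (G `\` [fset [fset x]; e]).
- by rewrite -ltnS; apply: leq_trans Gn; rewrite ltnS; apply: collapse_card.
- exact: collapse_complex Gcol.
- exact: dim_le_subset (collapse_subset Gcol) dG.
- exact: collapse_vertex_connected Gcol vG.
- by rewrite (collapse_euler_sum cG Gcol).
by exists v; apply: collapses_step cv.
Qed.

Lemma collapsible_criterion K : is_complex K -> dim_le 2 K -> has_free_edges K ->
  vertex_connected K -> euler_sum K = -1 -> collapsible K.
Proof.
move=> cK dK fK vK eK; split=> //; have [G [cG dG KG]] := collapses_to_graph cK dK fK.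
have [vG eG] : vertex_connected G /\ euler_sum G = -1.
  elim: KG cK vK eK {fK dK cG dG} => [A B AB cA vA eA|//|A B C AB IH1 _ IH2 cA vA eA].
    split; first exact: collapse_vertex_connected AB vA.
    by rewrite (collapse_euler_sum cA AB).
  by have [vB eB] := IH1 cA vA eA; apply: IH2 => //; apply: collapses_complex AB cA.
have [v Gv] := tree_collapses cG dG vG eG; exists v.
exact: rt_trans Gv.
Qed.

Lemma big_fset3 (I : choiceType) (V : nmodType) (x y z : I) (F : I -> V) :
  x != y -> x != z -> y != z -> \sum_(v <- [fset x; y; z]) F v = F x + F y + F z.
Proof.
move=> xy xz yz; rewrite fsetUC big_fsetU1 /= ?big_fsetU1 /= ?big_seq_fset1.
- by rewrite addrC.
- by rewrite inE.
- by rewrite !inE negb_or ![z == _]eq_sym xz.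
Qed.

Lemma fset2P (I : choiceType) (e : {fset I}) : #|` e| = 2%N ->
  exists x y, x != y /\ e = [fset x; y].
Proof.
move=> e2; have /fset0Pn[x xe] : e != fset0 by rewrite -cardfs_gt0 e2.
have : #|` e `\ x| == 1%N by move: e2; rewrite (cardfsD1 x) xe add1n => -[->].
move=> /cardfs1P[y ye]; exists x, y; split.
  by move: (fset11 y); rewrite -ye !inE eq_sym => /andP[].
by rewrite -(fsetD1K xe) ye.
Qed.

Lemma fset3P (I : choiceType) (t : {fset I}) : #|` t| = 3%N ->
  exists x y z, [/\ x != y, x != z, y != z & t = [fset x; y; z]].
Proof.
move=> t3; have /fset0Pn[z zt] : t != fset0 by rewrite -cardfs_gt0 t3.
have : #|` t `\ z| = 2%N by move: t3; rewrite (cardfsD1 z) zt add1n => -[->].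
move=> /fset2P[x [y [xy tz]]]; exists x, y, z.
have H w : w \in [fset x; y] -> w != z by rewrite -tz !inE => /andP[].
by split; rewrite // ?H ?inE ?eqxx ?orbT // -tz fsetUC fsetD1K.
Qed.

End Criterion.

(** * Linear subdivisions of collapsible complexes *)

Section Carried.
Context {R : realType}.
Implicit Types (s t : {fset nat}) (x y : nat -> R).

(** Barycentric coordinates of the points of the open simplex on [s]. A point of a realization has
    exactly one such [s], its support ([realizationP], [carried_inj]). *)
Definition carried s y := [/\ forall v, v \in s -> 0 < y v,
  forall v, v \notin s -> y v = 0 & \sum_(v <- s) y v = 1].

Lemma realizationP (K : complex) y : is_complex K ->
  realization R K y <-> exists2 s, s \in K & carried s y.
Proof.
move=> [K0 Kd]; split; last first.
  move=> [s sK [y0 ys s1]]; split; last by exists s.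
  by move=> v; have [/y0/ltW//|/ys ->//] := boolP (v \in s).
move=> [y0 [s sK [ys s1]]].
pose t := [fset v in s | y v != 0].
have ts : t `<=` s by apply/fsubsetP => v; rewrite !inE => /andP[].
have t1 : \sum_(v <- t) y v = 1.
  rewrite -s1; apply: big_fset_incl => // v vs; rewrite !inE vs /=.
  by rewrite negbK => /eqP.
exists t.
  apply: (Kd s) => //; apply/eqP => t0; move: t1; rewrite t0 big_seq_fset0.
  by move/esym/eqP; rewrite oner_eq0.
split=> // v; rewrite !inE; first by move=> /andP[_ yv]; rewrite lt_neqAle eq_sym yv y0.
by have [vs /=|/ys ->//] := boolP (v \in s); rewrite negbK => /eqP.
Qed.

Lemma sum_carried s t y (F : nat -> R) : carried s y -> s `<=` t ->
  \sum_(v <- t) y v * F v = \sum_(v <- s) y v * F v.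
Proof.
move=> [_ ys _] st; apply/esym; apply: big_fset_incl => // v _ /ys ->.
by rewrite mul0r.
Qed.

Lemma carried_inj s t y : carried s y -> carried t y -> s = t.
Proof.
move=> [y0 ys _] [y0' yt _]; apply/fsetP => v; apply/idP/idP.
  by move=> /y0; apply: contraTT => /yt ->; rewrite ltxx.
by move=> /y0'; apply: contraTT => /ys ->; rewrite ltxx.
Qed.

Definition barycenter s (v : nat) : R := if v \in s then #|` s|%:R^-1 else 0.

Lemma barycenter_carried s : s != fset0 -> carried s (barycenter s).
Proof.
rewrite -cardfs_gt0 => s0; split.
- by move=> v vs; rewrite /barycenter vs invr_gt0 ltr0n.
- by move=> v /negPf vs; rewrite /barycenter vs.
rewrite (eq_big_seq (fun=> #|` s|%:R^-1)); last by move=> v vs; rewrite /barycenter vs.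
rewrite big_const_seq count_predT iter_addr_0 -[_ *+ size _]mulr_natr mulVf //.
by rewrite pnatr_eq0 -lt0n.
Qed.

Lemma eventually_pos (I : eqType) (s : seq I) (x y : I -> R) :
  (forall v, v \in s -> 0 < x v \/ x v = 0 /\ 0 < y v) ->
  exists2 e0, 0 < e0 & forall e, 0 < e <= e0 -> forall v, v \in s -> 0 < x v + e * y v.
Proof.
elim: s => [_|v s IH H]; first by exists 1.
have [w ws|e0 e00 He0] := IH; first by apply: H; rewrite inE ws orbT.
have [e1 e10 He1] : exists2 e1, 0 < e1 & forall e, 0 < e <= e1 -> 0 < x v + e * y v.
  have [xv|[xv yv]] := H v (mem_head _ _); last first.
    by exists 1 => // e /andP[e0' _]; rewrite xv add0r mulr_gt0.
  (* The summand 1 keeps the denominator positive when [y v] is 0. *)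
  exists (x v / (1 + `|y v|)) => [|e /andP[e0' ee]].
    by rewrite divr_gt0 // ltr_pwDl.
  have y1 : 0 < 1 + `|y v| by rewrite ltr_pwDl.
  move: ee; rewrite ler_pdivlMr // mulrDr mulr1 => ee.
  have : - (e * `|y v|) <= e * y v by rewrite -mulrN ler_pM2l // lerNl -normrN ler_norm.
  by lra.
exists (Num.min e0 e1); first by rewrite lt_min e00.
move=> e /andP[ep]; rewrite le_min => /andP[ee0 ee1] w; rewrite inE => /orP[/eqP ->|ws].
  by apply: He1; rewrite ep.
by apply: He0 => //; rewrite ep.
Qed.

Lemma infinite_pigeonhole (T : eqType) (r : seq T) (P : nat -> T -> Prop) :
  (forall n, exists2 x, x \in r & P n x) ->
  exists2 x, x \in r & forall N, exists2 n, (N <= n)%N & P n x.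
Proof.
elim: r P => [P /(_ 0%N)[]//|x r IH P H].
have [inf|] := EM (forall N, exists2 n, (N <= n)%N & P n x).
  by exists x => //; apply: mem_head.
move=> /existsNP[N /forall2NP Nx].
have [n|y yr Hy] := IH (fun n => P (N + n)%N).
  have [y] := H (N + n)%N; rewrite inE => /orP[/eqP -> Px|yr Py]; last by exists y.
  by case: (Nx (N + n)%N) => //; rewrite leq_addr.
exists y; first by rewrite inE yr orbT.
move=> N'; have [n N'n Pn] := Hy N'; exists (N + n)%N => //.
by rewrite (leq_trans N'n) // leq_addl.
Qed.

Lemma involution_sum0 (I : choiceType) (V : numDomainType) (A : {fset I})
    (g : I -> I) (F : I -> V) :
  (forall i, i \in A -> [/\ g i \in A, g (g i) = i & F (g i) = - F i]) ->
  \sum_(i <- A) F i = 0.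
Proof.
move=> gA; have eA : [fset g i | i in A] = A.
  apply/fsetP => i; apply/imfsetP/idP => /= [[j /gA[jA _ _] -> //]|iA].
  by have [giA ggi _] := gA _ iA; exists (g i).
have : \sum_(i <- A) F i = - \sum_(i <- A) F i.
  rewrite -{1}eA big_imfset /=.
    by rewrite -sumrN; apply: eq_big_seq => i /gA[].
  by move=> i j /gA[_ gi _] /gA[_ gj _] /(congr1 g); rewrite gi gj.
by move/eqP; rewrite -addr_eq0 -mulr2n mulrn_eq0 => /eqP.
Qed.

End Carried.

Section Subdivision.
Context {R : realType}.
Implicit Types (s t : {fset nat}) (x y : nat -> R).
Variables (M K : complex) (q : nat -> nat -> R).

Definition comb s y (a : nat) : R := \sum_(v <- s) y v * q v a.

(* [q v] is the position in the realization of [M] of the vertex [v] of [K]; each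
   simplex of [K] is mapped affinely into a simplex of [M], and these maps are
   together a bijection between the realizations. *)
Record subdivides : Prop := {
  sub_complex : is_complex K;
  sub_carrier : forall s, s \in K ->
    exists2 m, m \in M & forall v a, v \in s -> a \notin m -> q v a = 0;
  sub_vertex : forall s v, s \in K -> v \in s -> realization R M (q v);
  sub_inj : forall s t y z, s \in K -> t \in K -> carried s y -> carried t z ->
    (forall a, comb s y a = comb t z a) -> forall v, y v = z v;
  sub_surj : forall x, realization R M x ->
    exists s y, [/\ s \in K, carried s y & forall a, x a = comb s y a] }.

Hypotheses (cM : is_complex M) (sK : subdivides).

Let cK := sub_complex sK.

(** The simplex of [M] whose interior contains the image of the interior of [s] ([comb_carried]).
    The union over [M] only provides a finite set to select from. *)
Definition carrier s :=
  [fset a in \bigcup_(m <- M) m | has (fun v => q v a != 0) s].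

Lemma sub_neq0 s : s \in K -> s != fset0.
Proof. by move=> sK'; case: cK => K0 _; apply: contraNneq K0 => <-. Qed.

Lemma sub_face s t : t \in K -> s `<=` t -> s != fset0 -> s \in K.
Proof. by case: cK => _; apply. Qed.

Lemma q_ge0 s v a : s \in K -> v \in s -> 0 <= q v a.
Proof. by move=> sK' /(sub_vertex sK sK')[+ _]. Qed.

Lemma carrierP s a : s \in K -> reflect (exists2 v, v \in s & q v a != 0) (a \in carrier s).
Proof.
move=> sK'; rewrite !inE; apply: (iffP andP) => [[_ /hasP]//|[v vs qva]].
split; last by apply/hasP; exists v.
have [m mM qm] := sub_carrier sK sK'; apply/bigfcupP; exists m; first by rewrite mM.
by apply: contraNT qva => am; rewrite (qm v).
Qed.

Lemma carrier_subset s t : s `<=` t -> carrier s `<=` carrier t.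
Proof.
move=> /fsubsetP st; apply/fsubsetP => a; rewrite !inE => /andP[-> /hasP[v vs qv]].
by apply/hasP; exists v => //; apply: st.
Qed.

Lemma carrier_out s v a : s \in K -> v \in s -> a \notin carrier s -> q v a = 0.
Proof.
move=> sK' vs; apply: contraNeq => qva; apply/carrierP => //; by exists v.
Qed.

Lemma sum_q s v : s \in K -> v \in s -> \sum_(a <- carrier s) q v a = 1.
Proof.
move=> sK' vs; have := sub_vertex sK sK' vs.
move=> /(realizationP _ cM)[m mM qm]; have [_ qm0 <-] := qm.
rewrite -(eq_bigr _ (fun a _ => mulr1 (q v a))) -[RHS](eq_bigr _ (fun a _ => mulr1 (q v
  a))).
apply: sum_carried => //; apply/fsubsetP => a am; apply/carrierP => //.
by exists v => //; apply: lt0r_neq0; case: qm => + _ _; apply.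
Qed.

Lemma sum_comb s t y : t \in K -> s `<=` t ->
  \sum_(a <- carrier t) comb s y a = \sum_(v <- s) y v.
Proof.
move=> tK st; rewrite /comb exchange_big /=; apply: eq_big_seq => v vs.
by rewrite -mulr_sumr sum_q ?mulr1 // (fsubsetP st).
Qed.

Lemma comb_carried s y : s \in K -> carried s y -> carried (carrier s) (comb s y).
Proof.
move=> sK' [y0 ys y1]; split; last by rewrite sum_comb.
  move=> a /(carrierP _ sK')[v vs qva]; rewrite /comb (big_fsetD1 v) //=.
  rewrite ltr_pwDl //; last first.
    rewrite big_seq; apply: sumr_ge0 => w; rewrite !inE => /andP[_ ws].
    by rewrite mulr_ge0 ?(q_ge0 _ sK') // ltW // y0.
  by rewrite mulr_gt0 ?y0 // lt_neqAle eq_sym qva (q_ge0 _ sK').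
move=> a aC; rewrite /comb big_seq big1 // => v vs.
by rewrite (carrier_out sK') // mulr0.
Qed.

Lemma carrier_in s : s \in K -> carrier s \in M.
Proof.
move=> sK'; have [m mM qm] := sub_carrier sK sK'; have [_ Md] := cM.
apply: (Md m) => //.
  apply/fsubsetP => a /(carrierP _ sK')[v vs]; apply: contraNT => am.
  by rewrite (qm v).
apply/eqP => c0; have := comb_carried sK' (barycenter_carried (sub_neq0 sK')).
by case=> _ _; rewrite c0 big_seq_fset0 => /esym/eqP; rewrite oner_eq0.
Qed.

Lemma comb_widen s t y : carried s y -> s `<=` t -> forall a, comb t y a = comb s y a.
Proof. by move=> ys st a; apply: sum_carried. Qed.

Lemma combD s y z (e : R) a : comb s (fun v => y v + e * z v) a = comb s y a + e * comb s
  z a.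
Proof.
rewrite /comb mulr_sumr -big_split; apply: eq_bigr => v _ /=.
by rewrite mulrDl mulrA.
Qed.

Lemma sumD s y z (e : R) : \sum_(v <- s) (y v + e * z v) =
  \sum_(v <- s) y v + e * \sum_(v <- s) z v.
Proof. by rewrite mulr_sumr -big_split. Qed.

Definition restr s y (v : nat) : R := if v \in s then y v else 0.

Lemma comb_restr s y a : comb s (restr s y) a = comb s y a.
Proof. by apply: eq_big_seq => v vs; rewrite /restr vs. Qed.

Lemma sum_restr s y : \sum_(v <- s) restr s y v = \sum_(v <- s) y v.
Proof. by apply: eq_big_seq => v vs; rewrite /restr vs. Qed.

Lemma carried_restr s y : (forall v, v \in s -> 0 < y v) -> \sum_(v <- s) y v = 1 ->
  carried s (restr s y).
Proof.
move=> y0 y1; split; last by rewrite sum_restr.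
  by move=> v vs; rewrite /restr vs y0.
by move=> v vs; rewrite /restr (negPf vs).
Qed.

(** Affine independence from injectivity: a relation among the vertices would move the barycenter of
    [t] inside [t] without moving its image. *)
Lemma sub_indep t y : t \in K -> \sum_(v <- t) y v = 0 ->
  (forall a, comb t y a = 0) -> forall v, v \in t -> y v = 0.
Proof.
move=> tK y1 yq; have bt := barycenter_carried (R := R) (sub_neq0 tK).
have [b0 _ b1] := bt.
have [|e0 e00 He] := @eventually_pos R _ t (barycenter t) y; first by move=> v /b0; left.
have ez : carried t (restr t (fun v => barycenter t v + e0 * y v)).
  by apply: carried_restr; [apply: He; rewrite e00 lexx|rewrite sumD y1 mulr0 addr0].
have := sub_inj sK tK tK bt ez; move=> H v vt.
have {H} : barycenter t v = restr t (fun v => barycenter t v + e0 * y v) v.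
  by apply: H => a; rewrite comb_restr combD yq mulr0 addr0.
rewrite /restr vt => bE; have /eqP : e0 * y v = 0 by lra.
by rewrite mulf_eq0 gt_eqF //= => /eqP.
Qed.

(* [t] carries the beginning of the ray from [x] in the direction [d]; [al] and
   [be] are the coordinates of [x] and [d] in it. *)
Lemma local_direction (x d : nat -> R) e0 : 0 < e0 ->
  (forall e, 0 < e <= e0 -> realization R M (fun a => x a + e * d a)) ->
  exists t al be, [/\ t \in K, forall a, x a = comb t al a,
    forall a, d a = comb t be a, \sum_(v <- t) al v = 1 & \sum_(v <- t) be v = 0 /\
    forall v, v \in t -> 0 < al v \/ al v = 0 /\ 0 < be v].
Proof.
move=> e00 H; pose ep n : R := e0 / n.+1%:R.
have ep0 n : 0 < ep n by rewrite divr_gt0 // ltr0n.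
have epe n : 0 < ep n <= e0.
  by rewrite ep0 /= ler_pdivrMr ?ltr0n // ler_peMr ?(ltW e00) // ler1n.
pose P n t := exists2 y, carried t y & forall a, x a + ep n * d a = comb t y a.
(* The points of the ray at the parameters [ep n], which tend to 0, lie in finitely many open
   simplices, so one of these contains infinitely many of them. *)
have [n|t tK inf] := @infinite_pigeonhole _ K P.
  have [s [y [sK' ys ye]]] := sub_surj sK (H _ (epe n)).
  by exists s => //; exists y.
have [k1 _ [y1 c1 E1]] := inf 0%N.
have [k2 k12 [y2 c2 E2]] := inf k1.+1.
have epn : ep k1 - ep k2 != 0.
  rewrite subr_eq0 /ep; apply/negP => /eqP/(mulfI (lt0r_neq0 e00))/invr_inj/eqP.
  by rewrite eqr_nat eqSS => /eqP k; rewrite k ltnn in k12.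
(* Two points in the same simplex determine the line: [be] is the difference quotient of their
   coordinates, and [al] extrapolates to parameter 0. *)
pose be v := (ep k1 - ep k2)^-1 * (y1 v - y2 v).
pose al v := y1 v + (- ep k1) * be v.
have [p1 o1 s1] := c1; have [p2 o2 s2] := c2.
have sbe : \sum_(v <- t) be v = 0 by rewrite -mulr_sumr sumrB s1 s2 subrr mulr0.
have sal : \sum_(v <- t) al v = 1 by rewrite sumD s1 sbe mulr0 addr0.
have dE a : d a = comb t be a.
  have -> : comb t be a = (ep k1 - ep k2)^-1 * (comb t y1 a - comb t y2 a).
    rewrite /comb -sumrB mulr_sumr; apply: eq_bigr => v _.
    by rewrite /be -mulrA mulrBl.
  by rewrite -E1 -E2; field.
have xE a : x a = comb t al a by rewrite combD -E1 -dE; ring.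
clearbody al; clearbody be.
have pos : (forall N, exists2 n, (N <= n)%N & forall v, v \in t -> 0 < al v + ep n * be v).
  move=> N; have [n Nn [y cy Ey]] := inf N; exists n => // v vt.
  have [p0 o0 s0] := cy.
  suff yv : (al v + ep n * be v) + (-1) * y v = 0.
    have := p0 v vt; lra.
  apply: (@sub_indep t (fun v => (al v + ep n * be v) + (-1) * y v)) => //.
    by rewrite !sumD sal sbe s0; ring.
  by move=> a; rewrite !combD -Ey -xE -dE; ring.
exists t, al, be; split=> //; split=> // v vt.
(* As [ep n] tends to 0, a negative [al v] would make [al v + ep n * be v] negative for large
   [n]. *)
have al0 : 0 <= al v.
  rewrite leNgt; apply/negP => aln.
  have : 0 < - al v / (e0 * (1 + `|be v|)).
    by rewrite divr_gt0 ?oppr_gt0 // mulr_gt0 // ltr_pwDl.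
  move=> /ltr_add_invr[] N; rewrite add0r => HN.
  have [n Nn /(_ v vt)] := pos N.
  have b1 : 0 < 1 + `|be v| by rewrite ltr_pwDl.
  have en : ep n <= e0 * N.+1%:R^-1.
    by rewrite /ep ler_pM2l // lef_pV2 ?posrE ?ltr0n // ler_nat.
  have : ep n * (1 + `|be v|) < - al v.
    apply: le_lt_trans (_ : e0 * N.+1%:R^-1 * (1 + `|be v|) < _).
      by rewrite ler_pM2r.
    by rewrite mulrAC mulrC -ltr_pdivlMr // mulr_gt0.
  have : ep n * be v <= ep n * (1 + `|be v|).
    by rewrite ler_pM2l //; apply: le_trans (ler_norm _) _; rewrite lerDr.
  by lra.
have [n _ /(_ v vt) pn] := pos 0%N.
move: al0; rewrite le_eqVlt => /orP[/eqP al0|]; [right|by left].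
by split=> //; move: pn; rewrite -al0 add0r pmulr_rgt0.
Qed.

Lemma sum_carried1 s t y : carried s y -> s `<=` t -> \sum_(v <- t) y v = 1.
Proof.
move=> ys st; have [_ _ <-] := ys.
rewrite (eq_bigr (fun v => y v * 1)) => [|v _]; last by rewrite mulr1.
rewrite (sum_carried (fun=> 1) ys st); apply: eq_bigr => v _; by rewrite mulr1.
Qed.

Lemma sub_injE s t y z : s \in K -> t \in K -> carried s y -> carried t z ->
  (forall a, comb s y a = comb t z a) -> s = t /\ y = z.
Proof.
move=> sK' tK ys zt E; have yz : y = z by apply/funext; apply: (sub_inj sK) ys zt E.
by split=> //; apply: carried_inj zt; rewrite -yz.
Qed.

(** * The cell over a removed pair *)

Section Facet.
Variables (m : {fset nat}) (u : nat).
Hypotheses (um : u \notin m) (mM : m \in M) (umM : u |` m \in M).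

(* Points into [u |` m] from its facet [m], and out of every other facet. *)
Let d (a : nat) : R := if a == u then 1 else if a \in m then - #|` m|%:R^-1 else 0.

(** [t] is the simplex entered on leaving the interior of [s] in the direction [d]. The coordinates
    on [s] are positive at the start, so only the others have to increase. *)
Definition into s t := [/\ t \in K, s `<=` t, carrier t = u |` m &
  exists be, [/\ \sum_(v <- t) be v = 0, forall a, d a = comb t be a &
                 forall v, v \in t -> v \notin s -> 0 < be v]].

Lemma facet_card_gt0 : (0 < #|` m|)%N.
Proof.
by rewrite cardfs_gt0; case: cM => M0 _; apply: contraNneq M0 => <-.
Qed.

Lemma sum_d : \sum_(a <- u |` m) d a = 0.
Proof.
rewrite big_fsetU1 //= /d eqxx (eq_big_seq (fun=> - #|` m|%:R^-1)); last first.
  by move=> a am; rewrite am; case: eqVneq => // au; move: um; rewrite -au am.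
rewrite big_const_seq count_predT iter_addr_0 mulNrn -[_ *+ size _]mulr_natr mulVf ?subrr
  //.
by rewrite pnatr_eq0 -lt0n facet_card_gt0.
Qed.

(** From the image of the barycenter of [s], the direction [d] leads into the open simplex on [u]
    and [m], so [local_direction] applies. *)
Lemma into_exists s : s \in K -> carrier s = m \/ carrier s = u |` m ->
  exists t, into s t.
Proof.
move=> sK' cs; pose b : nat -> R := barycenter s; pose x := comb s b.
have bs : carried s b := barycenter_carried (sub_neq0 sK').
have xc : carried (carrier s) x := comb_carried sK' bs.
have mc : m `<=` carrier s by case: cs => -> //; apply: fsubsetUr.
have cum : carrier s `<=` u |` m by case: cs => -> //; apply: fsubsetUr.
have [x0 xo x1] := xc.
have [|e0 e00 He] := @eventually_pos R _ (u |` m) x d.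
  move=> a; rewrite !inE => /orP[/eqP ->|am]; last by left; apply/x0/(fsubsetP mc).
  have [uc|uc] := boolP (u \in carrier s); first by left; apply: x0.
  by right; rewrite xo // /d eqxx.
have cH e : 0 < e <= e0 -> carried (u |` m) (fun a => x a + e * d a).
  move=> ee; split=> [a /(He _ ee)//|a|].
    rewrite !inE negb_or => /andP[/negPf au /negPf am].
    rewrite /d au am mulr0 addr0 xo //; apply: contraFN am => /(fsubsetP cum).
    by rewrite !inE au.
  by rewrite sumD sum_d mulr0 addr0 (sum_carried1 xc).
have [e ee|t [al [be [tK xt dt s1 [s0 ab]]]]] := local_direction e00 (x := x) (d := d).
  by apply/(realizationP _ cM); exists (u |` m) => //; apply: cH.
have [e1 e10 He1] := eventually_pos ab.
(* The starting coordinates [al] may vanish on a part of [t]. Their support carries the same point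
   as the barycenter of [s], so it is [s] by injectivity. *)
pose t' := [fset v in t | 0 < al v].
have al0 v : v \in t -> v \notin t' -> al v = 0.
  move=> vt; rewrite !inE vt /=; case: (ab v vt) => [->//|[-> _]//].
have t't : t' `<=` t by apply/fsubsetP => v; rewrite !inE => /andP[].
have s1' : \sum_(v <- t') al v = 1.
  by rewrite -s1; apply: big_fset_incl => // v vt vt'; apply: al0.
have t'K : t' \in K.
  apply: sub_face tK t't _; apply/eqP => t0; move: s1'; rewrite t0 big_seq_fset0.
  by move/esym/eqP; rewrite oner_eq0.
have ct' : carried t' (restr t' al).
  by apply: carried_restr => // v; rewrite !inE => /andP[].
have [et' _] : t' = s /\ restr t' al = b.
  apply: sub_injE => // a; rewrite comb_restr -/x.
  rewrite -/(x a) xt; apply: big_fset_incl => // v vt vt'.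
  by rewrite al0 // mul0r.
have ct : carrier t = u |` m.
  pose e := Num.min e0 e1.
  have ee0 : 0 < e <= e0 by rewrite /e lt_min e00 e10 ge_min lexx.
  have ee1 : 0 < e <= e1 by rewrite /e lt_min e00 e10 ge_min lexx orbT.
  have := cH e ee0; have := @comb_carried t (restr t (fun v => al v + e * be v)) tK.
  rewrite (_ : comb _ _ = (fun a => x a + e * d a)); last first.
    by apply/funext => a; rewrite comb_restr combD -xt -dt.
  move=> H; apply: carried_inj; apply: H; apply: carried_restr; first exact: He1.
  by rewrite sumD s1 s0 mulr0 addr0.
exists t; split=> //; first by rewrite -et'.
exists be; split=> // v vt vs; case: (ab v vt) => [al1|[]//].
by move: vs; rewrite -et' !inE vt al1.
Qed.

Lemma into_step s t : s \in K -> into s t -> exists be e0, [/\ 0 < e0,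
  forall e, 0 < e <= e0 -> carried t (restr t (fun v => barycenter s v + e * be v)) &
  forall e, comb t (restr t (fun v => barycenter s v + e * be v)) =
            (fun a => comb s (barycenter s) a + e * d a)].
Proof.
move=> sK' [tK st ct [be [s0 dt be0]]].
have bs := barycenter_carried (R := R) (sub_neq0 sK'); have [b0 bo b1] := bs.
have [|e0 e00 He] := @eventually_pos R _ t (barycenter s) be.
  move=> v vt; have [vs|vs] := boolP (v \in s); first by left; apply: b0.
  by right; rewrite bo // be0.
exists be, e0; split=> // [e ee|e].
  apply: carried_restr; first exact: He.
  by rewrite sumD s0 mulr0 addr0 (sum_carried1 bs).
apply/funext => a; rewrite comb_restr combD -dt; congr (_ + _).
exact: comb_widen.
Qed.

(** A point slightly after the start lies in the interior of both simplices. *)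
Lemma into_unique s t t' : s \in K -> into s t -> into s t' -> t = t'.
Proof.
move=> sK' st st'; have [tK _ _ _] := st; have [tK' _ _ _] := st'.
have [be [e0 [e00 c1 E1]]] := into_step sK' st.
have [be' [e0' [e00' c1' E1']]] := into_step sK' st'.
pose e := Num.min e0 e0'.
have ee0 : 0 < e <= e0 by rewrite /e lt_min e00 e00' ge_min lexx.
have ee1 : 0 < e <= e0' by rewrite /e lt_min e00 e00' ge_min lexx orbT.
have [|//] := sub_injE tK tK' (c1 e ee0) (c1' e ee1).
by move=> a; rewrite E1 E1'.
Qed.

(** The direction [d] decreases the coordinates in [m]; if one of them were 0 at the start, it would
    become negative at once. *)
Lemma into_carrier s t : s \in K -> into s t -> carrier s = m \/ carrier s = u |` m.
Proof.
move=> sK' st; have [tK sst ct _] := st; have [be [e0 [e00 c1 E1]]] := into_step sK' st.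
have ee : 0 < e0 <= e0 by rewrite e00 lexx.
have := comb_carried tK (c1 _ ee); rewrite E1 ct => -[p _ _].
have xc := comb_carried sK' (barycenter_carried (R := R) (sub_neq0 sK')).
have [x0 xo x1] := xc.
have mc a : a \in m -> a \in carrier s.
  move=> am; apply/negPn/negP => ac; have := p a; rewrite fset1Ur // => /(_ isT).
  rewrite xo // add0r /d am; case: eqVneq => [au|_]; first by move: um; rewrite -au am.
  by rewrite mulrN oppr_gt0 ltNge ltW // mulr_gt0 // invr_gt0 ltr0n facet_card_gt0.
have cu a : a \in carrier s -> a \in u |` m.
  by rewrite -ct; apply/fsubsetP/carrier_subset.
have [uc|uc] := boolP (u \in carrier s); [right|left]; apply/fsetP => a.
  apply/idP/idP => [/cu//|]; rewrite in_fset1U => /orP[/eqP -> //|/mc //].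
apply/idP/idP => [ac|/mc//]; have := cu a ac; rewrite !inE => /orP[/eqP au|//].
by rewrite -au ac in uc.
Qed.

(** The coordinates of [d] in [t] are unique by [sub_indep], so positivity off [s] holds for any
    choice of them. *)
Lemma into_up s t be : s \in K -> into s t -> \sum_(v <- t) be v = 0 ->
  (forall a, d a = comb t be a) -> forall v, v \in t -> v \notin s -> 0 < be v.
Proof.
move=> sK' [tK _ _ [be' [s0 dt bp]]] s0' dt' v vt vs.
have : be v + (-1) * be' v = 0.
  apply: (@sub_indep t (fun v => be v + (-1) * be' v)) => //.
    by rewrite (sumD _ be be') s0 s0'; ring.
  by move=> a; rewrite (combD _ be be') -dt -dt'; ring.
have := bp v vt vs; lra.
Qed.

(* For a given [t], the simplices [s] with [into s t] form an interval of the
   face lattice of [t] that ends at [t] and does not consist of [t] alone: toggling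
   a fixed vertex that does not belong to its least element reverses signs. *)
Lemma euler_facet :
  \sum_(s <- K | (carrier s == m) || (carrier s == u |` m)) (-1) ^+ #|` s| = 0 :> int.
Proof.
rewrite big_fset_condE.
pose pos t w := w \in t /\ exists be, [/\ \sum_(v <- t) be v = 0,
  forall a, d a = comb t be a & 0 < be w].
pose T s := xget fset0 (into s).
(* The toggled vertex depends on [t] alone, so [s] and its toggle, which have the same [t], toggle
   the same vertex. Its positive coefficient allows removing it from [s] without leaving the
   interval. *)
pose W t := xget 0%N (pos t).
have TI s : s \in K -> carrier s = m \/ carrier s = u |` m -> into s (T s).
  move=> sK' /(into_exists sK')[t st]; exact: xgetI st.
pose g s := let w := W (T s) in if w \in s then s `\ w else w |` s.
apply: (involution_sum0 (g := g)) => s; rewrite !inE => /andP[/= sK' cs].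
have {}cs : carrier s = m \/ carrier s = u |` m by case/orP: cs => /eqP; [left|right].
have st := TI s sK' cs; set t := T s in st.
have [tK sst ct [be [s0 dt bp]]] := st.
have Wt : pos t (W t).
  (* The coefficients sum to 0; if none were positive, all would vanish, although [d u] is 1. *)
  have [w [wt bw]] : exists w, w \in t /\ 0 < be w.
    apply: contrapT => H; have be0 v : v \in t -> be v <= 0.
      by move=> vt; rewrite leNgt; apply/negP => bv; apply: H; exists v.
    have bz v : v \in t -> be v = 0.
      move=> vt; apply/eqP; rewrite eq_le be0 //=.
      have := s0; rewrite (big_fsetD1 v) //= => /eqP; rewrite addr_eq0 => /eqP ->.
      rewrite oppr_ge0 big_seq; apply: sumr_le0 => w; rewrite !inE => /andP[_]; exact: be0.
    have := dt u; rewrite /d eqxx /comb big_seq big1 => [/eqP|v vt];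
      last by rewrite bz // mul0r.
    by rewrite oner_eq0.
  by apply: (@xgetI _ 0%N (pos t) w); split=> //; exists be.
have [wt [be' [s0' dt' bw]]] := Wt.
set w := W t in wt bw.
have gE : g s = if w \in s then s `\ w else w |` s by [].
have gt : g s `<=` t.
  rewrite gE; case: ifP => ws; first by apply: fsubset_trans sst; apply: fsubsetDl.
  by rewrite fsubUset sst fsub1set wt.
have upv := into_up sK' st s0' dt'.
(* If [w] were the only vertex of [s], all coefficients on [t] would be positive, while their sum is
   0. *)
have g0 : g s != fset0.
  rewrite gE; case: ifP => ws; last by apply/fset0Pn; exists w; rewrite fset1U1.
  apply/eqP => sw0; move: s0'; rewrite (big_fsetD1 w) //=.
  move/eqP; apply/negP/lt0r_neq0; rewrite ltr_pwDl //.
  rewrite big_seq; apply: sumr_ge0 => v; rewrite !inE => /andP[vw vt]; apply/ltW/upv => //.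
  apply/negP => vs; have := in_fset0 v; rewrite -sw0 !inE vw vs //.
have gK : g s \in K by apply: sub_face tK gt g0.
have gt' : into (g s) t.
  split=> //; exists be'; split=> // v vt; rewrite gE; case: ifP => ws; rewrite !inE.
    rewrite negb_and negbK => /orP[/eqP ->//|]; exact: upv.
  by rewrite negb_or => /andP[_]; apply: upv.
have gc := into_carrier gK gt'.
have Tg : T (g s) = t by exact: (into_unique gK (TI _ gK gc) gt').
split.
- by apply/andP; split; [exact: gK|case: gc => ->; rewrite eqxx ?orbT].
- rewrite {1}/g Tg -/w gE; have [ws|ws] := boolP (w \in s).
    by rewrite fsetD11 fsetD1K.
  by rewrite fset1U1 fsetU1K.
- rewrite gE; case: ifP => ws; last by rewrite cardfsU1 ws exprS mulN1r.
  by rewrite [in RHS](cardfsD1 w) ws exprS mulN1r opprK.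
Qed.

(** Moving along [d] raises the coordinate at [u] with speed 1, and all coefficients off [w] are
    positive, so some vertex of [t] must lie higher than [w]. *)
Lemma facet_ascent w : [fset w] \in K ->
  carrier [fset w] = m \/ carrier [fset w] = u |` m ->
  exists v t, [/\ t \in K, w \in t, v \in t, carrier t = u |` m & q w u < q v u].
Proof.
move=> wK cw; have [t wt] := into_exists wK cw.
have [tK]: into [fset w] t := wt.
rewrite fsub1set => wt' ct [be [s0 dt bp]].
apply: contrapT => H; have qle v : v \in t -> q v u <= q w u.
  move=> vt; rewrite leNgt; apply/negP => qwv; apply: H.
  by exists v, t.
have : d u = \sum_(v <- t) be v * (q v u - q w u).
  have -> : d u = \sum_(v <- t) be v * q v u - (\sum_(v <- t) be v) * q w u.
    by rewrite s0 mul0r subr0 dt.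
  rewrite mulr_suml -sumrB.
  by apply: eq_bigr => v _; rewrite mulrBr.
rewrite /d eqxx => E; have : (1 : R) <= 0; last by rewrite ler10.
rewrite E big_seq; apply: sumr_le0 => v vt; have [->|vw] := eqVneq v w.
  by rewrite subrr mulr0.
by rewrite pmulr_rle0 ?subr_le0 ?qle // bp // inE.
Qed.

(** Consecutive vertices of an ascent share a simplex, hence a colour. The coordinate at [u]
    strictly increases, so the ascent ends, and it can only end in the remaining boundary of the
    cell. *)
Lemma facet_vertex_connected (f : nat -> bool) :
  (forall s (x y : nat), s \in K -> x \in s -> y \in s -> f x = f y) ->
  forall w, [fset w] \in K -> carrier [fset w] = m \/ carrier [fset w] = u |` m ->
  exists w', [/\ [fset w'] \in K, carrier [fset w'] `<=` u |` m,
    carrier [fset w'] != m, carrier [fset w'] != u |` m & f w = f w'].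
Proof.
move=> fK w.
have [n] := ubnP #|` [fset v in \bigcup_(s <- K) s | q w u < q v u]|.
elim: n => // n IH in w * => Nw wK cw.
have [v [t [tK wt vt ct qwv]]] := facet_ascent wK cw.
have vK : [fset v] \in K.
  by apply: (sub_face tK); [rewrite fsub1set|apply/fset0Pn; exists v; rewrite inE].
have cv : carrier [fset v] `<=` u |` m.
  by rewrite -ct; apply: carrier_subset; rewrite fsub1set.
rewrite (fK t w v) //.
have Nv : (#|` [fset v' in \bigcup_(s <- K) s | (q v u < q v' u)%R]| < n)%N.
  rewrite -ltnS; apply: leq_trans Nw; rewrite ltnS; apply: fproper_ltn_card.
  rewrite fproperE; apply/andP; split.
    apply/fsubsetP => a; rewrite !inE => /andP[-> /=]; exact: lt_trans.
  apply/fsubsetPn; exists v; rewrite !inE ?ltxx ?andbF // qwv andbT.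
  by apply/bigfcupP; exists t; rewrite ?tK.
have [cvm|cvm] := eqVneq (carrier [fset v]) m.
  by apply: IH => //; left.
have [cvt|cvt] := eqVneq (carrier [fset v]) (u |` m); last by exists v.
by apply: IH => //; right.
Qed.

End Facet.

(** What is left at the end of the collapse of [M]: over a single point, injectivity allows a single
    simplex, and as its vertices lie over the same point, it is a vertex itself. *)
Lemma carrier_point p : [fset p] \in M -> exists w,
  [/\ [fset w] \in K, carrier [fset w] = [fset p] &
      forall s, s \in K -> carrier s = [fset p] -> s = [fset w]].
Proof.
move=> pM; pose x : nat -> R := barycenter [fset p].
have p0 : [fset p] != fset0 by apply/fset0Pn; exists p; rewrite inE.
have cx : carried [fset p] x := barycenter_carried p0.
have [|s [y [sK' ys xs]]] := sub_surj sK (x := x).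
  by apply/(realizationP _ cM); exists [fset p].
have cs t : t \in K -> carrier t = [fset p] -> t = s.
  move=> tK ct; have bt := barycenter_carried (R := R) (sub_neq0 tK).
  have [|//] := sub_injE tK sK' bt ys; move=> a; rewrite -xs.
  have := comb_carried tK bt; rewrite ct => -[_ cb1 cb2]; have [_ x1 x2] := cx.
  have [->|ap] := eqVneq a p; last by rewrite cb1 ?x1 // inE.
  by move: cb2 x2; rewrite !big_seq_fset1 => -> ->.
have cs' : carrier s = [fset p].
  have := comb_carried sK' ys; rewrite (_ : comb s y = x); last by apply/funext => a;
    rewrite xs.
  by move=> cc; apply: carried_inj cc cx.
have /fset0Pn[w ws] := sub_neq0 sK'.
have wK : [fset w] \in K.
  by apply: (sub_face sK'); [rewrite fsub1set|apply/fset0Pn; exists w; rewrite inE].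
have cw : carrier [fset w] = [fset p].
  apply/eqP; rewrite eqEfsubset -{1}cs' carrier_subset ?fsub1set //=.
  have /fset0Pn[a aw] : carrier [fset w] != fset0.
    by case: cM => M0 _; apply: contraNneq M0 => <-; apply: carrier_in.
  have : a \in carrier s by apply: (fsubsetP (carrier_subset _)) aw; rewrite fsub1set.
  by rewrite cs' inE => /eqP <-.
exists w; split=> // t tK /(cs t tK) ->; exact/esym/cs.
Qed.

Lemma euler_collapse A B : is_complex A -> A `<=` M -> collapses A B ->
  \sum_(s <- K | carrier s \in B) (-1) ^+ #|` s| =
  \sum_(s <- K | carrier s \in A) (-1) ^+ #|` s| :> int.
Proof.
move=> cA AM AB; elim: AB cA AM => [X Y XY cX XM|//|X Y Z XY IH1 YZ IH2 cX XM]; last first.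
  rewrite IH2 ?IH1 //; first exact: collapses_complex XY cX.
  exact: fsubset_trans (collapses_subset XY) XM.
have [v [m [vm mX vmX _ ->]]] := collapse_facetP cX XY.
rewrite [RHS](bigID (fun s => (carrier s == m) || (carrier s == v |` m))) /=.
rewrite [X in _ = X + _](_ : _ = 0) ?add0r.
  by apply: eq_bigl => s; rewrite !inE andbC.
rewrite -[RHS](euler_facet vm (fsubsetP XM _ mX) (fsubsetP XM _ vmX)).
apply: eq_bigl => s; case: eqVneq => [->|_]; first by rewrite mX.
by case: eqVneq => [->|_]; rewrite ?vmX // andbF.
Qed.

Lemma connected_collapse (f : nat -> bool) A B :
  (forall s (x y : nat), s \in K -> x \in s -> y \in s -> f x = f y) ->
  is_complex A -> A `<=` M -> collapses A B ->
  (forall w w', [fset w] \in K -> [fset w'] \in K -> carrier [fset w] \in B ->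
     carrier [fset w'] \in B -> f w = f w') ->
  forall w w', [fset w] \in K -> [fset w'] \in K -> carrier [fset w] \in A ->
     carrier [fset w'] \in A -> f w = f w'.
Proof.
move=> fK cA AM AB; elim: AB cA AM => [X Y XY cX XM|//|X Y Z XY IH1 YZ IH2 cX XM fZ];
  last first.
  apply: IH1 => //; apply: IH2 => //; first exact: collapses_complex XY cX.
  exact: fsubset_trans (collapses_subset XY) XM.
have [v [m [vm mX vmX _ ->]]] := collapse_facetP cX XY.
move=> fY; have low w : [fset w] \in K -> carrier [fset w] \in X -> exists w',
    [/\ [fset w'] \in K, carrier [fset w'] \in X `\` [fset m; v |` m] & f w = f w'].
  move=> wK wX; have [mw|mw] := boolP (carrier [fset w] \in [fset m; v |` m]); last first.
    by exists w; split=> //; rewrite in_fsetD mw.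
  have [|w' [w'K sub n1 n2 fw]] := facet_vertex_connected vm (fsubsetP XM _ mX)
    (fsubsetP XM _ vmX) fK wK.
    by move: mw; rewrite in_fset2 => /orP[] /eqP ->; [left|right].
  exists w'; split=> //; rewrite in_fsetD in_fset2 negb_or n1 n2 /=.
  case: cX => X0 Xd; apply: (Xd _ _ vmX sub).
  by case: cM => M0 _; apply: contraNneq M0 => <-; apply: carrier_in.
move=> w w' wK w'K wX w'X; have [a [aK aY ->]] := low w wK wX.
by have [b [bK bY ->]] := low w' w'K w'X; apply: fY.
Qed.

Hypothesis colM : collapsible M.

Lemma subdivision_euler_sum : euler_sum K = -1.
Proof.
case: colM => _ [p Mp]; have pM : [fset p] \in M.
  by apply: (fsubsetP (collapses_subset Mp)); rewrite inE.
have := euler_collapse cM (fsubset_refl M) Mp.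
have [w [wK cw wu]] := carrier_point pM.
rewrite /euler_sum [X in _ = X](_ : _ = \sum_(s <- K) (-1) ^+ #|` s|); last first.
  by rewrite big_seq_cond [RHS]big_seq; apply: eq_bigl => s;
    case: (boolP (s \in K)) => // /carrier_in ->.
move=> <-; rewrite big_fset_condE.
rewrite (_ : [fset s in K | _] = [fset [fset w]]) ?big_seq_fset1 ?cardfs1 //.
apply/fsetP => s; apply/idP/idP.
  by rewrite in_fset => /andP[/= sK']; rewrite !in_fset1 => /eqP /(wu s sK') ->.
by rewrite in_fset1 => /eqP ->; rewrite in_fset /=; apply/andP; split=> //;
  rewrite cw in_fset1.
Qed.

Lemma subdivision_connected : vertex_connected K.
Proof.
case: colM => _ [p Mp]; have pM : [fset p] \in M.
  by apply: (fsubsetP (collapses_subset Mp)); rewrite inE.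
have [w [wK cw wu]] := carrier_point pM.
move=> f fK s t x y sK' tK xs yt.
have vK s' (x' : nat) : s' \in K -> x' \in s' -> [fset x'] \in K.
  move=> s'K x's; apply: (sub_face s'K); rewrite ?fsub1set //.
  by apply/fset0Pn; exists x'; rewrite inE.
have [xK yK] := (vK s x sK' xs, vK t y tK yt).
apply: (connected_collapse fK cM (fsubset_refl M) Mp) => //; try exact: carrier_in.
move=> a b aK bK; rewrite !in_fset1 => /eqP /(wu _ aK) ab /eqP /(wu _ bK) bb.
have := fset11 a; have := fset11 b; rewrite {1}bb {1}ab !in_fset1.
by move=> /eqP -> /eqP ->.
Qed.

(** More vertices than coordinates would give a linear relation between the rows [q v]. Each row
    sums to 1, so the coefficients sum to 0, against [sub_indep]. *)
Lemma card_le_carrier t : t \in K -> (#|` t| <= #|` carrier t|)%N.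
Proof.
move=> tK; rewrite leqNgt; apply/negP => lt_c.
pose A : 'M[R]_(#|` t|, #|` carrier t|) :=
  \matrix_(i, j) q (nth 0%N t i) (nth 0%N (carrier t) j).
have : kermx A != 0.
  rewrite -mxrank_eq0 mxrank_ker -lt0n subn_gt0.
  by apply: leq_ltn_trans (rank_leq_col A) lt_c.
move=> /rowV0Pn[w /sub_kermxP wA w0].
pose y v := if insub (index v t) is Some i then w 0 i else 0.
have yE (i : 'I_(#|` t|)) : y (nth 0%N t i) = w 0 i.
  rewrite /y index_uniq ?fset_uniq // insubT //= => ilt.
  by congr (w 0 _); apply: val_inj.
have cy a : comb t y a = 0.
  have [aC|aC] := boolP (a \in carrier t); last first.
    by rewrite /comb big_seq big1 // => v vt; rewrite (carrier_out tK vt) // mulr0.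
  have jlt : (index a (carrier t) < #|` carrier t|)%N by rewrite index_mem.
  have := congr1 (fun B : 'rV_(_) => B 0 (Ordinal jlt)) wA; rewrite !mxE => <-.
  rewrite /comb (big_nth 0%N) big_mkord; apply: eq_bigr => i _.
  by rewrite yE mxE /= nth_index.
have y0 := @sub_indep t y tK.
apply/negP: w0; rewrite negbK; apply/eqP/rowP => i; rewrite mxE -yE.
apply: y0 => //; last by rewrite mem_nth.
by rewrite -(sum_comb y tK (fsubset_refl t)) big1.
Qed.

(** * Flux through sets of triangles over one triangle *)

Section Triangle.
Variables (u a b : nat).
Hypotheses (ua : u != a) (ub : u != b) (ab : a != b).
Implicit Types (v w : nat).

(** This describes the affine plane of the triangle; signs of the coordinates are not recorded. *)
Definition inside v := [/\ q v u + q v a + q v b = 1 &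
  forall c, c \notin [fset u; a; b] -> q v c = 0].

(** The determinant of the barycentric coordinates of three points: their signed area in units of
    that of the triangle on [u], [a], [b]. *)
Definition det3 (i j k : nat) : R :=
  q i u * (q j a * q k b - q j b * q k a) - q i a * (q j u * q k b - q j b * q k u)
  + q i b * (q j u * q k a - q j a * q k u).

(** In the same units, the signed area of the triangle from [u] to the edge [ij], which is up to a
    constant the flux of the field [x - u] across that edge. On a side through [u] it vanishes, as
    the coordinate at [a] or at [b] is 0 at both ends. *)
Definition flux (i j : nat) : R := q i a * q j b - q i b * q j a.

Lemma inside_carrier t v : t \in K -> carrier t = [fset u; a; b] -> v \in t -> inside v.
Proof.
move=> tK ct vt; split; last by move=> c; rewrite -ct; apply: carrier_out.
by rewrite -(sum_q tK vt) ct big_fset3.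
Qed.

Section Vertices.
Variables (i j k : nat).
Hypotheses (ij : i != j) (ik : i != k) (jk : j != k).
Hypotheses (tK : [fset i; j; k] \in K).
Hypotheses (hi : inside i) (hj : inside j) (hk : inside k).

Lemma indep3 (al be ga : R) : al + be + ga = 0 ->
  (forall c, c \in [fset u; a; b] -> al * q i c + be * q j c + ga * q k c = 0) ->
  [/\ al = 0, be = 0 & ga = 0].
Proof.
move=> s0 H; pose y v := if v == i then al else if v == j then be else ga.
have [yi yj yk] : [/\ y i = al, y j = be & y k = ga].
  by rewrite /y !eqxx ![_ == i]eq_sym (negPf ij) (negPf ik) [k == j]eq_sym (negPf jk).
have H0 : forall v, v \in [fset i; j; k] -> y v = 0.
  apply: sub_indep => //; first by rewrite big_fset3 // yi yj yk.
  move=> c; rewrite /comb big_fset3 // yi yj yk.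
  have [/H//|cn] := boolP (c \in [fset u; a; b]).
  have [_ /(_ c cn) ->] := hi; have [_ /(_ c cn) ->] := hj; have [_ /(_ c cn) ->] := hk.
  by rewrite !mulr0 !addr0.
by rewrite -yi -yj -yk !H0 // !inE eqxx ?orbT.
Qed.

(** If the determinant vanishes, cofactors give linear relations between the three rows, so
    independence kills all minors of the rows [i] and [j]. Both rows sum to 1, hence they are equal,
    which independence forbids again. *)
Lemma det3_neq0 : det3 i j k != 0.
Proof.
apply/eqP => D0; have [si _] := hi; have [sj _] := hj; have [sk _] := hk.
have minors (c c' : nat) : c \in [fset u; a; b] -> c' \in [fset u; a; b] ->
    q i c * q j c' - q i c' * q j c = 0.
  have E c1 c2 : (forall c, c \in [fset u; a; b] ->
     (q j c1 * q k c2 - q j c2 * q k c1) * q i c + (q k c1 * q i c2 - q k c2 * q i c1) * q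
       j c
     + (q i c1 * q j c2 - q i c2 * q j c1) * q k c = 0) -> q i c1 * q j c2 - q i c2 * q j
         c1 = 0.
    move=> H; have [] // := indep3 _ H.
    (* Multiplying each coefficient by its row sum 1 turns the sum of the coefficients into a sum of
       the relations at [u], [a] and [b]. *)
    rewrite -(mulr1 (q j c1 * _ - _)) -[X in _ + X + _]mulr1 -[X in _ + X]mulr1 -{1}si
      -{1}sj -sk.
    have := H u; have := H a; have := H b;
      rewrite !inE !eqxx !orbT /= => /(_ isT) Hb /(_ isT) Ha /(_ isT) Hu.
    by move: Hb Ha Hu; lra.
  have Eua := E u a; have Eub := E u b; have Eab := E a b.
  have {}Eua : q i u * q j a - q i a * q j u = 0.
    apply: Eua => c0; rewrite !inE -orbA => /or3P[]/eqP ->; move: D0; rewrite /det3; lra.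
  have {}Eub : q i u * q j b - q i b * q j u = 0.
    apply: Eub => c0; rewrite !inE -orbA => /or3P[]/eqP ->; move: D0; rewrite /det3; lra.
  have {}Eab : q i a * q j b - q i b * q j a = 0.
    apply: Eab => c0; rewrite !inE -orbA => /or3P[]/eqP ->; move: D0; rewrite /det3; lra.
  rewrite !inE -!orbA => /or3P[]/eqP -> /or3P[]/eqP ->; lra.
have [|c cin|/eqP] := @indep3 1 (-1) 0; rewrite ?oner_eq0 //; first by ring.
have Hu := minors c u cin; have Ha := minors c a cin; have Hb := minors c b cin.
move: Hu Ha Hb; rewrite !inE !eqxx !orbT => /(_ isT) Hu /(_ isT) Ha /(_ isT) Hb.
have : q i c * (q j u + q j a + q j b) = q j c * (q i u + q i a + q i b) by lra.
by rewrite si sj; lra.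
Qed.

End Vertices.
Lemma det3_rot i j k : det3 k i j = det3 i j k.
Proof. by rewrite /det3; ring. Qed.

Lemma det3_swap i j k : det3 k j i = - det3 k i j.
Proof. by rewrite /det3; ring. Qed.

Lemma fset3_rot (I : choiceType) (i j k : I) : [fset k; i; j] = [fset i; j; k].
Proof. by rewrite [RHS]fsetUC fsetUA. Qed.

(* Otherwise [k] and [k'] lie on the same side of the edge [ij], and the two
   triangles overlap. *)
Lemma det3_opposite i j k k' : i != j -> i != k -> j != k -> i != k' -> j != k' ->
  k != k' -> [fset i; j; k] \in K -> [fset i; j; k'] \in K ->
  inside i -> inside j -> inside k -> inside k' -> det3 k i j * det3 k' i j < 0.
Proof.
move=> ij ik jk ik' jk' kk' tK tK' hi hj hk hk'.
have D0 : det3 k i j != 0 by rewrite det3_rot; apply: det3_neq0.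
have D0' : det3 k' i j != 0 by rewrite det3_rot; apply: det3_neq0.
rewrite ltNge le_eqVlt negb_or eq_sym mulf_neq0 //=; apply/negP => DD.
(* By Cramer's rule [la], [mu], [nu] are the barycentric coordinates of [k'] with respect to [i],
   [j], [k]; the sign of [nu] tells the side of the edge [ij]. *)
pose nu := det3 k' i j / det3 k i j.
pose la := det3 k k' j / det3 k i j; pose mu := det3 k i k' / det3 k i j.
have nu0 : 0 < nu.
  have -> : nu = det3 k i j * det3 k' i j / det3 k i j ^+ 2 by rewrite /nu; field.
  by rewrite divr_gt0 // exprn_even_gt0.
have cramer (c : nat) : c \in [fset u; a;
  b] -> q k' c = la * q i c + mu * q j c + nu * q k c.
  move=> cin; have : det3 k i j * q k' c =
      det3 k k' j * q i c + det3 k i k' * q j c + det3 k' i j * q k c.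
    by move: cin; rewrite !inE -orbA => /or3P[]/eqP ->; rewrite /det3; ring.
  by move=> E; apply: (mulfI D0); rewrite E /la /mu /nu; field.
have [si oi] := hi; have [sj oj] := hj; have [sk ok] := hk; have [sk' ok'] := hk'.
have s1 : la + mu + nu = 1.
  have Hu := cramer u; have Ha := cramer a; have Hb := cramer b.
  move: Hu Ha Hb; rewrite !inE !eqxx !orbT => /(_ isT) Hu /(_ isT) Ha /(_ isT) Hb.
  rewrite -sk' Hu Ha Hb -[la]mulr1 -[mu]mulr1 -[nu]mulr1 -{1}si -{1}sj -{1}sk.
  by ring.
clearbody la mu nu.
(* Both [y + e * z] and [y' + e * z'] describe the point reached from the midpoint of [ij] after the
   fraction [e] of the way to [k']. For small [e] it is interior to both triangles. *)
pose y v : R := if v == k then 0 else 2^-1.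
pose z v := if v == k then nu else if v == i then la - 2^-1 else mu - 2^-1.
pose y' v : R := if v == k' then 0 else 2^-1.
pose z' v : R := if v == k' then 1 else - 2^-1.
have half : (0 : R) < 2^-1 by rewrite invr_gt0.
have [|e0 e00 He] := @eventually_pos R _ [fset i; j; k] y z.
  move=> v; rewrite !inE -orbA /y /z => /or3P[]/eqP ->;
    rewrite ?eqxx ?(negPf ik) ?(negPf jk).
  - by left.
  - by left.
  - by right.
have [|e1 e10 He1] := @eventually_pos R _ [fset i; j; k'] y' z'.
  move=> v; rewrite !inE -orbA /y' /z' => /or3P[]/eqP ->;
    rewrite ?eqxx ?(negPf ik') ?(negPf jk').
  - by left.
  - by left.
  - by right; rewrite ltr01.
pose e := Num.min e0 e1.
have ee0 : 0 < e <= e0 by rewrite /e lt_min e00 e10 ge_min lexx.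
have ee1 : 0 < e <= e1 by rewrite /e lt_min e00 e10 ge_min lexx orbT.
have yz : [/\ y i = 2^-1, y j = 2^-1 & y k = 0] /\ [/\ z i = la - 2^-1, z j = mu - 2^-1 &
  z k = nu].
  by rewrite /y /z !eqxx (negPf ik) (negPf jk) [j == i]eq_sym (negPf ij).
have yz' : [/\ y' i = 2^-1, y' j = 2^-1 & y' k' = 0] /\ [/\ z' i = - 2^-1, z' j = - 2^-1 &
  z' k' = 1].
  by rewrite /y' /z' !eqxx (negPf ik') (negPf jk').
have [[yi yj yk] [zi zj zk]] := yz; have [[yi' yj' yk'] [zi' zj' zk']] := yz'.
have C : carried [fset i; j; k] (restr [fset i; j; k] (fun v => y v + e * z v)).
  apply: carried_restr; first exact: He.
  by rewrite big_fset3 // yi yj yk zi zj zk (_ : nu = 1 - la - mu); [field|rewrite -s1;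
    ring].
have C' : carried [fset i; j; k'] (restr [fset i; j; k'] (fun v => y' v + e * z' v)).
  apply: carried_restr; first exact: He1.
  by rewrite big_fset3 // yi' yj' yk' zi' zj' zk'; field.
have [|tt _] := sub_injE tK tK' C C'.
  move=> c; rewrite !comb_restr /comb !big_fset3 // yi yj yk zi zj zk yi' yj' yk' zi' zj'
    zk'.
  have [/cramer ->|cn] := boolP (c \in [fset u; a; b]); first by field.
  by rewrite oi // oj // ok // ok' // !mulr0.
have : k \in [fset i; j; k'] by rewrite -tt !inE eqxx orbT.
by rewrite !inE ![k == _]eq_sym (negPf ik) (negPf jk) eq_sym (negPf kk').
Qed.

(** The outward flux through the edge [e] of [t]. The enumeration order of the two vertices of [e]
    is arbitrary: reversing it changes the sign of both factors. *)
Definition edge_flux (t e : {fset nat}) : R :=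
  let i := nth 0%N e 0 in let j := nth 0%N e 1 in let k := nth 0%N (t `\` e) 0 in
  Num.sg (det3 k i j) * flux i j.

Lemma edge_fluxE i j k : i != j -> i != k -> j != k ->
  edge_flux [fset i; j; k] [fset i; j] = Num.sg (det3 k i j) * flux i j.
Proof.
move=> ij ik jk; rewrite /edge_flux.
have e2 : #|` [fset i; j]| = 2%N by rewrite cardfs2 ij.
have -> : nth 0%N ([fset i; j; k] `\` [fset i; j]) 0 = k.
  rewrite fsetDUl fsetDv fset0U; apply/eqP; rewrite -in_fset1.
  have -> : [fset k] `\` [fset i; j] = [fset k].
    apply/fsetP => v; rewrite !inE; have [->|] := eqVneq v k; rewrite ?andbF //.
    by rewrite ![k == _]eq_sym (negPf ik) (negPf jk).
  by apply: mem_nth; rewrite cardfs1.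
have m0 : nth 0%N [fset i; j] 0 \in [fset i; j] by apply: mem_nth; rewrite e2.
have m1 : nth 0%N [fset i; j] 1 \in [fset i; j] by apply: mem_nth; rewrite e2.
have : nth 0%N [fset i; j] 0 != nth 0%N [fset i; j] 1.
  by rewrite nth_uniq ?fset_uniq // e2.
move: m0 m1; rewrite !in_fset2.
move=> /orP[]/eqP -> /orP[]/eqP ->; rewrite ?eqxx // => _.
rewrite det3_swap sgrN; rewrite /flux; ring.
Qed.

(** Signed area is additive: the triangle is the signed sum of the triangles joining its edges to
    [u]. *)
Lemma flux_sum i j k : inside i -> inside j -> inside k ->
  flux i j + flux j k + flux k i = det3 i j k.
Proof.
move=> [si _] [sj _] [sk _].
have ei : q i u = 1 - q i a - q i b by rewrite -si; ring.
have ej : q j u = 1 - q j a - q j b by rewrite -sj; ring.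
have ek : q k u = 1 - q k a - q k b by rewrite -sk; ring.
by rewrite /det3 /flux ei ej ek; ring.
Qed.

(** The divergence theorem for [x - u] on a single triangle. *)
Lemma total_flux i j k : i != j -> i != k -> j != k -> [fset i; j; k] \in K ->
  inside i -> inside j -> inside k ->
  \sum_(e <- [fset e in K | #|` e| == 2%N] | e `<=` [fset i; j; k])
    edge_flux [fset i; j; k] e = `|det3 i j k|.
Proof.
move=> ij ik jk tK hi hj hk; rewrite big_fset_condE.
have -> : [fset e in [fset e in K | #|` e| == 2%N] | e `<=` [fset i; j; k]] =
    [fset [fset i; j]; [fset j; k]; [fset k; i]].
  apply/fsetP => e; rewrite !inE /= -orbA; apply/idP/idP.
    move=> /andP[/andP[eK /eqP e2] et].
    have t3 : #|` [fset i; j; k]| = 3%N.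
      by rewrite fsetUC cardfsU1 cardfs2 ij !inE negb_or ![k == _]eq_sym ik jk.
    have : #|` [fset i; j; k] `\` e| == 1%N by rewrite cardfsDS // t3 e2.
    move=> /cardfs1P[w tw]; have eE : e = [fset i; j; k] `\ w by rewrite -tw fsetDK.
    have : w \in [fset i; j; k] by apply: (fsubsetP (fsubsetDl _ e)); rewrite tw inE.
    rewrite !inE -orbA => /or3P[]/eqP wE; apply/or3P; rewrite eE wE;
      [constructor 2|constructor 3|constructor 1]; apply/eqP/fsetP => v; rewrite !inE.
    - have [->|//] := eqVneq v i.
      by rewrite /= (negPf ij) (negPf ik).
    - have [->|] := eqVneq v j; last by rewrite /= orbF orbC.
      by rewrite /= (negPf jk) eq_sym (negPf ij).
    - have [->|] := eqVneq v k; last by rewrite /= orbF.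
      by rewrite /= ![k == _]eq_sym (negPf ik) (negPf jk).
  have sub v w : v \in [fset i; j; k] -> w \in [fset i; j; k] -> v != w ->
      ([fset v; w] \in K) && (#|` [fset v; w]| == 2%N) && ([fset v; w] `<=` [fset i; j; k]).
    move=> vt wt vw; rewrite cardfs2 vw eqxx andbT.
    have st : [fset v; w] `<=` [fset i; j; k] by rewrite fsubUset !fsub1set vt.
    by rewrite st andbT; apply: sub_face tK st _; apply/fset0Pn; exists v;
      rewrite !inE eqxx.
  by move=> /or3P[]/eqP ->; apply: sub; rewrite ?inE ?eqxx ?orbT // eq_sym.
rewrite big_fset3.
- have -> : edge_flux [fset i; j; k] [fset j; k] = Num.sg (det3 i j k) * flux j k.
    by rewrite (fset3_rot j k i) edge_fluxE // eq_sym.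
  have -> : edge_flux [fset i; j; k] [fset k; i] = Num.sg (det3 j k i) * flux k i.
    by rewrite -(fset3_rot i j k) edge_fluxE // eq_sym.
  by rewrite edge_fluxE // (det3_rot k i j) (det3_rot i j k) -!mulrDr flux_sum // normrEsg.
- apply/eqP => /fsetP/(_ i); rewrite !inE eqxx (negPf ij) (negPf ik) //.
- apply/eqP => /fsetP/(_ j); rewrite !inE eqxx (negPf jk) [j == i]eq_sym (negPf ij) //.
- apply/eqP => /fsetP/(_ j); rewrite !inE eqxx (negPf jk) [j == i]eq_sym (negPf ij) //.
Qed.

(* The vector field [x - u] has positive divergence and is tangent to the two
   sides through [u], so its flux through the boundary of a union of triangles
   that is closed away from these sides would vanish. *)
Lemma closed_triangles_eq0 (T : complex) : T `<=` K ->
  (forall t, t \in T -> #|` t| = 3%N /\ carrier t = [fset u; a; b]) ->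
  (forall t e, t \in T -> e `<=` t -> #|` e| = 2%N -> a \in carrier e -> b \in carrier e ->
    exists t', [/\ t' \in T, e `<=` t' & t' != t]) ->
  T = fset0.
Proof.
move=> /fsubsetP TK T3 Tcl; apply/eqP/negPn/negP => /fset0Pn[t0 t0T].
have shape t : t \in T -> exists i j k, [/\ i != j, i != k, j != k & t = [fset i; j; k]] /\
    [/\ inside i, inside j & inside k].
  move=> tT; have [t3 ct] := T3 t tT; have [i [j [k [ij ik jk te]]]] := fset3P t3.
  exists i, j, k; split=> //.
  by split; apply: (inside_carrier (TK _ tT) ct); rewrite te !inE eqxx ?orbT.
pose E := [fset e in K | #|` e| == 2%N].
have pos : 0 < \sum_(t <- T) \sum_(e <- E | e `<=` t) edge_flux t e.
  have tpos t : t \in T -> 0 < \sum_(e <- E | e `<=` t) edge_flux t e.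
    move=> tT; have [i [j [k [[ij ik jk te] [hi hj hk]]]]] := shape t tT.
    rewrite te total_flux ?normr_gt0 ?det3_neq0 //; first by rewrite -te TK.
    by rewrite -te TK.
  rewrite (big_fsetD1 t0) //= ltr_pwDl ?tpos // big_seq; apply: sumr_ge0 => t.
  by rewrite !inE => /andP[_ /tpos/ltW].
(* Summed by edges, every contribution is 0: the flux of the edge vanishes, or no triangle of [T]
   contains it, or exactly two do, on opposite sides. *)
move: pos; rewrite (exchange_big_dep xpredT) //= big_seq big1 ?ltxx // => e.
rewrite inE /= => /andP[_ /eqP e2]; have [i [j [ij ee]]] := fset2P e2.
have third t : t \in T -> e `<=` t -> let k := nth 0%N (t `\` e) 0 in [/\ i != k, j != k,
  t = [fset i; j; k] &
    [/\ inside i, inside j & inside k]].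
  move=> tT et; have [t3 ct] := T3 t tT.
  have : #|` t `\` e| == 1%N by rewrite cardfsDS // t3 e2.
  move=> /cardfs1P[k tk]; rewrite tk.
  have -> : nth 0%N [fset k] 0 = k.
    by apply/eqP; rewrite -in_fset1; apply: mem_nth; rewrite cardfs1.
  have ke : k \notin e by move: (fset11 k); rewrite -tk !inE => /andP[].
  have te : t = [fset i; j; k].
    rewrite -ee -tk; apply/fsetP => v; rewrite !inE.
    by case: (boolP (v \in e)) => [/(fsubsetP et) ->|].
  split=> //; try by apply: contraNneq ke => <-; rewrite ee !inE eqxx ?orbT.
  by split; apply: (inside_carrier (TK _ tT) ct); rewrite te !inE eqxx ?orbT.
have [f0|f0] := eqVneq (flux i j) 0.
  rewrite big_seq_cond big1 // => t /andP[tT et].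
  have [ik jk te _] := third t tT et.
  rewrite /= in ik jk te; set k := nth _ _ _ in ik jk te.
  by rewrite te ee edge_fluxE // f0 mulr0.
rewrite big_fset_condE; have [->|/fset0Pn[t1]] := eqVneq [fset t in T | e `<=` t] fset0.
  by rewrite big_seq_fset0.
rewrite !inE /= => /andP[t1T et1].
have eK : e \in K.
  by apply: (sub_face (TK _ t1T) et1); rewrite -cardfs_gt0 e2.
have [ae be'] : a \in carrier e /\ b \in carrier e.
  split; apply: contraNT f0 => /(carrier_out eK) H; rewrite /flux.
    by rewrite !H ?mul0r ?mulr0 ?subr0 // ee !inE eqxx ?orbT.
  by rewrite !H ?mul0r ?mulr0 ?subr0 // ee !inE eqxx ?orbT.
have [t2 [t2T et2 t21]] := Tcl t1 e t1T et1 e2 ae be'.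
pose G t := det3 (nth 0%N (t `\` e) 0) i j.
have fluxE t : t \in T -> e `<=` t -> edge_flux t e = Num.sg (G t) * flux i j.
  move=> tT et; have [] := third t tT et; rewrite /G.
  by set k := nth _ _ _ => ik jk te _; rewrite {1}te ee edge_fluxE.
have opp t t' : t \in T -> t' \in T -> e `<=` t -> e `<=` t' -> t != t' ->
    G t * G t' < 0.
  move=> tT t'T et et' tt'; have [] := third t tT et; have [] := third t' t'T et'.
  rewrite /G; set k := nth _ _ _; set k' := nth _ _ _.
  move=> ik jk te [_ _ hk] ik' jk' te' [hi hj hk'].
  apply: det3_opposite => //; [|by rewrite -te' TK|by rewrite -te TK].
  by apply: contraNneq tt' => kk; rewrite te te' kk.
(* A third triangle is impossible, since among three nonzero numbers two have the same sign. *)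
have -> : [fset t in T | e `<=` t] = [fset t1; t2].
  apply/fsetP => t; rewrite !inE /=; apply/andP/orP; last first.
    by case=> /eqP ->.
  move=> [tT et]; apply/orP; rewrite -[_ || _]negbK negb_or; apply/negP => /andP[tt1 tt2].
  have D1 := opp t t1 tT t1T et et1 tt1; have D2 := opp t t2 tT t2T et et2 tt2.
  have D12 := opp t2 t1 t2T t1T et2 et1 t21.
  have : 0 < (G t * G t1) * (G t * G t2) by rewrite nmulr_rgt0.
  have -> : (G t * G t1) * (G t * G t2) = G t ^+ 2 * (G t2 * G t1) by ring.
  by rewrite ltNge mulr_ge0_le0 ?sqr_ge0 // ltW.
rewrite big_fsetU1 ?inE 1?eq_sym //= big_seq_fset1 !fluxE // -mulrDl.
have := opp t2 t1 t2T t1T et2 et1 t21.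
have [p1|n1|->] := ltrgt0P (G t1); last by rewrite mulr0 ltxx.
  by rewrite pmulr_llt0 // => n2; rewrite gtr0_sg // ltr0_sg // addrN mul0r.
by rewrite nmulr_llt0 // => p2; rewrite ltr0_sg // gtr0_sg // addNr mul0r.
Qed.

End Triangle.

Hypothesis dM : dim_le 2 M.

(** A set [S] of triangles without such an edge is followed along the collapse of [M]. By
    [card_le_carrier] its members lie over triangles, and [closed_triangles_eq0] shows that none
    lies over a removed one, so that no room is left for [S] at the end. *)
Lemma subdivision_has_free_edges : has_free_edges K.
Proof.
move=> S /fsubsetP SK S0 S3; apply: contrapT => nofree.
have cl t e : t \in S -> e `<=` t -> #|` e| = 2%N ->
    exists t', [/\ t' \in S, e `<=` t' & t' != t].
  move=> tS et e2; apply: contrapT => H; apply: nofree; exists e, t; split=> // t' t'S et'.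
  by apply/eqP; rewrite -[_ == _]negbK; apply/negP => tt; apply: H; exists t'.
have car3 t : t \in S -> (3 <= #|` carrier t|)%N.
  by move=> tS; rewrite -(S3 t tS) card_le_carrier // SK.
have step A B : is_complex A -> A `<=` M -> collapses A B ->
    (forall t, t \in S -> carrier t \in A) -> forall t, t \in S -> carrier t \in B.
  move=> cA AM AB; elim: AB cA AM => [X Y XY cX XM SX|//|X Y Z XY IH1 YZ IH2 cX XM SX].
    have [v [m [vm mX vmX fr ->]]] := collapse_facetP cX XY.
    have dvm := dM (fsubsetP XM _ vmX); rewrite cardfsU1 vm add1n ltnS in dvm.
    have ncm t : t \in S -> carrier t != m.
      by move=> /car3; apply: contraTneq => ->; rewrite -ltnNge.
    suff T0 : [fset t in S | carrier t == v |` m] = fset0.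
      move=> t tS; rewrite in_fsetD in_fset2 (negPf (ncm t tS)) SX // andbT /=.
      by apply/negP => ct; have := in_fset0 t; rewrite -T0 !inE /= tS ct.
    apply/eqP/negPn/negP => T0; have /fset0Pn[t0] := T0.
    rewrite inE /= => /andP[t0S /eqP ct0].
    have m2 : #|` m| = 2%N.
      have := car3 t0 t0S; rewrite ct0 cardfsU1 vm add1n ltnS => m2.
      by apply/eqP; rewrite eqn_leq dvm m2.
    have [a [b [ab mab]]] := fset2P m2.
    have [va vb] : v != a /\ v != b.
      by move: vm; rewrite mab !inE negb_or => /andP.
    move/eqP: T0; apply; apply: (closed_triangles_eq0 va vb ab).
    - by apply/fsubsetP => t; rewrite inE /= => /andP[/SK].
    - move=> t; rewrite inE /= => /andP[/S3 -> /eqP ->]; split=> //.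
      by rewrite mab fsetUA.
    move=> t e; rewrite inE /= => /andP[tS /eqP ct] et e2 ae be.
    have [t' [t'S et' tt']] := cl t e tS et e2.
    (* The carrier of [t'] contains the free edge [m] but has at least three vertices, so it is the
       only simplex above [m]. *)
    exists t'; split=> //; rewrite inE /=; apply/andP; split=> //; apply/eqP/fr;
      first exact: SX.
    rewrite fproperEneq eq_sym ncm // mab fsubUset !fsub1set.
    by rewrite !(fsubsetP (carrier_subset et')).
  apply: IH2; [exact: collapses_complex XY cX| |exact: IH1].
  exact: fsubset_trans (collapses_subset XY) XM.
have [t0 t0S] := fset0Pn _ S0; case: colM => _ [p Mp].
have := step _ _ cM (fsubset_refl M) Mp (fun t tS => carrier_in (SK t tS)) t0 t0S.
by rewrite in_fset1 => /eqP c0; have := car3 t0 t0S; rewrite c0 cardfs1.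
Qed.

Hypothesis dK : dim_le 2 K.

Theorem subdivision_collapsible : collapsible K.
Proof.
apply: collapsible_criterion (sub_complex sK) dK _ _ _.
- exact: subdivision_has_free_edges.
- exact: subdivision_connected.
- exact: subdivision_euler_sum.
Qed.

End Subdivision.

(** * Flags of a hyperplane arrangement *)

Section Flags.
Context {R : realType} {E : lmodType R} {J : finType}.
Variables (l : J -> E -> R) (p : nat -> E).
Implicit Types (V s t : {fset nat}).

Definition affine_form (f : E -> R) := forall (s : seq nat) (y : nat -> R) (g : nat -> E),
  \sum_(v <- s) y v = 1 ->
  f (\sum_(v <- s) y v *: g v) = \sum_(v <- s) y v * f (g v).

Hypothesis l_affine : forall j, affine_form (l j).
Hypothesis l_neg : forall j, exists j', forall x, l j' x = - l j x.

(* As the family of forms is closed under negation, a cell of the arrangement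
   is determined by [lab], and faces correspond to inclusion. *)
Definition lab (x : E) : {set J} := [set j | 0 < l j x]%SET.

Definition comparable s := all (fun u => all (fun v =>
  (lab (p u) \subset lab (p v)) || (lab (p v) \subset lab (p u))) s) s.

(** The order complex of the cells represented in [V]: a barycentric subdivision of the arrangement
    in which [p v] replaces the barycenter of its cell. *)
Definition flags V : complex :=
  [fset s in fpowerset V | (s != fset0) && comparable s].

Lemma flagsP V s : reflect [/\ s `<=` V, s != fset0 & forall u v, u \in s -> v \in s ->
    (lab (p u) \subset lab (p v)) || (lab (p v) \subset lab (p u))] (s \in flags V).
Proof.
rewrite !inE /= fpowersetE; apply: (iffP and3P) => -[sV s0 cs]; split=> //.
  by move=> u v us vs; move/allP/(_ u us)/allP/(_ v vs): cs.
by apply/allP => u us; apply/allP => v vs; apply: cs.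
Qed.

Lemma flags_complex V : is_complex (flags V).
Proof.
split; first by apply/flagsP => -[_]; rewrite eqxx.
move=> s t /flagsP[sV _ cs] ts t0; apply/flagsP; split=> //.
  exact: fsubset_trans sV.
by move=> u v /(fsubsetP ts) us /(fsubsetP ts); apply: cs.
Qed.

(** A negative value of a form is a positive value of its negative, so inclusion of labels controls
    negative signs too. *)
Lemma lab_ge0 x y j : lab x \subset lab y -> j \in lab y -> 0 <= l j x.
Proof.
move=> /fintype.subsetP xy; rewrite !inE => jy; rewrite leNgt; apply/negP => jx.
have [j' lj'] := l_neg j; have := xy j'; rewrite !inE !lj' oppr_gt0 => /(_ jx).
by rewrite oppr_gt0 => jy'; have := lt_trans jy jy'; rewrite ltxx.
Qed.

Lemma lab_le0 x y j : lab x \subset lab y -> j \notin lab y -> l j x <= 0.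
Proof.
move=> /fintype.subsetP xy jy; rewrite leNgt; apply: contra jy => jx.
by apply: xy; rewrite inE.
Qed.

(** Forms positive at the largest vertex of a flag are nonnegative at the others, and the remaining
    forms are nonpositive at all of them, so a combination has the label of the largest vertex. The
    weights are not normalized because [flag_coords_unique] subtracts from them. *)
Lemma flag_top V (y : nat -> R) : (forall v, 0 <= y v) ->
  (forall u v, u \in V -> v \in V -> 0 < y u -> 0 < y v ->
    (lab (p u) \subset lab (p v)) || (lab (p v) \subset lab (p u))) ->
  \sum_(v <- V) y v != 0 ->
  exists v, [/\ v \in V, 0 < y v,
    forall u, u \in V -> 0 < y u -> lab (p u) \subset lab (p v) &
    forall j, (j \in lab (p v)) = (0 < \sum_(u <- V) y u * l j (p u))].
Proof.
move=> y0 cy sy; pose S := [fset v in V | 0 < y v].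
have /fset0Pn[v0 v0S] : S != fset0.
  apply: contraNneq sy => S0; rewrite big_seq big1 // => v vV; apply/eqP.
  rewrite eq_le y0 andbT leNgt; apply/negP => yv.
  by have := in_fset0 v; rewrite -S0 !inE vV yv.
have [[v vS] _ /= vmax] := arg_maxnP (fun v : S => #|lab (p (val v))|)
  (erefl (xpredT [` v0S])).
have topv u : u \in V -> 0 < y u -> lab (p u) \subset lab (p v).
  move=> uV yu; have uS : u \in S by rewrite !inE uV.
  move: (vS); rewrite !inE /= => /andP[vV yv].
  case/orP: (cy u v uV vV yu yv) => // vu.
  by have /eqP -> : lab (p v) == lab (p u) by rewrite eqEcard vu; apply: (vmax [` uS]).
move: (vS); rewrite !inE /= => /andP[vV yv].
exists v; split=> // j; have [jv|jv] := boolP (j \in lab (p v)); apply/esym.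
  rewrite (big_fsetD1 v) //= ltr_pwDl //.
    by rewrite mulr_gt0 //; move: jv; rewrite inE.
  rewrite big_seq; apply: sumr_ge0 => u; rewrite !inE => /andP[_ uV].
  have := y0 u; rewrite le_eqVlt => /orP[/eqP <-|yu]; first by rewrite mul0r.
  by rewrite mulr_ge0 // (lab_ge0 (topv u uV yu)).
apply/negbTE; rewrite -leNgt big_seq; apply: sumr_le0 => u uV.
have := y0 u; rewrite le_eqVlt => /orP[/eqP <-|yu]; first by rewrite mul0r.
by rewrite mulr_ge0_le0 // (lab_le0 (topv u uV yu)).
Qed.

Lemma flag_max V s : s \in flags V ->
  exists2 v, v \in s & forall u, u \in s -> lab (p u) \subset lab (p v).
Proof.
move=> /flagsP[_ s0 cs]; have [b0 bo b1] := barycenter_carried (R := R) s0.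
have [|||v [vs _ vmax _]] := @flag_top s (barycenter s).
- by move=> v; have [/b0/ltW//|/bo ->] := boolP (v \in s).
- by move=> u v us vs _ _; apply: cs.
- by rewrite b1 oner_eq0.
by exists v => // u us; apply: vmax => //; apply: b0.
Qed.

(* Both points have the same label, which is that of the top vertex of either
   flag: subtract the smaller of its two weights from both and induct. *)
Lemma flag_coords_unique V (y z : nat -> R) :
  (forall u v, u \in V -> v \in V -> lab (p u) = lab (p v) -> u = v) ->
  (forall v, 0 <= y v) -> (forall v, 0 <= z v) ->
  (forall u v, u \in V -> v \in V -> 0 < y u -> 0 < y v ->
    (lab (p u) \subset lab (p v)) || (lab (p v) \subset lab (p u))) ->
  (forall u v, u \in V -> v \in V -> 0 < z u -> 0 < z v ->
    (lab (p u) \subset lab (p v)) || (lab (p v) \subset lab (p u))) ->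
  \sum_(v <- V) y v = \sum_(v <- V) z v ->
  (forall j, \sum_(v <- V) y v * l j (p v) = \sum_(v <- V) z v * l j (p v)) ->
  forall v, v \in V -> y v = z v.
Proof.
move=> Vinj.
have [n] := ubnP (#|` [fset v in V | y v != 0%R]| + #|` [fset v in V | z v != 0%R]|)%N.
elim: n => // n IH in y z *; move=> yzn y0 z0 cy cz s1 sl.
have [sy|sy] := eqVneq (\sum_(v <- V) y v) 0.
  have zero (w : nat -> R) : (forall v, 0 <= w v) -> \sum_(v <- V) w v = 0 ->
      forall v, v \in V -> w v = 0.
    move=> w0 sw v vV; apply/eqP; rewrite eq_le w0 andbT.
    rewrite -sw (big_fsetD1 v) //= lerDl; exact: sumr_ge0.
  by move=> v vV; rewrite !zero // -s1.
have [v [vV yv _ vE]] := flag_top y0 cy sy.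
have [|w [wV zw _ wE]] := flag_top z0 cz; first by rewrite -s1.
have wv : w = v by apply: Vinj => //; apply/setP => j; rewrite vE wE sl.
subst w.
pose c := Num.min (y v) (z v).
have c0 : 0 < c by rewrite lt_min yv zw.
pose f (w : nat -> R) u := if u == v then w u - c else w u.
have f0 w : (forall u, 0 <= w u) -> c <= w v -> forall u, 0 <= f w u.
  by move=> w0 cw u; rewrite /f; case: eqVneq => [->|_ //]; rewrite subr_ge0.
have fpos w u : (forall u, 0 <= w u) -> 0 < f w u -> 0 < w u.
  move=> w0; rewrite /f; case: eqVneq => // _ H.
  by apply: lt_le_trans H _; rewrite gerBl ltW.
have fsum (F : nat -> R) w : \sum_(u <- V) f w u * F u = \sum_(u <- V) w u * F u - c * F v.
  rewrite (big_fsetD1 v) //= [in RHS](big_fsetD1 v) //= /f eqxx mulrBl addrAC.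
  congr (_ + _ - _); apply: eq_big_seq => u; rewrite !inE => /andP[/negPf -> _] //.
have cyv : c <= y v by rewrite ge_min lexx.
have czv : c <= z v by rewrite ge_min lexx orbT.
have fsupp w : [fset u in V | f w u != 0%R] `<=` [fset u in V | w u != 0%R] \/ w v = 0.
  have [wv0|wv0] := eqVneq (w v) 0; [by right|left].
  apply/fsubsetP => u; rewrite !inE => /andP[-> /=]; rewrite /f.
  by have [->|] := eqVneq u v.
have fsuppD w : w v = c -> [fset u in V | f w u != 0%R] `<` [fset u in V | w u != 0%R].
  move=> wc; have [sub|wv0] := fsupp w; last by rewrite -wc wv0 ltxx in c0.
  rewrite fproperE sub /=; apply/fsubsetPn; exists v; rewrite !inE vV /=.
    by rewrite wc gt_eqF.
  by rewrite /f eqxx wc subrr eqxx.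
have fsuppC w : 0 < w v -> (#|` [fset u in V | f w u != 0%R]| <= #|` [fset u in V | w u !=
  0%R]|)%N.
  by move=> w0; case: (fsupp w) => [|wv0]; [apply: fsubset_leq_card|rewrite wv0 ltxx in w0].
have ffE : forall u, u \in V -> f y u = f z u.
  apply: IH.
  - have : c = y v \/ c = z v by rewrite /c; case: leP; [left|right].
    case=> /esym/fsuppD/fproper_ltn_card lt.
      rewrite -ltnS; apply: leq_trans yzn; rewrite ltnS -addSn.
      exact: leq_add lt (fsuppC z zw).
    rewrite -ltnS; apply: leq_trans yzn; rewrite ltnS -addnS.
    exact: leq_add (fsuppC y yv) lt.
  - exact: f0.
  - exact: f0.
  - by move=> a b aV bV /(fpos _ _ y0) ya /(fpos _ _ y0); apply: cy.
  - by move=> a b aV bV /(fpos _ _ z0) ya /(fpos _ _ z0); apply: cz.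
  - have fs1 w : \sum_(u <- V) f w u = \sum_(u <- V) w u - c.
      rewrite -(eq_bigr _ (fun u _ => mulr1 (f w u))) -(eq_bigr _ (fun u _ => mulr1 (w u))).
      by rewrite (fsum (fun=> 1)) mulr1.
    by rewrite !fs1 s1.
  - by move=> j; rewrite !fsum sl.
move=> u uV; have := ffE u uV; rewrite /f; case: eqVneq => // _; exact: addIr.
Qed.

Lemma affine_form2 f x y (t : R) : affine_form f ->
  f (x + t *: (y - x)) = f x + t * (f y - f x).
Proof.
move=> ff; pose g (v : nat) := if v == 0%N then x else y.
pose c (v : nat) := if v == 0%N then 1 - t else t.
have c1 : \sum_(v <- [:: 0; 1]%N) c v = 1.
  by rewrite !big_cons big_nil /c /= addr0 subrK.
have := ff _ c g c1; rewrite !big_cons !big_nil /c /g /= !addr0.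
have -> : x + t *: (y - x) = (1 - t) *: x + t *: y.
  by rewrite scalerBr scalerBl scale1r -addrA [- _ + _]addrC.
by move=> ->; ring.
Qed.

Lemma carried_sumZ V s y (F : nat -> E) : carried s y -> s `<=` V ->
  \sum_(v <- V) y v *: F v = \sum_(v <- s) y v *: F v.
Proof.
move=> [_ ys _] sV; apply/esym; apply: big_fset_incl => // v _ /ys ->.
by rewrite scale0r.
Qed.

Lemma flags_inj V s t y z :
  (forall u v, u \in V -> v \in V -> lab (p u) = lab (p v) -> u = v) ->
  s \in flags V -> t \in flags V -> carried s y -> carried t z ->
  \sum_(v <- s) y v *: p v = \sum_(v <- t) z v *: p v -> forall v, y v = z v.
Proof.
move=> Vinj /flagsP[sV _ cs] /flagsP[tV _ ct] ys zt eyz.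
have ge0 s' (w : nat -> R) : carried s' w -> forall v, 0 <= w v.
  by move=> [w0 ws _] v; have [/w0/ltW//|/ws ->] := boolP (v \in s').
have inc s' (w : nat -> R) v : carried s' w -> 0 < w v -> v \in s'.
  by move=> [_ ws _]; apply: contraTT => /ws ->; rewrite ltxx.
have big s' w (F : nat -> R) : carried s' w -> s' `<=` V ->
    \sum_(v <- V) w v * F v = \sum_(v <- s') w v * F v by exact: sum_carried.
move=> v; have [vV|vV] := boolP (v \in V); last first.
  have [_ ys0 _] := ys; have [_ zt0 _] := zt.
  by rewrite ys0 ?zt0 //; apply: contra vV; apply/fsubsetP.
apply: (@flag_coords_unique V y z) => //.
- exact: ge0 ys.
- exact: ge0 zt.
- by move=> a b _ _ /(inc _ _ _ ys) aS /(inc _ _ _ ys); apply: cs.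
- by move=> a b _ _ /(inc _ _ _ zt) aS /(inc _ _ _ zt); apply: ct.
- by rewrite (sum_carried1 ys) // (sum_carried1 zt).
move=> j; rewrite (big s) // (big t) //.
have [_ _ y1] := ys; have [_ _ z1] := zt.
by rewrite -(l_affine j p y1) -(l_affine j p z1) eyz.
Qed.

(* The ray from the representative of the cell of [x] through [x] leaves the cell
   in a proper face, where one proceeds by induction. *)
Lemma flags_surj V (Q : set E) :
  (forall x y, Q x -> lab y \subset lab x -> Q y) ->
  (forall x, Q x -> exists2 v, v \in V & lab (p v) = lab x) ->
  (forall x y, Q x -> Q y -> x <> y -> lab x = lab y ->
     exists2 j, j \in lab x & l j x < l j y) ->
  forall x, Q x -> exists s y, [/\ s \in flags V, carried s y,
    x = \sum_(v <- s) y v *: p v & forall v, v \in s -> lab (p v) \subset lab x].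
Proof.
move=> Qdown Qrep Qbnd x.
have [n] := ubnP #|lab x|; elim: n => // n IH in x *; rewrite ltnS => xn Qx.
have [v vV pvx] := Qrep x Qx.
have [xp|xp] := EM (x = p v).
  exists [fset v], (barycenter [fset v]); split.
  - apply/flagsP; split; first by rewrite fsub1set.
      by apply/fset0Pn; exists v; rewrite inE.
    by move=> a b; rewrite !inE => /eqP -> /eqP ->; rewrite subxx.
  - by apply: barycenter_carried; apply/fset0Pn; exists v; rewrite inE.
  - by rewrite big_seq_fset1 /barycenter fset11 cardfs1 invr1 scale1r.
  - by move=> a; rewrite inE => /eqP ->; rewrite pvx.
have Qp : Q (p v) by apply: Qdown Qx _; rewrite pvx.
have [j0 j0x j0l] := Qbnd x (p v) Qx Qp xp (esym pvx).
(* [F j] is the parameter at which the ray meets the hyperplane of [j], for the forms that decrease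
   from [p v] to [x]. [Qbnd], which says that cells are bounded, provides one of them; the smallest
   parameter is where the ray leaves the cell. *)
pose P j := (j \in lab x) && (l j x < l j (p v)).
pose F j := l j (p v) / (l j (p v) - l j x).
have Pj0 : P j0 by rewrite /P j0x.
have [j1 /andP[j1x j1l] jmin] := Order.TotalTheory.arg_minP F Pj0.
pose t := F j1.
have t1 : 1 < t.
  rewrite /t /F ltr_pdivlMr ?subr_gt0 // mul1r gtrBl.
  by move: j1x; rewrite inE.
have t0 : 0 < t by apply: lt_trans t1; rewrite ltr01.
pose x0 := p v + t *: (x - p v).
have lx0 j : l j x0 = l j (p v) + t * (l j x - l j (p v)) by exact: affine_form2.
have x0ge j : j \in lab x -> 0 <= l j x0.
  move=> jx; have jx0 : 0 < l j x by move: jx; rewrite inE.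
  rewrite lx0; have [jl|jl] := ltP (l j x) (l j (p v)); last first.
    have lp : 0 < l j (p v) by move: jx; rewrite -pvx inE.
    by rewrite addr_ge0 ?(ltW lp) // mulr_ge0 ?(ltW t0) // subr_ge0.
  have : t <= F j by apply: jmin; rewrite /P jx jl.
  rewrite /F ler_pdivlMr ?subr_gt0 //; lra.
have j1x0 : l j1 x0 = 0.
  rewrite lx0 /t /F; field; rewrite subr_eq0 gt_eqF //.
have sub : lab x0 \subset lab x.
  apply/fintype.subsetP => j; rewrite inE => jx0; apply/negPn/negP => jx.
  have [j' lj'] := l_neg j.
  have jle : l j x <= 0 by move: jx; rewrite inE -leNgt.
  move: jle; rewrite le_eqVlt => /orP[/eqP jx00|jlt].
    have j'x : j' \notin lab x by rewrite inE lj' jx00 oppr0 ltxx.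
    have jp : l j (p v) = 0.
      move: jx j'x; rewrite -pvx !inE lj' -!leNgt oppr_le0 => a b.
      by apply/eqP; rewrite eq_le a b.
    by move: jx0; rewrite lx0 jp jx00 subrr mulr0 addr0 ltxx.
  have : 0 <= l j' x0 by apply: x0ge; rewrite inE lj' oppr_gt0.
  by rewrite lj' oppr_ge0 leNgt jx0.
have psub : lab x0 \proper lab x.
  apply/properP; split=> //; exists j1 => //; by rewrite inE j1x0 ltxx.
have [|s [y [sV ys x0E sx0]]] := IH x0 _ (Qdown _ _ Qx sub).
  exact: leq_trans (proper_card psub) xn.
have vs : v \notin s.
  apply/negP => /sx0; rewrite pvx => xx0.
  by move: psub; rewrite properE sub xx0.
have [/flagsP[sV' s0 cs] [y0 yo y1]] := (sV, ys).
(* Solving [x0 = p v + t *: (x - p v)] for [x] gives [p v] the weight [1 - t^-1] and [x0] the weight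
   [t^-1]. *)
pose y' u := if u == v then 1 - t^-1 else t^-1 * y u.
have y'v : y' v = 1 - t^-1 by rewrite /y' eqxx.
have y's u : u \in s -> y' u = t^-1 * y u.
  by move=> us; rewrite /y'; case: eqVneq => // uv; rewrite -uv us in vs.
exists (v |` s), y'; split.
- apply/flagsP; split.
  + by rewrite fsubUset fsub1set vV.
  + by apply/fset0Pn; exists v; rewrite fset1U1.
  + move=> a b; rewrite !inE => /orP[/eqP ->|aS] /orP[/eqP ->|bS].
    * by rewrite subxx.
    * by rewrite pvx (fintype.subset_trans (sx0 b bS) sub) orbT.
    * by rewrite pvx (fintype.subset_trans (sx0 a aS) sub).
    * exact: cs.
- split.
  + move=> u; rewrite !inE => /orP[/eqP ->|us].
      by rewrite y'v subr_gt0 invf_lt1.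
    by rewrite y's // mulr_gt0 ?invr_gt0 ?y0.
  + move=> u; rewrite !inE negb_or => /andP[/negPf uv us].
    by rewrite /y' uv yo // mulr0.
  + rewrite big_fsetU1 //= y'v (eq_big_seq (fun u => t^-1 * y u)); last by move=> u us;
      rewrite y's.
    by rewrite -mulr_sumr y1 mulr1 subrK.
- rewrite big_fsetU1 //= y'v (eq_big_seq (fun u => t^-1 *: (y u *: p u))); last first.
    by move=> u us; rewrite y's // scalerA.
  rewrite -scaler_sumr -x0E /x0 scalerDr scalerA mulVf ?gt_eqF // scale1r.
  by rewrite scalerBl scale1r addrA subrK addrC subrK.
- move=> u; rewrite !inE => /orP[/eqP ->|us]; first by rewrite pvx.
  exact: fintype.subset_trans (sx0 u us) sub.
Qed.

Lemma flags_mem V (Q : set E) s y :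
  (forall x y, Q x -> lab y \subset lab x -> Q y) ->
  (forall v, v \in V -> Q (p v)) -> s \in flags V -> carried s y ->
  Q (\sum_(v <- s) y v *: p v).
Proof.
move=> Qdown QV /flagsP[sV s0 cs] ys; have [y0 yo y1] := ys.
have [|||v [vs yv _ vE]] := @flag_top s y.
- by move=> v; have [/y0/ltW//|/yo ->] := boolP (v \in s).
- by move=> u v us vs _ _; apply: cs.
- by rewrite y1 oner_eq0.
apply: (Qdown (p v)); first by apply: QV; apply: (fsubsetP sV).
by apply/fintype.subsetP => j; rewrite vE inE l_affine.
Qed.

Lemma flag_indep V s (y : nat -> R) :
  (forall u v, u \in V -> v \in V -> lab (p u) = lab (p v) -> u = v) ->
  s \in flags V -> \sum_(v <- s) y v = 0 -> \sum_(v <- s) y v *: p v = 0 ->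
  forall v, v \in s -> y v = 0.
Proof.
move=> Vinj sV y0 yp; have /flagsP[_ s0 _] := sV.
have bs := barycenter_carried (R := R) s0; have [b0 _ b1] := bs.
have [|e e0 He] := @eventually_pos R _ s (barycenter s) y; first by move=> v /b0; left.
have ee : 0 < e <= e by rewrite e0 lexx.
have cs : carried s (restr s (fun v => barycenter s v + e * y v)).
  by apply: carried_restr; [apply: He|rewrite big_split /= b1 -mulr_sumr y0 mulr0 addr0].
have H := flags_inj Vinj sV sV bs cs.
move=> v vs; have : barycenter s v = restr s (fun v => barycenter s v + e * y v) v.
  apply: H; rewrite [RHS](eq_big_seq (fun v => barycenter s v *: p v + e *: (y v *: p v))).
    by rewrite big_split /= -scaler_sumr yp scaler0 addr0.
  by move=> w ws; rewrite /restr ws scalerDl scalerA.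
rewrite /restr vs => /esym/eqP; rewrite addrC -subr_eq0 addrK mulf_eq0 gt_eqF //=.
by move/eqP.
Qed.

End Flags.

(** * Dimension of covered simplices *)

Section Dimension.
Context {R : realType} {E : lmodType R}.
Implicit Types (s : {fset nat}) (u : seq E).

Definition affine_hull u (x : E) := exists b : nat -> R,
  \sum_(i < size u) b i = 1 /\ x = \sum_(i < size u) b i *: nth 0 u i.

(** The moment curve on the vertices of index 1, 2, 3; index 0 compensates, so that the coordinates
    sum to 0 if there are at least four vertices. *)
Definition curve (t : R) (k : nat) : R :=
  if k == 0%N then - (t + t ^+ 2 + t ^+ 3) else if (k < 4)%N then t ^+ k else 0.

Definition moment s (t : R) (v : nat) : R := barycenter s v + curve t (index v s).

Lemma curve_le t k : 0 <= t <= 1 -> `|curve t k| <= 3%:R * t.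
Proof.
move=> /andP[t0 t1]; have H i : t ^+ i.+1 <= t by rewrite exprS ler_piMr // exprn_ile1.
have P i : 0 <= t ^+ i by apply: exprn_ge0.
case: k => [|k]; rewrite /curve /=.
  rewrite normrN ger0_norm; last by rewrite !addr_ge0.
  by have := H 1%N; have := H 2%N; lra.
case: ltnP => _; last by rewrite normr0 mulr_ge0.
rewrite ger0_norm //; have := H k; lra.
Qed.

Lemma sum_curve s t : (3 < #|` s|)%N -> \sum_(v <- s) curve t (index v s) = 0.
Proof.
move=> s4; have -> : \sum_(v <- s) curve t (index v s) = \sum_(0 <= i < #|` s|) curve t i.
  rewrite (big_nth 0%N) big_nat [RHS]big_nat; apply: eq_bigr => i /andP[_ ilt].
  by rewrite index_uniq ?fset_uniq.
rewrite (big_cat_nat _ (n := 4)) //= [X in _ + X]big1_seq ?addr0; last first.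
  move=> i /andP[_]; rewrite mem_index_iota => /andP[i4 _].
  by case: i i4 => // i i4; rewrite /curve /= ltnNge i4.
rewrite !big_nat_recr //= big_geq // /curve /= expr1; ring.
Qed.

Lemma moment_sum s t : (3 < #|` s|)%N -> \sum_(v <- s) moment s t v = 1.
Proof.
move=> s4; rewrite big_split /= sum_curve // addr0.
have s0 : s != fset0 by rewrite -cardfs_gt0; apply: ltn_trans s4.
by have [] := barycenter_carried (R := R) s0.
Qed.

Lemma moment_pos s : (3 < #|` s|)%N -> exists2 e : R, 0 < e & forall t, 0 < t <= e ->
  forall v, v \in s -> 0 < moment s t v.
Proof.
move=> s4; have s0 : (0 < #|` s|)%N by apply: ltn_trans s4.
have n0 : (0 : R) < #|` s|%:R by rewrite ltr0n.
(* By [curve_le] a coordinate moves by at most [3 * t], which is then less than the barycentric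
   coordinate at the start. *)
exists ((4%:R * #|` s|%:R)^-1); first by rewrite invr_gt0 mulr_gt0.
move=> t /andP[t0 te] v vs.
have t1 : t <= 1.
  by apply: le_trans te _; rewrite invf_le1 ?mulr_gt0 // -natrM ler1n muln_gt0.
have c3 : `|curve t (index v s)| <= 3%:R * t by apply: curve_le; rewrite ltW.
rewrite /moment /barycenter vs.
have : 3%:R * t < #|` s|%:R^-1.
  by apply: le_lt_trans (_ : 3%:R * (4%:R * #|` s|%:R)^-1 < _);
    [rewrite ler_pM2l|rewrite invfM; lra].
have := ler_norm (- curve t (index v s)); rewrite normrN; lra.
Qed.

(* Each affine plane meets the moment curve in at most three points. *)
Lemma dim_bound (I : eqType) s (g : nat -> E) (F : seq I) (U : I -> seq E) (e : R) :
  (forall y, \sum_(v <- s) y v = 0 -> \sum_(v <- s) y v *: g v = 0 ->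
     forall v, v \in s -> y v = 0) ->
  (forall i, i \in F -> (size (U i) <= 3)%N) -> 0 < e ->
  (forall t, 0 < t <= e -> exists2 i, i \in F &
     affine_hull (U i) (\sum_(v <- s) moment s t v *: g v)) ->
  (#|` s| <= 3)%N.
Proof.
move=> indep F3 e0 cover; rewrite leqNgt; apply/negP => s4.
pose ep n : R := e / n.+1%:R.
have ep0 n : 0 < ep n by rewrite divr_gt0 // ltr0n.
have epe n : 0 < ep n <= e.
  by rewrite ep0 /= ler_pdivrMr ?ltr0n // ler_peMr ?(ltW e0) // ler1n.
have epI : injective ep.
  move=> i j /(mulfI (lt0r_neq0 e0))/invr_inj/eqP; by rewrite eqr_nat eqSS => /eqP.
(* One of the hulls contains points of the curve for infinitely many parameters; four of them are
   used. *)
have [i0 iF inf] := infinite_pigeonhole (fun n => cover (ep n) (epe n)).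
set u := U i0 in inf.
have [n0 _ [b0 B0]] := inf 0%N; have [n1 n01 [b1 B1]] := inf n0.+1.
have [n2 n12 [b2 B2]] := inf n1.+1; have [n3 n23 [b3 B3]] := inf n2.+1.
pose N (i : 'I_4) := nth 0%N [:: n0; n1; n2; n3] i.
pose b (i : 'I_4) := nth b0 [:: b0; b1; b2; b3] i.
have Ninj : injective N.
  have un : uniq [:: n0; n1; n2; n3].
    by rewrite /= !inE; apply/and4P; split=> //; rewrite ?negb_or ?neq_ltn;
      repeat (apply/andP; split); lia.
  by move=> i j /eqP; rewrite /N nth_uniq // => /eqP/val_inj.
have B (i : 'I_4) : \sum_(k < size u) b i k = 1 /\
    \sum_(v <- s) moment s (ep (N i)) v *: g v = \sum_(k < size u) b i k *: nth 0 u k.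
  by case: i => [[|[|[|[|i]]]] ilt]; rewrite /b /N.
pose D : 'M[R]_(4, size u) := \matrix_(i, k) b i k.
have : kermx D != 0.
  rewrite -mxrank_eq0 mxrank_ker -lt0n subn_gt0.
  by apply: leq_ltn_trans (rank_leq_col D) _; rewrite ltnS; apply: F3.
move=> /rowV0Pn[c /sub_kermxP cU c0].
have cUk (k : 'I_(size u)) : \sum_i c 0 i * b i k = 0.
  have := congr1 (fun A : 'rV_(_) => A 0 k) cU; rewrite !mxE => H.
  rewrite -[RHS]H; by apply: eq_bigr => i _; rewrite mxE.
(* The rows of [D] sum to 1, so the linear relation [c] between the four points is an affine one. *)
have sc : \sum_i c 0 i = 0.
  have : \sum_i c 0 i * \sum_(k < size u) b i k = 0.
    under eq_bigr do rewrite mulr_sumr.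
    by rewrite exchange_big big1 // => k _; rewrite cUk.
  move=> H; rewrite -[RHS]H; by apply: eq_bigr => i _; rewrite (B i).1 mulr1.
pose z v := \sum_i c 0 i * moment s (ep (N i)) v.
have z0 v : v \in s -> z v = 0.
  apply: indep.
    rewrite exchange_big -[RHS]sc; apply: eq_bigr => i _.
    by rewrite -mulr_sumr moment_sum // mulr1.
  transitivity (\sum_i c 0 i *: \sum_(v <- s) moment s (ep (N i)) v *: g v).
    under eq_bigr do rewrite scaler_suml; rewrite exchange_big.
    by apply: eq_bigr => i _; rewrite scaler_sumr; apply: eq_bigr => w _; rewrite scalerA.
  under eq_bigr do rewrite (B _).2 scaler_sumr; rewrite exchange_big big1 // => k _.
  under eq_bigr do rewrite scalerA.
  by rewrite -scaler_suml cUk scale0r.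
pose a : 'rV[R]_4 := \row_i ep (N i).
(* Row 0 is [sc]. Row [k] is the coordinate of index [k] of the relation [z], whose barycenter part
   drops out by [sc]. *)
have Va : Vandermonde 4 a *m c^T = 0.
  apply/matrixP => k j; rewrite !mxE ord1 {j}.
  have [k0|k0] := eqVneq (k : nat) 0%N.
    by rewrite -[RHS]sc; apply: eq_bigr => i _; rewrite !mxE k0 expr0 mul1r.
  have ks : (k < #|` s|)%N by apply: leq_trans (ltn_ord k) s4.
  have vs : nth 0%N s k \in s by apply: mem_nth.
  have := z0 _ vs; rewrite /z /moment index_uniq ?fset_uniq //.
  under eq_bigr do rewrite mulrDr.
  rewrite big_split /= -mulr_suml sc mul0r add0r => H.
  rewrite -[RHS]H; apply: eq_bigr => i _.
  by rewrite !mxE /curve (negPf k0) ltn_ord mulrC.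
have detV : Vandermonde 4 a \in unitmx.
  rewrite unitmxE det_Vandermonde unitfE; apply/prodf_neq0 => i _; apply/prodf_neq0 => j ij.
  rewrite !mxE subr_eq0 (inj_eq epI) (inj_eq Ninj).
  by apply: contraTneq ij => ->; rewrite ltnn.
apply/negP: c0; rewrite negbK -trmx_eq0; apply/eqP.
by rewrite -[c^T](mulKmx detV) Va mulmx0.
Qed.

End Dimension.

(** * Affine forms *)

Section Forms.
Context {R : realType} {n : nat}.
Implicit Types (w : 'cV[R]_n * R) (x y : 'rV[R]_n).

Definition form w x : R := (x *m w.1) 0 0 + w.2.

Lemma form_sum_affine (I : Type) (r : seq I) w (b : I -> R) (g : I -> 'rV[R]_n) :
  \sum_(v <- r) b v = 1 ->
  form w (\sum_(v <- r) b v *: g v) = \sum_(v <- r) b v * form w (g v).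
Proof.
move=> b1; rewrite /form mulmx_suml summxE; under [RHS]eq_bigr do rewrite mulrDr.
rewrite big_split /= -mulr_suml b1 mul1r; congr (_ + _).
by apply: eq_bigr => v _; rewrite -scalemxAl mxE.
Qed.

Lemma form_affine w : affine_form (form w).
Proof. by move=> s y g; apply: form_sum_affine. Qed.

Lemma formD w w' x : form (w + w') x = form w x + form w' x.
Proof. by rewrite /form mulmxDr mxE addrACA. Qed.

Lemma formZ (a : R) w x : form (a *: w) x = a * form w x.
Proof. by rewrite /form -scalemxAr mxE mulrDr. Qed.

Lemma formN w x : form (- w) x = - form w x.
Proof. by rewrite /form mulmxN mxE opprD. Qed.

Lemma form_sum (I : Type) (r : seq I) (F : I -> 'cV[R]_n * R) x :
  form (\sum_(i <- r) F i) x = \sum_(i <- r) form (F i) x.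
Proof.
elim: r => [|i r IH]; first by rewrite !big_nil /form mulmx0 mxE addr0.
by rewrite !big_cons formD IH.
Qed.

Lemma form_coord (j : 'I_n) x : form (delta_mx j 0, 0) x = x 0 j.
Proof.
rewrite /form /= addr0 mxE (bigD1 j) //= big1 => [|i ij].
  by rewrite mxE !eqxx mulr1 addr0.
by rewrite mxE (negPf ij) mulr0.
Qed.

Lemma form_const (c : R) x : form (0, c) x = c.
Proof. by rewrite /form mulmx0 mxE add0r. Qed.

(** Affine independence says that the matrix with rows [(g v, 1)] has full row rank; a right inverse
    of it solves for the coefficients of the form. *)
Lemma form_interpolation (I : choiceType) (s : {fset I}) (g : I -> 'rV[R]_n) :
  (forall a : I -> R, \sum_(v <- s) a v = 0 -> \sum_(v <- s) a v *: g v = 0 ->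
     forall v, v \in s -> a v = 0) ->
  forall f : I -> R, exists w, forall v, v \in s -> form w (g v) = f v.
Proof.
move=> indep f; have [->|/fset0Pn[x0 _]] := eqVneq s fset0; first by exists 0.
pose A : 'M[R]_(#|` s|, n + 1) := \matrix_i row_mx (g (nth x0 s i)) 1%:M.
have /row_freeP[B AB] : row_free A.
  rewrite -kermx_eq0; apply/negPn/negP => /rowV0Pn[c /sub_kermxP cA c0].
  pose a v := if insub (index v s) is Some i then c 0 i else 0.
  have aE (i : 'I_(#|` s|)) : a (nth x0 s i) = c 0 i.
    rewrite /a index_uniq ?fset_uniq // insubT //= => ilt.
    by congr (c 0 _); apply: val_inj.
  have AE : c *m A = \sum_(v <- s) a v *: row_mx (g v) 1%:M.
    rewrite mulmx_sum_row (big_nth x0) big_mkord; apply: eq_bigr => i _.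
    by rewrite aE rowK.
  have [a1 a2] : \sum_(v <- s) a v = 0 /\ \sum_(v <- s) a v *: g v = 0.
    move: cA; rewrite AE => H; split.
      have := congr1 (fun M : 'rV_(n + 1) => rsubmx M 0 0) H.
      rewrite linear_sum summxE !mxE => H'; rewrite -[RHS]H'.
      by apply: eq_bigr => v _; rewrite linearZ /= row_mxKr !mxE mulr1.
    have := congr1 (fun M : 'rV_(n + 1) => lsubmx M) H.
    rewrite linear_sum linear0 => H'; rewrite -[RHS]H'.
    by apply: eq_bigr => v _; rewrite linearZ /= row_mxKl.
  apply/negP: c0; rewrite negbK; apply/eqP/rowP => i; rewrite mxE -aE.
  by apply: indep => //; apply: mem_nth.
pose w := B *m \col_(i < #|` s|) f (nth x0 s i).
exists (usubmx w, dsubmx w 0 0) => v vs; rewrite /form /=.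
have ilt : (index v s < #|` s|)%N by rewrite index_mem.
have : (A *m w) (Ordinal ilt) 0 = f v by rewrite mulmxA AB mul1mx mxE nth_index.
rewrite mxE => <-; rewrite big_split_ord /= mxE; congr (_ + _).
  apply: eq_bigr => i _; rewrite !mxE nth_index //.
  by rewrite (unsplitK (inl i : 'I_n + 'I_1)).
by rewrite big_ord1 !mxE nth_index // (unsplitK (inr 0 : 'I_n + 'I_1)) mxE eqxx mul1r.
Qed.

(** Inclusion of labels ([lab_below]), stated for a list so that forms can be added without
    reindexing. *)
Definition below (W : seq ('cV[R]_n * R)) y x :=
  forall w, w \in W -> 0 < form w y -> 0 < form w x.

Section Cut.
Variables (I : choiceType) (s : {fset I}) (g : I -> 'rV[R]_n) (A : seq nat) (f : nat -> I
  -> R).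

Definition simplex : set 'rV[R]_n := [set x | exists a : I -> R,
  [/\ forall v, v \in s -> 0 <= a v, \sum_(v <- s) a v = 1 & x = \sum_(v <- s) a v *: g v]].

(* The signs of the forms in [W] at a point of the simplex determine all faces of
   the simplex and, for [a \in A], the sign of the affine function with values
   [f a] at the vertices; moreover their cells are bounded. *)
Definition cut_by W :=
  [/\ forall x y, below W y x -> simplex x -> simplex y,
      forall x y, simplex x -> simplex y -> x <> y -> below W y x ->
        exists2 w, w \in W & 0 < form w x < form w y &
      forall a b c, a \in A -> \sum_(v <- s) b v = 1 -> \sum_(v <- s) c v = 1 ->
        below W (\sum_(v <- s) b v *: g v) (\sum_(v <- s) c v *: g v) ->
        0 < \sum_(v <- s) b v * f a v -> 0 < \sum_(v <- s) c v * f a v].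

Lemma exists_cut :
  (forall a : I -> R, \sum_(v <- s) a v = 0 -> \sum_(v <- s) a v *: g v = 0 ->
     forall v, v \in s -> a v = 0) ->
  exists W : seq ('cV[R]_n * R), forall W' : seq ('cV[R]_n * R),
    {subset W <= W'} -> cut_by W'.
Proof.
move=> indep; have interp := form_interpolation indep.
have /choice[B HB] : forall v, exists w, forall u, u \in s -> form w (g u) = (u == v)%:R.
  by move=> v; apply: interp.
have /choice[C HC] : forall a, exists w, forall u, u \in s -> form w (g u) = f a u.
  by move=> a; apply: interp.
pose e (j : 'I_n) : 'cV[R]_n * R := (delta_mx j 0, 0) - \sum_(v <- s) g v 0 j *: B v.
pose tau : 'cV[R]_n * R := (0, 1) - \sum_(v <- s) B v.
have BE b v : \sum_(v <- s) b v = 1 -> v \in s -> form (B v) (\sum_(v <- s) b v *: g v) =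
  b v.
  move=> b1 vs; rewrite form_sum_affine // (big_fsetD1 v) //= HB // eqxx mulr1.
  rewrite big_seq big1 ?addr0 // => u; rewrite !inE => /andP[/negPf uv us].
  by rewrite HB // uv mulr0.
have eE j x : form (e j) x = x 0 j - \sum_(v <- s) g v 0 j * form (B v) x.
  rewrite formD form_coord formN form_sum; congr (_ - _).
  by apply: eq_bigr => v _; rewrite formZ.
have tauE x : form tau x = 1 - \sum_(v <- s) form (B v) x.
  by rewrite formD form_const formN form_sum.
pose W0 := tau :: [seq B v | v <- s] ++ [seq e j | j <- enum 'I_n] ++ [seq C a | a <- A].
exists (W0 ++ [seq - w | w <- W0]) => W' sub.
have in0 w : w \in W0 -> w \in W' by move=> wW; apply: sub; rewrite mem_cat wW.
have inN w : w \in W0 -> - w \in W' by move=> wW; apply: sub; rewrite mem_cat map_f // orbT.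
have BW v : v \in s -> B v \in W0 by move=> vs; rewrite inE mem_cat map_f // orbT.
have eW j : e j \in W0 by rewrite inE !mem_cat map_f ?mem_enum // !orbT.
have tW : tau \in W0 by rewrite inE eqxx.
(* The list also contains the negative of [w], so vanishing at [x] passes to points with a smaller
   label. *)
have zero w x y : w \in W0 -> below W' y x -> form w x = 0 -> form w y = 0.
  move=> wW yx wx; apply/eqP; rewrite eq_le !leNgt; apply/andP; split; apply/negP => wy.
    by have := yx w (in0 _ wW) wy; rewrite wx ltxx.
  have := yx _ (inN _ wW); rewrite !formN wx oppr0 ltxx oppr_gt0 => H; exact/notF/H.
split.
- move=> x y yx [a [a0 a1 xE]]; exists (fun v => form (B v) y).
  have sB : \sum_(v <- s) form (B v) y = 1.
    have /eqP : form tau y = 0.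
      apply: zero tW yx _; rewrite tauE xE (eq_big_seq a) ?a1 ?subrr // => v vs.
      exact: BE.
    by rewrite tauE subr_eq0 => /eqP <-.
  split=> // [v vs|].
    rewrite leNgt; apply/negP => By.
    have := yx _ (inN _ (BW v vs)); rewrite !formN oppr_gt0 => /(_ By).
    by rewrite oppr_gt0 xE BE // ltNge a0.
  apply/rowP => j; have /eqP : form (e j) y = 0.
    apply: zero (eW j) yx _; rewrite eE xE summxE -sumrB big_seq big1 // => v vs.
    by rewrite BE // mxE mulrC subrr.
  rewrite eE subr_eq0 summxE => /eqP ->; apply: eq_bigr => v _.
  by rewrite mxE mulrC.
- move=> x y [a [a0 a1 xE]] [b [b0 b1 yE]] xy yx.
  (* The coordinates of both points sum to 1, so for distinct points one of them grows from [x] to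
     [y]. *)
  have [v vs ab] : exists2 v, v \in s & a v < b v.
    apply: contrapT => H; apply: xy; rewrite xE yE; apply: eq_big_seq => v vs.
    have le u : u \in s -> b u <= a u.
      by move=> us; rewrite leNgt; apply/negP => ab; apply: H; exists u.
    suff -> : a v = b v by [].
    apply/eqP; rewrite eq_le le // andbT.
    have := a1; rewrite -b1 (big_fsetD1 v) //= [in RHS](big_fsetD1 v) //= => E.
    have : \sum_(i <- s `\ v) b i <= \sum_(i <- s `\ v) a i.
      by rewrite !big_seq; apply: ler_sum => i; rewrite !inE => /andP[_]; apply: le.
    by move=> H'; rewrite -(lerD2r (\sum_(i <- s `\ v) a i)) E lerD2l.
  exists (B v); first by apply/in0/BW.
  have Bx : form (B v) x = a v by rewrite xE BE.
  have By : form (B v) y = b v by rewrite yE BE.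
  rewrite Bx By ab andbT -Bx; apply: yx; first exact/in0/BW.
  by rewrite By; apply: le_lt_trans (a0 v vs) ab.
- move=> a b c aA b1 c1 bc bp.
  have CW : C a \in W0 by rewrite inE !mem_cat map_f // !orbT.
  have CE d : \sum_(v <- s) d v = 1 -> form (C a) (\sum_(v <- s) d v *: g v) =
      \sum_(v <- s) d v * f a v.
    by move=> d1; rewrite form_sum_affine //; apply: eq_big_seq => v vs; rewrite HC.
  by rewrite -CE //; apply: bc; [apply: in0|rewrite CE].
Qed.

End Cut.
End Forms.

(** * Realizations as geometric complexes *)

Section Realization.
Context {R : realType}.
Implicit Types (s t : {fset nat}) (x : nat -> R^o).

Definition delta (v : nat) : nat -> R^o := fun a => (a == v)%:R.

Lemma delta_inj : injective delta.
Proof.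
move=> u v /(congr1 (fun f => f u)); rewrite /delta eqxx.
by case: eqVneq => // _ /eqP; rewrite oner_eq0.
Qed.

Definition spanned s : {fset (nat -> R^o)} := [fset delta v | v in s].

Lemma big_spanned (V : nmodType) s (F : (nat -> R^o) -> V) :
  \sum_(v <- spanned s) F v = \sum_(v <- s) F (delta v).
Proof. by rewrite /spanned big_imfset //= => u v _ _; apply: delta_inj. Qed.

Lemma sum_delta s (c : nat -> R) :
  \sum_(v <- s) c v *: delta v = (fun a => if a \in s then c a else 0) :> (nat -> R^o).
Proof.
apply/funext => a; rewrite fct_sumE; case: ifP => [aS|aS].
  rewrite (big_fsetD1 a) //= big_seq big1 ?addr0 => [|v].
    by rewrite /delta /GRing.scale /= /GRing.scale /= eqxx mulr1.
  rewrite !inE => /andP[va _]; rewrite /GRing.scale /= /delta /GRing.scale /=.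
  by rewrite eq_sym (negPf va) mulr0.
rewrite big_seq big1 // => v vs; rewrite /GRing.scale /= /delta /GRing.scale /=.
by case: eqVneq => [av|]; [rewrite av vs in aS|rewrite mulr0].
Qed.

Lemma hull_spannedP s x : hull (spanned s) x <->
  [/\ forall v, 0 <= x v, forall v, v \notin s -> x v = 0 & \sum_(v <- s) x v = 1].
Proof.
split.
  move=> [a [a0 a1] ->]; rewrite big_spanned (sum_delta s (a \o delta)) /=.
  rewrite big_spanned in a1.
  have a0' v : v \in s -> 0 <= a (delta v) by move=> vs; apply: a0; apply: in_imfset.
  split=> [v|v /negPf ->//|]; first by case: ifP => // /a0'.
  by rewrite -a1; apply: eq_big_seq => v ->.
(* The weights in [hull] are indexed by vectors; [v0] recovers [v] from [delta v]. *)
move=> [x0 xs x1]; pose v0 (y : nat -> R^o) : nat := xget 0%N [set v | delta v = y].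
have v0E v : v0 (delta v) = v by apply/delta_inj/(@xgetI _ 0%N [set u | delta u = delta v]
  v).
exists (fun y => x (v0 y)).
  split; first by move=> v _; apply: x0.
  by rewrite big_spanned; under eq_bigr do rewrite v0E.
rewrite big_spanned; under eq_bigr do rewrite v0E.
rewrite sum_delta; apply/funext => a; case: ifP => // /negbT; exact: xs.
Qed.

Definition spanned_complex (K : complex) : set {fset (nat -> R^o)} :=
  [set spanned s | s in [set s | s \in K]].

Lemma underlying_spanned K : underlying (spanned_complex K) = realization R K.
Proof.
apply/seteqP; split=> x.
  by move=> [_ [s sK <-]] /hull_spannedP[x0 xs x1]; split=> //; exists s.
move=> [x0 [s sK [xs x1]]]; exists (spanned s); first by exists s.
exact/hull_spannedP.
Qed.

Lemma spanned_independent s : affinely_independent (spanned s).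
Proof.
move=> a; rewrite !big_spanned (sum_delta s (a \o delta)) => _ H v /imfsetP[u /= us ->].
by have := congr1 (fun f : nat -> R^o => f u) H; rewrite /= us.
Qed.

Lemma spannedI s t : (spanned s `&` spanned t)%fset = spanned (s `&` t)%fset.
Proof.
apply/fsetP => y; rewrite inE; apply/andP/imfsetP => /=.
  move=> [/imfsetP[u /= us ->] /imfsetP[v /= vt /delta_inj uv]].
  by exists u => //; rewrite inE us uv vt.
by move=> [u]; rewrite inE => /andP[us ut] ->; split; apply: in_imfset.
Qed.

Lemma spanned_geometric K : is_complex K -> geometric_complex (spanned_complex K).
Proof.
move=> [K0 Kd]; split.
- move=> _ [s sK <-]; split; last exact: spanned_independent.
  have /fset0Pn[v vs] : s != fset0 by apply: contraNneq K0 => <-.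
  by apply/fset0Pn; exists (delta v); apply: in_imfset.
- move=> _ t [s sK <-] ts t0; exists [fset v in s | delta v \in t].
    have /fset0Pn[y yt] := t0.
    have /imfsetP[v /= vs yv] := fsubsetP ts y yt.
    apply: (Kd s) => //; first by apply/fsubsetP => w; rewrite !inE => /andP[].
    by apply/fset0Pn; exists v; rewrite !inE vs -yv.
  apply/fsetP => y; apply/imfsetP/idP => /=.
    by move=> [v]; rewrite !inE => /andP[_ +] ->.
  by move=> yt; have /imfsetP[v /= vs yv] := fsubsetP ts y yt; exists v;
    rewrite // !inE vs -yv.
- move=> _ _ [s sK <-] [t tK <-]; rewrite spannedI; apply/seteqP; split=> x.
    move=> [/hull_spannedP[x0 xs x1] /hull_spannedP[_ xt _]]; apply/hull_spannedP.
    have out v : v \notin s `&` t -> x v = 0 by rewrite inE negb_and => /orP[/xs|/xt].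
    split=> //; rewrite -x1; apply: big_fset_incl => [|v _ /out//]; exact: fsubsetIl.
  move=> /hull_spannedP[x0 xst x1].
  split; apply/hull_spannedP; split=> //.
  + by move=> v vs; apply: xst; rewrite inE negb_and vs.
  + by rewrite -x1; apply/esym/big_fset_incl => [|v _ /xst//]; exact: fsubsetIl.
  + by move=> v vt; apply: xst; rewrite inE negb_and vt orbT.
  + by rewrite -x1; apply/esym/big_fset_incl => [|v _ /xst//]; exact: fsubsetIr.
Qed.

Lemma realization_pl_on {F : lmodType R} K (f : (nat -> R^o) -> F) : is_complex K ->
  (forall s, s \in K -> affine_on (spanned s) f) -> pl_on (realization R K) f.
Proof.
move=> cK fK; exists (spanned_complex K); split.
- by apply: finite_image; apply: finite_fset.
- exact: spanned_geometric.
- exact: underlying_spanned.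
- by move=> _ [s sK <-]; apply: fK.
Qed.

Lemma realization_triangulation K : is_complex K ->
  triangulation (realization R K) K (@id (nat -> R^o)).
Proof.
move=> cK; split=> //; split; last by split=> [//|//|x xK]; exists x.
by apply: realization_pl_on => // s sK a _.
Qed.

End Realization.

Lemma realization_neq0 (R : realType) M : collapsible M -> realization R M !=set0.
Proof.
move=> [cM [v Mv]]; have vM : [fset v] \in M.
  by apply: (fsubsetP (collapses_subset Mv)); rewrite inE.
exists (barycenter [fset v]); apply/realizationP => //; exists [fset v] => //.
by apply: barycenter_carried; apply/fset0Pn; exists v; rewrite inE.
Qed.

(** * Common triangulations *)

(* A piecewise linear parametrization [g] of [Q] by the realization of [M], linear
   on the simplices of [S]; these triangulate the realization of [M], but need
   not subdivide the simplices of [M]. *)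
Section Source.
Context {R : realType} {n : nat}.
Local Notation space := (nat -> R^o).
Variables (M : complex) (g : space -> 'rV[R]_n) (Q : set 'rV[R]_n) (S : seq {fset space}).
Hypotheses (cM : is_complex M) (gQ : set_bij (realization R M) Q g).
Hypothesis gS : geometric_complex [set` S].
Hypothesis uS : underlying [set` S] = realization R M.
Hypothesis aS : forall s, s \in S -> affine_on s g.

(** The arrangement must also decide the signs of these coordinates, so that each flag ends up in a
    single simplex of [M]. *)
Let A : seq nat := \bigcup_(m <- M) m.
Let ev (a : nat) (X : space) : R := X a.

Lemma source_inj X Y : realization R M X -> realization R M Y -> g X = g Y -> X = Y.
Proof. by case: gQ => _ gI _ rX rY; apply: gI; rewrite in_setE. Qed.

Lemma source_hull s X : s \in S -> hull s X -> realization R M X.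
Proof. by move=> sS hX; rewrite -uS; exists s. Qed.

(** A relation among the images of the vertices would let two points of the hull of [s] have the
    same image, against injectivity of [g]. *)
Lemma source_indep s (a : space -> R) : s \in S -> \sum_(v <- s) a v = 0 ->
  \sum_(v <- s) a v *: g v = 0 -> forall v, v \in s -> a v = 0.
Proof.
move=> sS a0 ag; have [/(_ s sS)[s0 sI] _ _] := gS.
have n0 : (0 : R) < #|` s|%:R by rewrite ltr0n cardfs_gt0.
have b1 : \sum_(v <- s) (#|` s|%:R^-1 : R) = 1.
  rewrite big_const_seq count_predT iter_addr_0 -[_ *+ size _]mulr_natr mulVf //.
  exact: lt0r_neq0.
have [|e e0 He] := @eventually_pos R _ s (fun=> #|` s|%:R^-1) a.
  by move=> v _; left; rewrite invr_gt0.
have B0 : barycentric s (fun=> #|` s|%:R^-1) by split=> // v _; rewrite invr_ge0 ltW.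
have B1 : barycentric s (fun v => #|` s|%:R^-1 + e * a v).
  split; first by move=> v vs; apply/ltW/He; rewrite ?e0 ?lexx.
  by rewrite big_split /= b1 -mulr_sumr a0 mulr0 addr0.
apply: sI => //.
have E (F : lmodType R) (h : space -> F) : \sum_(v <- s) (#|` s|%:R^-1 + e * a v) *: h v =
    \sum_(v <- s) #|` s|%:R^-1 *: h v + e *: \sum_(v <- s) a v *: h v.
  rewrite scaler_sumr -big_split; apply: eq_bigr => v _.
  by rewrite scalerDl scalerA.
have : \sum_(v <- s) (#|` s|%:R^-1 + e * a v) *: v = \sum_(v <- s) (#|` s|%:R^-1 : R) *: v.
  apply: source_inj.
  - by apply: (source_hull sS); exists (fun v => #|` s|%:R^-1 + e * a v).
  - by apply: (source_hull sS); exists (fun=> #|` s|%:R^-1).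
  - by rewrite !(aS sS) // E ag scaler0 addr0.
rewrite (E _ id) => /(canRL (addKr _)); rewrite addrC subrr => /eqP.
by rewrite scaler_eq0 gt_eqF //= => /eqP.
Qed.

Lemma source_cut : exists W : seq ('cV[R]_n * R), forall W' : seq ('cV[R]_n * R),
  {subset W <= W'} -> forall s, s \in S -> cut_by s g A ev W'.
Proof.
have /choice[W HW] : forall s, exists W : seq ('cV[R]_n * R), s \in S ->
    forall W' : seq ('cV[R]_n * R), {subset W <= W'} -> cut_by s g A ev W'.
  move=> s; have [sS|_] := boolP (s \in S); last by exists [::].
  have [W HW] := exists_cut A ev (fun a a0 ag => @source_indep s a sS a0 ag).
  by exists W.
exists (flatten [seq W s | s <- S]) => W' sub s sS; apply: HW => // w wW.
by apply: sub; apply/flattenP; exists (W s) => //; apply: map_f.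
Qed.

Lemma simplexP s y : s \in S -> simplex s g y <-> exists2 X, hull s X & y = g X.
Proof.
move=> sS; split=> [[a [a0 a1 ->]]|[_ [a [a0 a1] ->] ->]].
  by exists (\sum_(v <- s) a v *: v); [exists a|rewrite (aS sS)].
by exists a; split=> //; rewrite (aS sS).
Qed.

Lemma source_cover y : Q y <-> exists2 s, s \in S & simplex s g y.
Proof.
case: gQ => gf _ gs; split.
  move=> /gs[X rX <-]; move: rX; rewrite -uS => -[s sS hX]; exists s => //.
  by apply/simplexP => //; exists X.
move=> [s sS /(simplexP _ sS)[X hX ->]]; apply: gf; exact: source_hull hX.
Qed.

Section Arrangement.
Variables (W : seq ('cV[R]_n * R)) (V : {fset nat}) (p : nat -> 'rV[R]_n).
Hypothesis negW : forall w, w \in W -> - w \in W.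
Hypothesis cutW : forall s, s \in S -> cut_by s g A ev W.

Definition arr (j : 'I_(size W)) : 'rV[R]_n -> R := form (nth 0 W j).
Local Notation labW := (lab arr).

Lemma arr_affine j : affine_form (arr j).
Proof. exact: form_affine. Qed.

Lemma arr_neg j : exists j', forall x, arr j' x = - arr j x.
Proof.
pose w : 'cV[R]_n * R := - nth 0 W j.
have jW : w \in W by apply/negW/mem_nth.
have ilt : (index w W < size W)%N by rewrite index_mem.
by exists (Ordinal ilt) => x; rewrite /arr /= nth_index // formN.
Qed.

Lemma lab_below x y : (labW y \subset labW x) <-> below W y x.
Proof.
split=> [/fintype.subsetP yx w wW wy|yx].
  have ilt : (index w W < size W)%N by rewrite index_mem.
  have := yx (Ordinal ilt); rewrite !inE /arr /= nth_index //; exact.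
by apply/fintype.subsetP => j; rewrite !inE; apply: yx; apply: mem_nth.
Qed.

Lemma source_down x y : Q x -> labW y \subset labW x -> Q y.
Proof.
move=> /source_cover[s sS sx] /lab_below yx; apply/source_cover; exists s => //.
by have [H _ _] := cutW sS; apply: H yx sx.
Qed.

Lemma source_bounded x y : Q x -> x <> y -> labW x = labW y ->
  exists2 j, j \in labW x & arr j x < arr j y.
Proof.
move=> /source_cover[s sS sx] xy exy; have [H1 H2 _] := cutW sS.
have yx : below W y x by apply/lab_below; rewrite exy.
have [w wW /andP[wx wxy]] := H2 x y sx (H1 x y yx sx) xy yx.
have ilt : (index w W < size W)%N by rewrite index_mem.
by exists (Ordinal ilt); rewrite ?inE /arr /= nth_index.
Qed.

Hypothesis Vinj : forall u v, u \in V -> v \in V -> labW (p u) = labW (p v) -> u = v.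
Hypothesis QV : forall v, v \in V -> Q (p v).
Hypothesis Vrep : forall x, Q x -> exists2 v, v \in V & labW (p v) = labW x.

Let K := flags arr p V.
(** The position of [v] in the realization of [M], that is the [q] of [subdivides]; on [V] the
    default value is not taken. *)
Definition lift (v : nat) : space := xget (fun=> 0) [set X | realization R M X /\ g X = p
  v].

Lemma liftP v : v \in V -> realization R M (lift v) /\ g (lift v) = p v.
Proof.
move=> vV; case: gQ => _ _ /(_ _ (QV vV))[X rX gX].
exact: (@xgetI _ (fun=> 0) [set X | realization R M X /\ g X = p v] X).
Qed.

Lemma lift_flag s : s \in K -> exists s0 v, [/\ s0 \in S, v \in s,
  forall u, u \in s -> below W (p u) (p v) & forall u, u \in s -> hull s0 (lift u)].
Proof.
move=> sK; have [v vs vmax] := flag_max arr_neg sK.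
have /flagsP[/fsubsetP sV _ _] := sK.
have /source_cover[s0 s0S sv] := QV (sV v vs).
exists s0, v; split=> // [u us|u us]; first exact/lab_below/vmax.
have [H _ _] := cutW s0S.
have /(simplexP _ s0S)[X hX pX] : simplex s0 g (p u).
  by apply: H sv; apply/lab_below/vmax.
have [rl gl] := liftP (sV u us).
by rewrite (source_inj rl (source_hull s0S hX)) // gl.
Qed.

Lemma comb_lift s (y : nat -> R) : s \in K -> carried s y ->
  realization R M (comb lift s y) /\ g (comb lift s y) = \sum_(v <- s) y v *: p v.
Proof.
move=> sK ys; have [s0 [v [s0S _ _ hl]]] := lift_flag sK.
have /flagsP[/fsubsetP sV _ _] := sK; have [y0 _ y1] := ys.
have /choice[B HB] : forall u, exists B : space -> R, u \in s ->
    barycentric s0 B /\ lift u = \sum_(w <- s0) B w *: w.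
  move=> u; have [us|_] := boolP (u \in s); last by exists (fun=> 0).
  by have [B bB lB] := hl u us; exists B.
pose c w := \sum_(u <- s) y u * B u w.
have bc : barycentric s0 c.
  split=> [w ws|].
    rewrite /c big_seq; apply: sumr_ge0 => u us; rewrite mulr_ge0 ?(ltW (y0 u us)) //.
    by have [[B0 _] _] := HB u us; apply: B0.
  rewrite /c exchange_big -[RHS]y1; apply: eq_big_seq => u us.
  by have [[_ B1] _] := HB u us; rewrite -mulr_sumr B1 mulr1.
have exch (F : lmodType R) (h : space -> F) :
    \sum_(w <- s0) c w *: h w = \sum_(u <- s) y u *: \sum_(w <- s0) B u w *: h w.
  under eq_bigr do rewrite scaler_suml; rewrite exchange_big.
  by apply: eq_bigr => u _; rewrite scaler_sumr; apply: eq_bigr => w _; rewrite scalerA.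
have cE : comb lift s y = \sum_(w <- s0) c w *: w.
  rewrite (exch _ id); apply/funext => a; rewrite fct_sumE; apply: eq_big_seq => u us.
  by have [_ ->] := HB u us.
split; first by apply: (source_hull s0S); exists c.
rewrite cE (aS s0S bc) exch; apply: eq_big_seq => u us.
have [_ <-] := liftP (sV u us); have [bB ->] := HB u us; by rewrite (aS s0S bB).
Qed.

Lemma source_subdivides : subdivides M K lift.
Proof.
split.
- exact: flags_complex.
- move=> s sK; have [s0 [v [s0S vs vmax hl]]] := lift_flag sK.
  have /flagsP[/fsubsetP sV _ _] := sK; have [rv gv] := liftP (sV v vs).
  (* The simplex of the largest vertex [v] works for the flag: a coordinate positive at a smaller
     vertex is positive at [v], by the sign clause of [cut_by]. *)
  have [_ [m mM [vm _]]] := rv; exists m => // u a us am.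
  apply/eqP/negPn/negP => lu; have [ru gu] := liftP (sV u us).
  have [u0 [mu muM [umu _]]] := ru.
  have aA : a \in A.
    by apply/bigfcupP; exists mu; rewrite ?muM //; apply: contraNT lu => /umu ->.
  have [_ _ H] := cutW s0S.
  have [b b0 ub] := hl u us; have [c c0 vc] := hl v vs.
  have [[_ b1] [_ c1]] := (b0, c0).
  have := H a b c aA b1 c1.
  have bE (d : space -> R) X : X = \sum_(v <- s0) d v *: v -> \sum_(v <- s0) d v * ev a v
    = X a.
    by move=> ->; rewrite fct_sumE.
  rewrite (bE b _ ub) (bE c _ vc) -(aS s0S b0) -(aS s0S c0) -ub -vc gu gv.
  move=> /(_ (vmax u us)); rewrite vm // ltxx lt_neqAle eq_sym lu u0 => H'; exact/notF/H'.
- move=> s v sK vs; have /flagsP[/fsubsetP sV _ _] := sK.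
  by have [] := liftP (sV v vs).
- move=> s t y z sK tK ys zt E; have [_ gy] := comb_lift sK ys;
    have [_ gz] := comb_lift tK zt.
  apply: (flags_inj arr_affine arr_neg Vinj sK tK ys zt).
  by rewrite -gy -gz; congr g; apply/funext.
- move=> X rX; have QX : Q (g X) by case: gQ => gf _ _; apply: gf.
  have [|s [y [sK ys gE _]]] := flags_surj arr_affine arr_neg source_down Vrep _ QX.
    by move=> a b Qa _; apply: source_bounded.
  exists s, y; split=> // a; have [ry gy] := comb_lift sK ys.
  by rewrite (source_inj rX ry) // gy.
Qed.

End Arrangement.
End Source.

(** * Open stars of cells, connectedness and dimension *)

Section Topology.
Context {R : realType} {n : nat}.

Lemma form_nbhs (w : 'cV[R]_n * R) (x : 'rV[R]_n) : 0 < form w x ->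
  nbhs x [set y | 0 < form w y].
Proof.
(* A form changes by at most the sum of its absolute coefficients times the distance in the sup
   norm; adding 1 makes [c] positive and the estimate strict. *)
move=> wx; pose c := 1 + \sum_j `|w.1 j 0|.
have c0 : 0 < c by rewrite ltr_pwDl // sumr_ge0.
apply/nbhs_ballP; exists (form w x / c); first by rewrite /= divr_gt0.
move=> y [_ xy] /=.
have : form w x - form w y <= \sum_j `|w.1 j 0| * (form w x / c).
  have -> : form w x - form w y = \sum_j (x 0 j - y 0 j) * w.1 j 0.
    rewrite /form !mxE opprD addrACA subrr addr0 -sumrB; apply: eq_bigr => j _.
    by rewrite mulrBl.
  apply: ler_sum => j _; apply: le_trans (ler_norm _) _.
  rewrite normrM mulrC ler_wpM2l //; apply: ltW; exact: xy.
rewrite -mulr_suml => H.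
have : (\sum_j `|w.1 j 0|) * (form w x / c) < form w x.
  by rewrite mulrA ltr_pdivrMr // mulrC ltr_pM2l // /c ltrDr.
lra.
Qed.

Lemma lab_nbhs (W : seq ('cV[R]_n * R)) (x : 'rV[R]_n) :
  nbhs x [set y | lab (arr (W := W)) x \subset lab (arr (W := W)) y].
Proof.
have : \forall y \near x, forall j : 'I_(size W), j \in lab (arr (W := W)) x ->
    j \in lab (arr (W := W)) y.
  apply: (@filter_forall _ _ (fun j y => j \in lab (arr (W := W)) x ->
    j \in lab (arr (W := W)) y) (nbhs x)) => j;
      have [jx|jx] := boolP (j \in lab (arr (W := W)) x); last first.
    by near=> y.
  have := form_nbhs (w := nth 0 W j) (x := x); move: jx; rewrite inE => jx /(_ jx).
  by apply: filterS => y; rewrite inE.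
by apply: filterS => y H; apply/fintype.subsetP.
Unshelve. all: by end_near.
Qed.

Lemma lab_open (W : seq ('cV[R]_n * R)) (Q : set 'rV[R]_n) :
  open (bigcup Q (fun x => [set y | lab (arr (W := W)) x \subset lab (arr (W := W)) y])).
Proof.
apply: bigcup_open => x _; rewrite openE => y /= xy.
apply: filterS (lab_nbhs W y) => z; exact: fintype.subset_trans.
Qed.

(** The points whose label contains that of a point of [Q1] form an open set. If [Q1] and [Q2] were
    disjoint, it would miss [Q2], which is closed under passing to smaller labels; so each of them
    would be open in the connected union. *)
Lemma connected_cover_meet (W : seq ('cV[R]_n * R)) (Q1 Q2 : set 'rV[R]_n) :
  connected (Q1 `|` Q2)%classic -> Q1 !=set0 -> Q2 !=set0 ->
  (forall x y, Q1 x -> lab (arr (W := W)) y \subset lab (arr (W := W)) x -> Q1 y) ->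
  (forall x y, Q2 x -> lab (arr (W := W)) y \subset lab (arr (W := W)) x -> Q2 y) ->
  exists x, Q1 x /\ Q2 x.
Proof.
move=> con n1 [x2 Qx2] down1 down2; apply: contrapT => dis.
pose C Q := bigcup Q (fun x => [set y | lab (arr (W := W)) x \subset lab (arr (W := W)) y]).
have C12 x : C Q1 x -> ~ Q2 x.
  by move=> [y Qy /= yx] Qx; apply: dis; exists y; split=> //; apply: down2 yx.
have C21 x : C Q2 x -> ~ Q1 x.
  by move=> [y Qy /= yx] Qx; apply: dis; exists y; split=> //; apply: down1 yx.
have self Q x : Q x -> C Q x by move=> Qx; exists x => //=; rewrite subxx.
have Q12 : Q1 = (Q1 `|` Q2)%classic.
  apply: con => //.
    exists (C Q1); first exact: lab_open.
    apply/seteqP; split=> x; first by move=> Qx; split; [left|apply: self].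
    by move=> [[//|Qx] /C12].
  exists (~` C Q2); first by apply: open_closedC; apply: lab_open.
  apply/seteqP; split=> x; first by move=> Qx; split; [left|move=> /C21].
  by move=> [[//|Qx] /(_ (self _ _ Qx))].
apply: dis; exists x2; split=> //; by rewrite Q12; right.
Qed.

(* Near an interior point of a simplex of [P], only finitely many planes are
   available to cover it. *)
Lemma flag_card_le3 (P : set 'rV[R]_n) (s : {fset nat}) (p : nat -> 'rV[R]_n) :
  polyhedron_dim P 2 ->
  (forall y : nat -> R, \sum_(v <- s) y v = 0 -> \sum_(v <- s) y v *: p v = 0 ->
     forall v, v \in s -> y v = 0) ->
  (forall y : nat -> R, carried s y -> P (\sum_(v <- s) y v *: p v)) ->
  (#|` s| <= 3)%N.
Proof.
move=> [K0 [gK lK uK dK _]] indep sP; rewrite leqNgt; apply/negP => s4.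
have s0 : s != fset0 by rewrite -cardfs_gt0; apply: ltn_trans s4.
pose x0 := \sum_(v <- s) barycenter s v *: p v.
have [|U nU /finite_seqP[F FE]] := lK x0.
  by rewrite uK; apply: sP; apply: barycenter_carried.
have [e0 e00 pos] := moment_pos (R := R) s4.
have [e1 e10 near] : exists2 e1 : R, 0 < e1 & forall t, 0 < t <= e1 ->
    U (\sum_(v <- s) moment s t v *: p v).
  have /nbhs_ballP[e /= e1 eU] := nU.
  pose c := 1 + \sum_(v <- s) \sum_j `|p v 0 j|.
  have c0 : 0 < c by rewrite ltr_pwDl // sumr_ge0 // => v _; apply: sumr_ge0.
  (* Each weight changes by at most [3 * t], so every coordinate of the point changes by less than
     [4 * t * c]; the bound 1 is for [curve_le]. *)
  exists (Num.min 1 (e / (4%:R * c))); first by rewrite lt_min ltr01 divr_gt0 // mulr_gt0.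
  move=> t /andP[t0]; rewrite le_min => /andP[t1 te]; apply: eU; split=> // i j.
  rewrite /ball /= ord1 {i} !summxE -sumrB.
  apply: le_lt_trans (ler_norm_sum _ _ _) _.
  apply: le_lt_trans (_ : 3%:R * t * \sum_(v <- s) \sum_j `|p v 0 j| < _).
    rewrite mulr_sumr; apply: ler_sum => v _.
    have -> : (barycenter s v *: p v) 0 j - (moment s t v *: p v) 0 j =
        - (curve t (index v s) * p v 0 j) by rewrite !mxE /moment; ring.
    rewrite normrN normrM ler_pM //; first by apply: curve_le; rewrite ltW.
    by rewrite (bigD1 j) //= lerDl sumr_ge0.
  have : 3%:R * t * (\sum_(v <- s) \sum_j `|p v 0 j|) < 4%:R * t * c.
    rewrite /c; have : 0 <= \sum_(v <- s) \sum_j `|p v 0 j|.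
      by apply: sumr_ge0 => v _; apply: sumr_ge0.
    by set S := \sum_(v <- s) _ => S0; nra.
  move/lt_le_trans; apply; move: te; rewrite ler_pdivlMr ?mulr_gt0 //; lra.
move: (s4); rewrite ltnNge => /negP; apply.
apply: (@dim_bound R 'rV[R]_n _ s p F (fun u => enum_fset u) (Num.min e0 e1)) => //.
- move=> u uF; apply: dK.
  have : [set s0 | K0 s0 /\ hull s0 `&` U !=set0] u by rewrite FE.
  by case.
- by rewrite lt_min e00.
move=> t /andP[t0]; rewrite le_min => /andP[te0 te1].
have sE : \sum_(v <- s) moment s t v *: p v = \sum_(v <- s) restr s (moment s t) v *: p v.
  by apply: eq_big_seq => v vs; rewrite /restr vs.
have : P (\sum_(v <- s) moment s t v *: p v).
  rewrite sE; apply: sP; apply: carried_restr; first by apply: pos; rewrite t0.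
  exact: moment_sum.
rewrite -uK => -[u Ku hu]; exists u.
  have : [set` F] u.
    rewrite -FE; split=> //; exists (\sum_(v <- s) moment s t v *: p v); split=> //.
    by apply: near; rewrite t0.
  by [].
have [a [a0 a1] yE] := hu; exists (fun i => a (nth 0 (enum_fset u) i)).
by rewrite yE (big_nth 0) big_mkord; move: a1; rewrite (big_nth 0) big_mkord.
Qed.

(** Each simplex of [M] is covered by the hulls of finitely many sets of at most three points,
    namely the vertices of the simplices of [K], so [dim_bound] applies. *)
Lemma source_dim (M K : complex) (q : nat -> nat -> R) :
  is_complex M -> subdivides M K q -> dim_le 2 K -> dim_le 2 M.
Proof.
move=> cM sK dK m mM; rewrite leqNgt; apply/negP => m4.
have [e e0 pos] := moment_pos (R := R) m4.
move: (m4); rewrite ltnNge => /negP; apply.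
apply: (@dim_bound R (nat -> R^o) _ m delta K (fun s : {fset nat} => [seq (q v : nat ->
  R^o) | v <- s]) e) => //.
- move=> y _; rewrite sum_delta => H v vm.
  by have := congr1 (fun f : nat -> R^o => f v) H; rewrite /= vm.
- by move=> s sK'; rewrite size_map; apply: dK.
move=> t te; have cm : carried m (restr m (moment m t)).
  by apply: carried_restr; [apply: pos|apply: moment_sum].
have [|s [y [sK' [_ _ y1] yE]]] := sub_surj sK (x := restr m (moment m t)).
  by apply/realizationP => //; exists m.
exists s => //.
exists (fun i => y (nth 0%N s i)); rewrite size_map; split.
  by move: y1; rewrite (big_nth 0%N) big_mkord.
rewrite sum_delta; apply/funext => a; rewrite -/(restr m (moment m t) a) yE /comb.
rewrite fct_sumE (big_nth 0%N) big_mkord; apply: eq_bigr => i _.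
by rewrite (nth_map 0%N).
Qed.

End Topology.

(** * Triangulating a union of cells by flags *)

Section Triangulation.
Context {R : realType} {E : lmodType R} {J : finType}.
Variables (l : J -> E -> R) (V : {fset nat}) (p : nat -> E) (P : set E).
Hypothesis l_affine : forall j, affine_form (l j).
Hypothesis l_neg : forall j, exists j', forall x, l j' x = - l j x.
Hypothesis Vinj : forall u v, u \in V -> v \in V -> lab l (p u) = lab l (p v) -> u = v.
Hypothesis PV : forall v, v \in V -> P (p v).
Hypothesis Vrep : forall x, P x -> exists2 v, v \in V & lab l (p v) = lab l x.
Hypothesis Pdown : forall x y, P x -> lab l y \subset lab l x -> P y.
Hypothesis Pbnd : forall x y, P x -> P y -> x <> y -> lab l x = lab l y ->
  exists2 j, j \in lab l x & l j x < l j y.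

Lemma flags_triangulation :
  triangulation P (flags l p V) (fun y : nat -> R^o => \sum_(v <- V) y v *: p v).
Proof.
have cK := flags_complex l p V.
have sumE s (y : nat -> R) : s \in flags l p V -> carried s y ->
    \sum_(v <- V) y v *: p v = \sum_(v <- s) y v *: p v.
  by move=> /flagsP[sV _ _] ys; apply: carried_sumZ.
split=> //; split.
  apply: realization_pl_on => // s sK a _.
  under eq_bigr do rewrite fct_sumE scaler_suml.
  rewrite exchange_big; apply: eq_bigr => w _; rewrite scaler_sumr.
  by apply: eq_bigr => v _; rewrite scalerA.
split.
- move=> y /(realizationP _ cK)[s sK ys]; rewrite /= (sumE s) //.
  exact: flags_mem PV sK ys.
- move=> y z; rewrite !in_setE => /(realizationP _ cK)[s sK ys] /(realizationP _ cK)[t tK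
    zt].
  rewrite (sumE s) // (sumE t) // => yz; apply/funext.
  exact: (flags_inj l_affine l_neg Vinj sK tK ys zt yz).
- move=> x Px; have [s [y [sK ys xE _]]] := flags_surj l_affine l_neg Pdown Vrep Pbnd Px.
  exists y; last by rewrite (sumE s).
  by apply/realizationP => //; exists s.
Qed.

End Triangulation.

Section Representatives.
Context {R : realType} {E : lmodType R} {J : finType}.

Lemma exists_representatives (l : J -> E -> R) (P : set E) :
  exists (V : {fset nat}) (p : nat -> E), [/\ forall v, v \in V -> P (p v),
    forall u v, u \in V -> v \in V -> lab l (p u) = lab l (p v) -> u = v &
    forall x, P x -> exists2 v, v \in V & lab l (p v) = lab l x].
Proof.
(* A cell is numbered by the rank of its label, so that distinct vertices represent distinct
   cells. *)
pose C v := [set x | P x /\ enum_rank (lab l x) = v :> nat].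
pose V := [fset v in iota 0 #|{set J}| | `[< C v !=set0 >]].
pose p v := xget 0 (C v).
have pC v : v \in V -> C v (p v).
  by rewrite !inE => /andP[_ /asboolP[x Cx]]; apply: xgetI Cx.
exists V, p; split.
- by move=> v /pC[].
- by move=> u v /pC[_ eu] /pC[_ ev] uv; rewrite -eu -ev uv.
move=> x Px; pose v : nat := enum_rank (lab l x).
have vV : v \in V.
  by rewrite !inE /= mem_iota /= ltn_ord; apply/asboolP; exists x.
by exists v => //; have [_ /val_inj/enum_rank_inj] := pC v vV.
Qed.

End Representatives.

Theorem proposition2p10 (R : realType) (n : nat) (P : set 'rV[R]_n)
    (polP : polyhedron P) (cptP : compact P) (conP : connected P)
    (dimP : polyhedron_dim P 2) (catP : plgcat P = 2%N) :
  exists (G : complex) (v1 v2 : nat),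
    [/\ graph G, v1 != v2, [fset v1] \notin G, [fset v2] \notin G
      & pl_deforms 3 P (realization R (suspension v1 v2 G))].
Proof.
(* The default value in [plgcat] is 0, so the value 2 comes from an actual cover. *)
have [Q [QP PE]] : pl_collapsible_cover P 2.
  move: catP; rewrite /plgcat; case: xgetP => [k -> [+ _] k2|//].
  by rewrite k2.
have [_ [M1 [g1 [[cM1 [[S1' [/finite_seqP[S1 ->] gS1 uS1 aS1]] gQ1]] col1]]]] := QP ord0.
have [_ [M2 [g2 [[cM2 [[S2' [/finite_seqP[S2 ->] gS2 uS2 aS2]] gQ2]] col2]]]] := QP ord_max.
have {PE} PE : P = (Q ord0 `|` Q ord_max)%classic.
  rewrite PE; apply/seteqP; split=> [x [[[|[|//]] i2] _ Qx]|x [Qx|Qx]].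
  - by left; rewrite (_ : ord0 = Ordinal i2) //; apply: val_inj.
  - by right; rewrite (_ : ord_max = Ordinal i2) //; apply: val_inj.
  - by exists ord0.
  - by exists ord_max.
move: (Q ord0) (Q ord_max) gQ1 gQ2 PE => Q1 Q2 gQ1 gQ2 {QP}PE.
have [W1 HW1] := source_cut gQ1 gS1 uS1 aS1.
have [W2 HW2] := source_cut gQ2 gS2 uS2 aS2.
pose W0 := W1 ++ W2; pose W := W0 ++ [seq - w | w <- W0].
have negW w : w \in W -> - w \in W.
  rewrite [w \in W]mem_cat [- w \in W]mem_cat => /orP[wW|/mapP[w' w'W ->]].
    by apply/orP; right; apply: map_f.
  by rewrite opprK; apply/orP; left.
have cut1 s : s \in S1 -> cut_by s g1 (\bigcup_(m <- M1) m)%fset (fun a X => X a) W.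
  by apply: HW1 => w wW; rewrite !mem_cat wW.
have cut2 s : s \in S2 -> cut_by s g2 (\bigcup_(m <- M2) m)%fset (fun a X => X a) W.
  by apply: HW2 => w wW; rewrite !mem_cat wW orbT.
pose l := arr (W := W).
have l_aff j : affine_form (l j) := arr_affine j.
have l_neg := arr_neg negW.
have down1 x y : Q1 x -> lab l y \subset lab l x -> Q1 y 
  by exact: (source_down gQ1 uS1 aS1 cut1).
have down2 x y : Q2 x -> lab l y \subset lab l x -> Q2 y 
  by exact: (source_down gQ2 uS2 aS2 cut2).
have downP x y : P x -> lab l y \subset lab l x -> P y.
  by rewrite PE => -[/down1 H /H|/down2 H /H]; [left|right].
have bndP x y : P x -> P y -> x <> y -> lab l x = lab l y ->
    exists2 j, j \in lab l x & l j x < l j y.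
  rewrite PE => -[Qx|Qx] _ xy exy.
    exact: (source_bounded gQ1 uS1 aS1 cut1).
  exact: (source_bounded gQ2 uS2 aS2 cut2).
have [V [p [PV Vinj Vrep]]] := exists_representatives l P.
have indepK s (y : nat -> R) : s \in flags l p V -> \sum_(v <- s) y v = 0 ->
    \sum_(v <- s) y v *: p v = 0 -> forall v, v \in s -> y v = 0.
  exact: flag_indep Vinj.
have dK : dim_le 2 (flags l p V).
  move=> s sK; apply: (flag_card_le3 (p := p) dimP); first by move=> y; apply: indepK.
  by move=> y ys; apply: flags_mem PV sK ys.
(* The same representatives serve [P], [Q1] and [Q2], which makes the flags of each part a
   subcomplex of those of [P]. *)
pose part (Qi : set 'rV[R]_n) := [fset v in V | `[< Qi (p v) >]].
have partP Qi v : reflect (v \in V /\ Qi (p v)) (v \in part Qi).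
  by rewrite !inE; apply: (iffP andP) => -[vV /asboolP].
have partK Qi : flags l p (part Qi) `<=` flags l p V.
  apply/fsubsetP => s /flagsP[sV s0 cs]; apply/flagsP; split=> //.
  by apply: fsubset_trans sV _; apply/fsubsetP => v /partP[].
have partinj Qi u v : u \in part Qi -> v \in part Qi -> lab l (p u) = lab l (p v) -> u = v.
  by move=> /partP[uV _] /partP[vV _]; apply: Vinj.
have partQ Qi v : v \in part Qi -> Qi (p v) by move=> /partP[].
have partrep (Qi : set 'rV[R]_n) : (forall x, Qi x -> P x) ->
    (forall x y, Qi x -> lab l y \subset lab l x -> Qi y) ->
    forall x, Qi x -> exists2 v, v \in part Qi & lab l (p v) = lab l x.
  move=> QP Qd x Qx; have [v vV vx] := Vrep x (QP x Qx); exists v => //.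
  by apply/partP; split=> //; apply: (Qd x) => //; rewrite vx.
have QP1 x : Q1 x -> P x by rewrite PE; left.
have QP2 x : Q2 x -> P x by rewrite PE; right.
have sub1 := source_subdivides gQ1 uS1 aS1 negW cut1 (partinj Q1) (partQ Q1)
  (partrep Q1 QP1 down1).
have sub2 := source_subdivides gQ2 uS2 aS2 negW cut2 (partinj Q2) (partQ Q2)
  (partrep Q2 QP2 down2).
pose K1 := flags l p (part Q1); pose K2 := flags l p (part Q2).
have d1 : dim_le 2 K1 := dim_le_subset (partK Q1) dK.
have d2 : dim_le 2 K2 := dim_le_subset (partK Q2) dK.
have dM1 := source_dim cM1 sub1 d1; have dM2 := source_dim cM2 sub2 d2.
have colK1 : collapsible K1 := subdivision_collapsible cM1 sub1 col1 dM1 d1.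
have colK2 : collapsible K2 := subdivision_collapsible cM2 sub2 col2 dM2 d2.
have freeK2 : has_free_edges K2 := subdivision_has_free_edges cM2 sub2 col2 dM2.
have n1 : Q1 !=set0.
  by have [X rX] := realization_neq0 R col1; have [gf _ _] := gQ1; exists (g1 X); apply: gf.
have n2 : Q2 !=set0.
  by have [X rX] := realization_neq0 R col2; have [gf _ _] := gQ2; exists (g2 X); apply: gf.
have [x [Qx1 Qx2]] : exists x, Q1 x /\ Q2 x.
  by apply: (connected_cover_meet (W := W)) => //; rewrite -PE.
have K12 : K1 `&` K2 != fset0.
  have [v vV vx] := Vrep x (QP1 x Qx1); apply/fset0Pn; exists [fset v].
  have fv Qi : (forall x y, Qi x -> lab l y \subset lab l x -> Qi y) -> Qi x ->
      [fset v] \in flags l p (part Qi).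
    move=> Qd Qx; apply/flagsP; split.
    - by rewrite fsub1set; apply/partP; split=> //; apply: (Qd x) => //; rewrite vx.
    - by apply/fset0Pn; exists v; rewrite inE.
    - by move=> a b; rewrite !inE => /eqP -> /eqP ->; rewrite subxx.
  by rewrite inE; apply/andP; split; apply: fv.
have KE : flags l p V = K1 `|` K2.
  apply/fsetP => s; rewrite inE; apply/idP/orP => [sK|[]]; try exact: (fsubsetP (partK _)).
  (* A flag belongs to whichever part contains its largest vertex, as the parts are closed under
     passing to smaller labels. *)
  have [v vs vmax] := flag_max l_neg sK; have /flagsP[sV s0 cs] := sK.
  have fs Qi : (forall x y, Qi x -> lab l y \subset lab l x -> Qi y) -> Qi (p v) ->
      s \in flags l p (part Qi).
    move=> Qd Qv; apply/flagsP; split=> //; apply/fsubsetP => u us; apply/partP.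
    by split; [apply: (fsubsetP sV)|apply: Qd Qv (vmax u us)].
  have := PV v (fsubsetP sV v vs); rewrite PE => -[Qv|Qv]; [left|right]; exact: fs.
have [G [v1 [v2 [gG v12 vG1 vG2 [cS KS]]]]] := deforms_suspension d1 d2 colK1 colK2 freeK2
  K12.
exists G, v1, v2; split=> //.
exists (flags l p V), (fun y : nat -> R^o => \sum_(v <- V) y v *: p v).
exists (suspension v1 v2 G), id; split.
- exact: flags_triangulation.
- exact: realization_triangulation.
- by rewrite KE.
Qed.
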